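(* There is a constant $A$, independent of $N$, such that for every positive integer $N$ and all $f \in L^1(\mathbb{T}^N)$, $$\|Mf\|_1^* \leq A\, \|f\|_1,$$ where $M$ is the maximal operator $$M(f) = \sup_{1\le n\le N}\left|\sum_{j=1}^n H_j(d_j(f))\right|.$$
   Context: $\mathbb{T}$ is the circle group, $\mathbb{T}^N$ the product of $N$ copies of $\mathbb{T}$, and $P$ the normalized Lebesgue measure on $\mathbb{T}^N$; $\|f\|_1$ is the norm of $L^1(\mathbb{T}^N)=L^1(\mathbb{T}^N,P)$. For a measurable function $g$ on $\mathbb{T}^N$, $\|g\|_1^* = \sup_{y>0} y\,P(\{x\in\mathbb{T}^N : |g(x)|>y\})$. Let $\mathcal{F}_n$ be the $\sigma$-algebra on $\mathbb{T}^N$ generated by the first $n$ coordinate functions ($\mathcal{F}_0$ is trivial). For $f\in L^1(\mathbb{T}^N)$ let $d_0(f)=\mathbb{E}(f|\mathcal{F}_0)=\int_{\mathbb{T}^N} f\,dP$ and, for $j=1,\dots,N$, $d_j(f)=\mathbb{E}(f|\mathcal{F}_j)-\mathbb{E}(f|\mathcal{F}_{j-1})$. For $j=1,\dots,N$, $H_j$ is the one-dimensional conjugate function operator in the $j$-th variable. On $L^2(\mathbb{T}^N)$ it is given by the multiplier relation $\widehat{H_j(f)}(z_1,\dots,z_N) = -i\,\mathrm{sgn}(z_j)\,\widehat{f}(z_1,\dots,z_N)$ for all $(z_1,\dots,z_N)\in\mathbb{Z}^N$ (with $\mathrm{sgn}(0)=0$). By Kolmogorov's theorem $H_j$ is of weak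 type $(1,1)$, and on $L^1(\mathbb{T}^N)$ it denotes the resulting extension, continuous from $L^1(\mathbb{T}^N)$ to weak $L^1$ (equivalently, the usual almost everywhere defined conjugate function in the $j$-th variable). The operators $H_j$ and $d_j$ commute on $L^2(\mathbb{T}^N)$. *)

(* Defs.v *)
From HB Require Import structures.
From mathcomp Require Import all_boot all_order all_algebra.
From mathcomp Require Import complex.
From mathcomp Require Import all_classical all_reals all_analysis.
From mathcomp Require Import measurable_realfun.
Set Implicit Arguments.
Unset Strict Implicit.
Unset Printing Implicit Defensive.
Import Order.TTheory GRing.Theory Num.Theory.
Import numFieldNormedType.Exports.
Local Open Scope classical_set_scope.
Local Open Scope ring_scope.

Notation ReC := (@mathcomp.real_closed.complex.Re _).
Notation ImC := (@mathcomp.real_closed.complex.Im _).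
Notation modC := ComplexField.Normc.normc.

Section complex_measurable.
Variable R : realType.

Definition complex_pair (z : R[i]) : R * R := (ReC z, ImC z).

HB.instance Definition _ := isPointed.Build R[i] 0.

(* Borel sets of R[i], transported from R * R *)
Let CT : measurableType _ := g_sigma_algebra_preimageType complex_pair.
HB.instance Definition _ := isMeasurable.Build default_measure_display R[i]
  (@measurable0 _ CT) (@measurableC _ CT) (@bigcupT_measurable _ CT).

Lemma measurable_complex d (T : measurableType d) (f : T -> R[i]) :
  measurable_fun setT (fun x => ReC (f x)) ->
  measurable_fun setT (fun x => ImC (f x)) ->
  measurable_fun setT f.
Proof.
move=> mRe mIm _ _ [B mB <-]; rewrite !setTI -comp_preimage.
have h : measurable_fun setT (complex_pair \o f) by exact: measurable_fun_pair.
by rewrite -[X in measurable X]setTI; exact: h.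
Qed.

End complex_measurable.

Section circle.
Variable R : realType.

Record circle := Circle { circle_val :> R[i]; _ : `|circle_val| == 1 }.
HB.instance Definition _ := [isSub for circle_val].
HB.instance Definition _ := [Choice of circle by <:].

Definition circle1 : circle := Circle (introT eqP (normr1 R[i])).
HB.instance Definition _ := isPointed.Build circle circle1.

Let CT : measurableType _ := g_sigma_algebra_preimageType circle_val.
HB.instance Definition _ := isMeasurable.Build default_measure_display circle
  (@measurable0 _ CT) (@measurableC _ CT) (@bigcupT_measurable _ CT).

Lemma circle_exp_norm (t : R) :
  `|cos (2 * pi * t) +i* sin (2 * pi * t)|%C == 1.
Proof. by rewrite normc_def /= cos2Dsin2 sqrtr1. Qed.

(* exp(2 i pi t) *)
Definition circle_exp (t : measurableTypeR R) : circle := Circle (circle_exp_norm t).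

Lemma measurable_circle_exp : measurable_fun setT circle_exp.
Proof.
move=> _ _ [B mB <-]; rewrite !setTI -comp_preimage.
have mt : measurable_fun setT (fun t : R => 2 * pi * t).
  exact: mulrl_measurable.
have h : measurable_fun setT (circle_val \o circle_exp).
  apply: measurable_complex => /=; apply: (measurableT_comp _ mt);
  apply: continuous_measurable_fun; [exact: continuous_cos|exact: continuous_sin].
by rewrite -[X in measurable X]setTI; exact: h.
Qed.

HB.instance Definition _ :=
  isMeasurableFun.Build _ _ _ _ circle_exp measurable_circle_exp.

(* normalized Lebesgue measure on the circle *)
Definition circle_prob : probability circle R :=
  distribution (uniform_prob (@ltr01 R)) circle_exp.

End circle.

Section tuple_prob.
Context d (T : measurableType d) (R : realType) (mu : probability T R).

Definition tuple_cons n (x : T * n.-tuple T) : n.+1.-tuple T :=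
  [tuple of x.1 :: x.2].

Lemma measurable_tuple_cons n : measurable_fun setT (@tuple_cons n).
Proof. exact: measurable_cons. Qed.

HB.instance Definition _ n :=
  isMeasurableFun.Build _ _ _ _ (@tuple_cons n) (@measurable_tuple_cons n).

(* n-fold product of mu with itself *)
Fixpoint tuple_prob n : probability (n.-tuple T) R :=
  match n with
  | 0 => dirac [tuple]
  | n'.+1 => distribution (mu \x tuple_prob n')%E (@tuple_cons n')
  end.

End tuple_prob.

Section complex_L1.
Context d (T : measurableType d) (R : realType) (P : probability T R).
Implicit Types (f g : T -> R[i]) (G : set (set T)) (D : set T).
Local Open Scope ereal_scope.

Definition L1norm f : \bar R := \int[P]_x (modC (f x))%:E.

Definition inL1 f := measurable_fun setT f /\ L1norm f < +oo.

Definition inL2 f :=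
  measurable_fun setT f /\ \int[P]_x ((modC (f x)) ^+ 2)%:E < +oo.

Definition weakL1norm (h : T -> R) : \bar R :=
  ereal_sup [set y%:E * P [set x | (`|h x| > y)%R] | y in [set y : R | (0 < y)%R]].

Definition Cintegral D f : R[i] :=
  ((\int[P]_(x in D) ReC (f x)) +i* (\int[P]_(x in D) ImC (f x)))%R%C.

Definition is_condexp G f g :=
  [/\ (forall B, measurable B -> G (g @^-1` B)),
      inL1 g
    & forall D, G D -> Cintegral D g = Cintegral D f].

(* an arbitrary version of E(f | G) *)
Definition condexp G f : T -> R[i] := xget (cst 0%R) [set g | is_condexp G f g].

End complex_L1.

Section torus.
Variables (R : realType) (N : nat).

Definition torus := (N.-tuple (circle R))%type.
Definition torus_prob : probability torus R := tuple_prob (circle_prob R) N.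
Local Notation P := torus_prob.
Implicit Types (f g : torus -> R[i]) (j : 'I_N).

Definition coord_salgebra (n : nat) : set (set torus) :=
  <<s \bigcup_(i in [set i : 'I_N | (i < n)%N])
        preimage_set_system setT (fun x : torus => tnth x i) measurable >>.

Definition mdiff (j : nat) f : torus -> R[i] :=
  match j with
  | 0 => condexp P (coord_salgebra 0) f
  | j'.+1 => condexp P (coord_salgebra j'.+1) f \- condexp P (coord_salgebra j') f
  end.

Definition torus_char (z : 'I_N -> int) (x : torus) : R[i] :=
  \prod_(i < N) (circle_val (tnth x i)) ^ (z i).

Definition fourier_coef f (z : 'I_N -> int) : R[i] :=
  Cintegral P setT (fun x => f x * (torus_char z x)^*)%C.

Definition conjugate_L2 j f g :=
  [/\ inL2 P f, inL2 P g
    & forall z : 'I_N -> int,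
        fourier_coef g z = - 'i%C * (Num.sg (z j))%:~R * fourier_coef f z].

(* g is a limit in weak L^1 of conjugates of L^2 functions converging to f in
   L^1. By Kolmogorov's weak type (1, 1) theorem, every f in L^1 has such a g,
   unique up to a null set. *)
Definition conjugate_L1 j f g :=
  measurable_fun setT g /\
  exists u v : nat -> torus -> R[i],
    [/\ forall k, conjugate_L2 j (u k) (v k),
        L1norm P (u k \- f) @[k --> \oo] --> 0%E
      & weakL1norm P (fun x => modC (v k x - g x)) @[k --> \oo] --> 0%E].

Definition conjugate j f : torus -> R[i] :=
  xget (cst 0) [set g | conjugate_L1 j f g].

Definition maximal_op f (x : torus) : R :=
  (* n and j count from 0 here: coordinate j carries d_(j + 1) *)
  \big[Num.max/0]_(n < N)
    modC (\sum_(j < N | (j <= n)%N) conjugate j (mdiff j.+1 f) x).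

End torus.

(* Main.v *)
Require Import Defs.
From HB Require Import structures.
From mathcomp Require Import all_boot all_order all_algebra.
From mathcomp Require Import complex.
From mathcomp Require Import all_classical all_reals all_analysis.
From mathcomp Require Import measurable_realfun.
From mathcomp Require Import ring lra.
Set Implicit Arguments.
Unset Strict Implicit.
Unset Printing Implicit Defensive.
Import Order.TTheory GRing.Theory Num.Theory.
Import numFieldNormedType.Exports.
Local Open Scope classical_set_scope.
Local Open Scope ring_scope.

(** Everything is proved first for trigonometric polynomials f with f >= 0. Write
    E_n f for the conditional expectation on the first n coordinates and T_n f for
    the sum of H_j (d_j f) over j <= n. As a function of the n-th coordinate, the
    others being fixed, F_n = E_n f + i T_n f is a constant plus the boundary
    values of an analytic function with mean zero: conjugation in the n-th variable
    turns the part d_n f, which has mean zero in that variable, into an imaginary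
    part that completes it to a power series. Hence F_n is an analytic martingale
    with values in the right half-plane, and u(F_n) is a martingale for each
    function u harmonic there. The choice u(z) = Re (2 z / (z + lam)) is
    nonnegative, at least 1 when |z| >= lam, and at most 2 c / lam at a real point
    c, so Doob's maximal inequality bounds the probability that some |F_n| reaches
    lam by 2 (mean of f) / lam. This is [max_weak_type]; Doob's inequality is
    proved together with the martingale property, by induction on the dimension,
    in [amart_max_le]. The one analytic fact behind it is the mean value property
    of 1 / p on the circle for a polynomial p whose real part is bounded below by
    a positive constant there ([mean_inverse]): such a p has no root in the closed
    disc, and 1 / p expands into geometric series. The same half-plane argument in
    a single coordinate gives the weak type inequality for each H_j
    ([conjugate_weak_type]).

    A general f is approximated in Lp, p = 1 or 2, by a combination of four squared
    moduli |r_k|^2 of trigonometric polynomials with coefficients 1, i, -1, -i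
    ([tcomb_approx]): each |r_k|^2 is a nonnegative trigonometric polynomial, close
    to one of the positive or negative parts of Re f and Im f. Together with the
    contractivity of H_j on L2 this extends the weak type bound for H_j to L2
    ([conjugate_L2_weak]), and then to the limits that define H_j on L1
    ([conjugate_L1_weak]). The conditional expectation and the conjugate function
    being specified only up to null sets, one also shows that versions of them
    exist, as almost everywhere limits along rapidly converging approximations
    ([condexp_exists], [conjugate_exists]).

    Finally, for fixed N and a combination Q of four squared moduli close enough
    to f in L1, each of the N functions H_j (d_j f) is close in measure to
    H_j (d_j Q). The maximal function of f is then at most that of Q plus an error
    whose weak bound, although dependent on N, is arbitrarily small, while the
    maximal function of Q is controlled by [max_weak_type] with a constant
    independent of N. *)

(** * Complex numbers *)

Section complex_basics.
Variable R : realType.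
Implicit Types (z w : R[i]).

Lemma ReCD z w : ReC (z + w) = ReC z + ReC w. Proof. by case: z w => ? ? []. Qed.
Lemma ImCD z w : ImC (z + w) = ImC z + ImC w. Proof. by case: z w => ? ? []. Qed.
Lemma ReCN z : ReC (- z) = - ReC z. Proof. by case: z. Qed.
Lemma ImCN z : ImC (- z) = - ImC z. Proof. by case: z. Qed.
Lemma ReCM z w : ReC (z * w) = ReC z * ReC w - ImC z * ImC w.
Proof. by case: z w => ? ? []. Qed.
Lemma ImCM z w : ImC (z * w) = ReC z * ImC w + ImC z * ReC w.
Proof. by case: z w => ? ? [c d] /=. Qed.
Lemma ReCJ z : ReC (z^*)%C = ReC z. Proof. by case: z. Qed.
Lemma ImCJ z : ImC (z^*)%C = - ImC z. Proof. by case: z. Qed.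
Definition ReImE := (ReCD, ImCD, ReCN, ImCN, ReCM, ImCM, ReCJ, ImCJ).

Lemma eq_ReIm z w : ReC z = ReC w -> ImC z = ImC w -> z = w.
Proof. by case: z w => a b [c d] /= -> ->. Qed.

Lemma modC_sqr z : modC z ^+ 2 = ReC z ^+ 2 + ImC z ^+ 2.
Proof. by case: z => a b /=; rewrite sqr_sqrtr // addr_ge0 // sqr_ge0. Qed.

Lemma modC_ge0 z : 0 <= modC z. Proof. by case: z => a b; exact: sqrtr_ge0. Qed.

Lemma normCE z : `|z| = (modC z)%:C%C. Proof. by case: z. Qed.

Lemma modCD z w : modC (z + w) <= modC z + modC w.
Proof. exact: le_normcD. Qed.
Lemma modCN z : modC (- z) = modC z. Proof. exact: normcN. Qed.
Lemma modCB z w : modC (z - w) <= modC z + modC w.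
Proof. by rewrite -(modCN w); exact: modCD. Qed.
Lemma modCBC z w : modC (z - w) = modC (w - z).
Proof. by rewrite -modCN opprB. Qed.
Lemma modCM z w : modC (z * w) = modC z * modC w.
Proof. exact: ComplexField.Normc.normcM. Qed.
Lemma modC0 : modC (0 : R[i]) = 0. Proof. exact: ComplexField.Normc.normc0. Qed.
Lemma modC1 : modC (1 : R[i]) = 1. Proof. exact: ComplexField.Normc.normc1. Qed.
Lemma modCV z : modC z^-1 = (modC z)^-1.
Proof. exact: ComplexField.Normc.normcV. Qed.
Lemma modCJ z : modC (z^*)%C = modC z.
Proof. by case: z => a b /=; rewrite sqrrN. Qed.
Lemma modCi : modC ('i%C : R[i]) = 1.
Proof. by rewrite /= expr0n /= add0r expr1n sqrtr1. Qed.
Lemma modC_real (x : R) : modC (x%:C)%C = `|x|.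
Proof. by rewrite /= expr0n /= addr0 sqrtr_sqr. Qed.
Lemma modC_eq0 z : modC z = 0 -> z = 0.
Proof. exact: ComplexField.Normc.eq0_normc. Qed.
Lemma modC_sum I (r : seq I) (P : pred I) (F : I -> R[i]) :
  modC (\sum_(i <- r | P i) F i) <= \sum_(i <- r | P i) modC (F i).
Proof.
elim: r => [|i r IH]; first by rewrite !big_nil modC0.
rewrite !big_cons; case: (P i) => //.
by apply: (le_trans (modCD _ _)); rewrite lerD2l.
Qed.
Lemma modCX z n : modC (z ^+ n) = modC z ^+ n.
Proof. by elim: n => [|n IH]; rewrite ?expr0 ?modC1 // !exprS modCM IH. Qed.

Lemma modC_ge_Re z : `|ReC z| <= modC z.
Proof.
rewrite -(ler_pXn2r (n := 2)) // ?nnegrE ?modC_ge0 //.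
by rewrite modC_sqr real_normK ?num_real // lerDl sqr_ge0.
Qed.

Lemma modC_ge_Im z : `|ImC z| <= modC z.
Proof.
rewrite -(ler_pXn2r (n := 2)) // ?nnegrE ?modC_ge0 //.
by rewrite modC_sqr real_normK ?num_real // lerDr sqr_ge0.
Qed.

Lemma modC_le z : modC z <= `|ReC z| + `|ImC z|.
Proof.
rewrite -(ler_pXn2r (n := 2)) // ?nnegrE ?modC_ge0 ?addr_ge0 //.
rewrite modC_sqr sqrrD !real_normK ?num_real // addrAC lerDl.
by rewrite mulrn_wge0 // mulr_ge0.
Qed.

Lemma mulCJ z : (z * z^*)%C = ((modC z ^+ 2)%:C)%C.
Proof. by rewrite modC_sqr; apply: eq_ReIm; rewrite !ReImE /=; ring. Qed.

End complex_basics.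

Section complex_measurability.
Context d (T : measurableType d) (R : realType).
Implicit Types (f g : T -> R[i]).

Lemma measurable_ReC : measurable_fun setT (fun z : R[i] => ReC z).
Proof.
move=> _ B mB; rewrite setTI.
exists (B `*` setT); first exact: measurableX.
by apply/seteqP; split => [z [_ []]|z Bz].
Qed.

Lemma measurable_ImC : measurable_fun setT (fun z : R[i] => ImC z).
Proof.
move=> _ B mB; rewrite setTI.
exists (setT `*` B); first exact: measurableX.
by apply/seteqP; split => [z [_ []]|z Bz].
Qed.

Lemma cmeasP f : measurable_fun setT f <->
  measurable_fun setT (fun x => ReC (f x)) /\
  measurable_fun setT (fun x => ImC (f x)).
Proof.
split=> [mf|[mr mi]]; last exact: measurable_complex.
by split; [exact: (measurableT_comp measurable_ReC)|
           exact: (measurableT_comp measurable_ImC)].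
Qed.

Lemma cmeasD f g : measurable_fun setT f -> measurable_fun setT g ->
  measurable_fun setT (fun x => f x + g x).
Proof.
move=> /cmeasP[fr fi] /cmeasP[gr gi]; apply/cmeasP; split.
- by under eq_fun do rewrite ReCD; exact: measurable_funD.
- by under eq_fun do rewrite ImCD; exact: measurable_funD.
Qed.

Lemma cmeasN f : measurable_fun setT f -> measurable_fun setT (fun x => - f x).
Proof.
move=> /cmeasP[fr fi]; apply/cmeasP; split.
- by under eq_fun do rewrite ReCN; exact: measurable_funN.
- by under eq_fun do rewrite ImCN; exact: measurable_funN.
Qed.

Lemma cmeasB f g : measurable_fun setT f -> measurable_fun setT g ->
  measurable_fun setT (fun x => f x - g x).
Proof. by move=> mf mg; apply: cmeasD => //; exact: cmeasN. Qed.

Lemma cmeasM f g : measurable_fun setT f -> measurable_fun setT g ->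
  measurable_fun setT (fun x => f x * g x).
Proof.
move=> /cmeasP[fr fi] /cmeasP[gr gi]; apply/cmeasP; split.
- under eq_fun do rewrite ReCM.
  by apply: measurable_funB; exact: measurable_funM.
- under eq_fun do rewrite ImCM.
  by apply: measurable_funD; exact: measurable_funM.
Qed.

Lemma cmeas_cst (c : R[i]) : measurable_fun setT (fun _ : T => c).
Proof. exact: measurable_cst. Qed.

Lemma cmeasJ f : measurable_fun setT f -> measurable_fun setT (fun x => (f x)^*%C).
Proof.
move=> /cmeasP[fr fi]; apply/cmeasP; split.
- by under eq_fun do rewrite ReCJ.
- by under eq_fun do rewrite ImCJ; exact: measurable_funN.
Qed.

Lemma cmeas_real (f : T -> R) : measurable_fun setT f ->
  measurable_fun setT (fun x => (f x)%:C%C).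
Proof. by move=> mf; apply/cmeasP; split => //=; exact: measurable_cst. Qed.

Lemma cmeas_sum I (r : seq I) (P : pred I) (F : I -> T -> R[i]) :
  (forall i, measurable_fun setT (F i)) ->
  measurable_fun setT (fun x => \sum_(i <- r | P i) F i x).
Proof.
move=> mF; elim: r => [|i r IH].
  by under eq_fun do rewrite big_nil; exact: cmeas_cst.
under eq_fun do rewrite big_cons.
by case: (P i) => //; exact: cmeasD.
Qed.

Lemma cmeas_prod I (r : seq I) (P : pred I) (F : I -> T -> R[i]) :
  (forall i, measurable_fun setT (F i)) ->
  measurable_fun setT (fun x => \prod_(i <- r | P i) F i x).
Proof.
move=> mF; elim: r => [|i r IH].
  by under eq_fun do rewrite big_nil; exact: cmeas_cst.
under eq_fun do rewrite big_cons.
by case: (P i) => //; exact: cmeasM.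
Qed.

Lemma cmeasX f n : measurable_fun setT f -> measurable_fun setT (fun x => f x ^+ n).
Proof.
move=> mf; elim: n => [|n IH].
  by under eq_fun do rewrite expr0; exact: cmeas_cst.
by under eq_fun do rewrite exprS; exact: cmeasM.
Qed.

Lemma measurable_modC f : measurable_fun setT f ->
  measurable_fun setT (fun x => modC (f x)).
Proof.
move=> /cmeasP[fr fi].
have -> : (fun x => modC (f x)) =
   (fun x => Num.sqrt (ReC (f x) ^+ 2 + ImC (f x) ^+ 2)).
  by apply/funext => x; rewrite -modC_sqr sqrtr_sqr ger0_norm // modC_ge0.
apply: measurableT_comp; first exact: (continuous_measurable_fun (@sqrt_continuous R)).
by apply: measurable_funD; apply: measurable_funX.
Qed.

End complex_measurability.

(** * Integrals of complex functions *)

Section complex_integral.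
Context d (T : measurableType d) (R : realType) (P : probability T R).
Implicit Types (f g : T -> R[i]) (D : set T).
Local Open Scope ereal_scope.

(** The p-th power of the Lp norm; taking no root keeps the exponents 1, 2 and 4
    on the same footing. *)
Definition Lpint (p : nat) f : \bar R := \int[P]_x ((modC (f x)) ^+ p)%:E.

Lemma Eint_le (a b : T -> R) :
  measurable_fun setT a -> measurable_fun setT b -> (forall x, (0 <= a x)%R) ->
  (forall x, (a x <= b x)%R) -> \int[P]_x (a x)%:E <= \int[P]_x (b x)%:E.
Proof.
move=> ma mb a0 ab; apply: ge0_le_integral => //.
- by move=> x _; rewrite lee_fin.
- exact/measurable_EFinP.
- exact/measurable_EFinP.
- by move=> x _; rewrite lee_fin.
Qed.

Lemma Eint_cst (r : R) : \int[P]_x r%:E = r%:E.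
Proof. by rewrite integral_cst // [X in _ * X](@probability_setT _ _ _ P) mule1. Qed.

Lemma EintD (a b : T -> R) :
  measurable_fun setT a -> measurable_fun setT b -> (forall x, (0 <= a x)%R) ->
  (forall x, (0 <= b x)%R) ->
  \int[P]_x (a x + b x)%:E = \int[P]_x (a x)%:E + \int[P]_x (b x)%:E.
Proof.
move=> ma mb a0 b0; under eq_integral do rewrite EFinD.
apply: ge0_integralD => //.
- by move=> x _; rewrite lee_fin.
- exact/measurable_EFinP.
- by move=> x _; rewrite lee_fin.
- exact/measurable_EFinP.
Qed.

Lemma EintZ (k : R) (a : T -> R) :
  measurable_fun setT a -> (0 <= k)%R -> (forall x, (0 <= a x)%R) ->
  \int[P]_x (k * a x)%:E = k%:E * \int[P]_x (a x)%:E.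
Proof.
move=> ma k0 a0; under eq_integral do rewrite EFinM.
by apply: ge0_integralZl_EFin => //; [move=> x _; rewrite lee_fin|
  exact/measurable_EFinP].
Qed.

Lemma measurable_ge_set (a : T -> R) (y : R) :
  measurable_fun setT a -> measurable [set x | (y <= a x)%R].
Proof.
by move=> ma; rewrite -[X in measurable X]setTI; exact: measurable_fun_le.
Qed.

Lemma measurable_gt_set (a : T -> R) (y : R) :
  measurable_fun setT a -> measurable [set x | (y < a x)%R].
Proof.
move=> ma; rewrite [X in measurable X](_ : _ = setT `&` a @^-1` `]y, +oo[%classic).
  exact: ma.
by apply/seteqP; split => x; rewrite /= in_itv /= andbT // => -[].
Qed.

Lemma Eint_chebyshev (a : T -> R) (y : R) :
  measurable_fun setT a -> (forall x, (0 <= a x)%R) -> (0 <= y)%R ->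
  y%:E * P [set x | (y <= a x)%R] <= \int[P]_x (a x)%:E.
Proof.
move=> ma a0 y0; set A := [set x | _].
have mA : measurable A by exact: measurable_ge_set.
rewrite -(setIT A) -(integral_indic P measurableT mA) -EintZ //.
apply: Eint_le => //.
- by apply: measurable_funM => //; exact: measurable_indic.
- by move=> x; rewrite mulr_ge0.
- move=> x; rewrite indicE.
  have [/set_mem Ax|_] := boolP (x \in A); first by rewrite mulr1.
  by rewrite mulr0.
Qed.

Lemma measurable_modCX p f : measurable_fun setT f ->
  measurable_fun setT (fun x => (modC (f x) ^+ p)%R).
Proof. by move=> mf; apply: measurable_funX; exact: measurable_modC. Qed.

Lemma Lpint_ge0 p f : 0 <= Lpint p f.
Proof. by apply: integral_ge0 => x _; rewrite lee_fin exprn_ge0 // modC_ge0. Qed.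

Lemma Lpint_le p f g : measurable_fun setT f -> measurable_fun setT g ->
  (forall x, (modC (f x) <= modC (g x))%R) -> Lpint p f <= Lpint p g.
Proof.
move=> mf mg fg; apply: Eint_le; try exact: measurable_modCX.
- by move=> x; rewrite exprn_ge0 // modC_ge0.
- by move=> x; rewrite lerXn2r // nnegrE modC_ge0.
Qed.

Lemma exprD_le2 p (a b : R) : (0 <= a)%R -> (0 <= b)%R ->
  ((a + b) ^+ p <= 2 ^+ p * (a ^+ p + b ^+ p))%R.
Proof.
move=> a0 b0; wlog ab : a b a0 b0 / (a <= b)%R => [H|].
  have [/H|/ltW ba] := leP a b; first exact.
  by rewrite addrC [X in (_ * X)%R]addrC H.
have le : ((a + b) ^+ p <= (2 * b) ^+ p)%R.
  by rewrite lerXn2r ?nnegrE ?addr_ge0 // ?mulr_ge0 //; lra.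
apply: (le_trans le); rewrite exprMn ler_wpM2l ?exprn_ge0 //.
by rewrite lerDr exprn_ge0.
Qed.

Lemma LpintD p f g : measurable_fun setT f -> measurable_fun setT g ->
  Lpint p (fun x => f x + g x)%R <= (2 ^+ p)%:E * (Lpint p f + Lpint p g).
Proof.
move=> mf mg.
have := measurable_modCX p mf; have := measurable_modCX p mg => mg' mf'.
rewrite /Lpint -EintD //; last first.
  by move=> x; rewrite exprn_ge0 // modC_ge0.
  by move=> x; rewrite exprn_ge0 // modC_ge0.
rewrite -EintZ ?exprn_ge0 //; last first.
  by move=> x; rewrite addr_ge0 // exprn_ge0 // modC_ge0.
  exact: measurable_funD.
apply: Eint_le.
- by apply: measurable_modCX; exact: cmeasD.
- apply: measurable_funM; first exact: measurable_cst.
  exact: measurable_funD.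
- by move=> x; rewrite exprn_ge0 // modC_ge0.
move=> x; apply: (le_trans _ (exprD_le2 _ (modC_ge0 _) (modC_ge0 _))).
by rewrite lerXn2r ?nnegrE ?modC_ge0 ?addr_ge0 ?modC_ge0 // modCD.
Qed.

Lemma LpintN p f : Lpint p (fun x => - f x)%R = Lpint p f.
Proof. by apply: eq_integral => x _; rewrite modCN. Qed.

Lemma LpintB p f g : measurable_fun setT f -> measurable_fun setT g ->
  Lpint p (fun x => f x - g x)%R <= (2 ^+ p)%:E * (Lpint p f + Lpint p g).
Proof.
by move=> mf mg; rewrite -(LpintN p g); apply: LpintD => //; exact: cmeasN.
Qed.

Lemma Lpint_bounded p f (B : R) : measurable_fun setT f ->
  (forall x, (modC (f x) <= B)%R) -> Lpint p f <= (B ^+ p)%:E.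
Proof.
move=> mf fB; rewrite -(Eint_cst (B ^+ p)); apply: Eint_le.
- exact: measurable_modCX.
- exact: measurable_cst.
- by move=> x; rewrite exprn_ge0 // modC_ge0.
- move=> x; rewrite lerXn2r ?nnegrE ?modC_ge0 //.
  by apply: le_trans (fB x); exact: modC_ge0.
Qed.

Lemma LpintM p f g (B : R) : measurable_fun setT f -> measurable_fun setT g ->
  (forall x, (modC (f x) <= B)%R) ->
  Lpint p (fun x => f x * g x)%R <= (B ^+ p)%:E * Lpint p g.
Proof.
move=> mf mg fB; have B0 x : (0 <= B)%R := le_trans (modC_ge0 _) (fB x).
have B0' : (0 <= B)%R := B0 point.
rewrite -EintZ ?exprn_ge0 //; last first.
  by move=> x; rewrite exprn_ge0 // modC_ge0.
  exact: measurable_modCX.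
apply: Eint_le.
- by apply: measurable_modCX; exact: cmeasM.
- by apply: measurable_funM; [exact: measurable_cst|exact: measurable_modCX].
- by move=> x; rewrite exprn_ge0 // modC_ge0.
move=> x; rewrite modCM exprMn ler_wpM2r ?exprn_ge0 ?modC_ge0 //.
by rewrite lerXn2r ?nnegrE ?modC_ge0.
Qed.

Lemma Lpint_chebyshev p f (y : R) : (0 < p)%N -> measurable_fun setT f -> (0 <= y)%R ->
  (y ^+ p)%:E * P [set x | (y <= modC (f x))%R] <= Lpint p f.
Proof.
move=> p0 mf y0.
have -> : [set x | (y <= modC (f x))%R] = [set x | (y ^+ p <= modC (f x) ^+ p)%R].
  by apply/seteqP; split => x /=; rewrite ler_pXn2r ?nnegrE ?modC_ge0.
apply: Eint_chebyshev; first exact: measurable_modCX.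
- by move=> x; rewrite exprn_ge0 // modC_ge0.
- exact: exprn_ge0.
Qed.

Lemma L1normE f : L1norm P f = Lpint 1 f.
Proof. by []. Qed.

Lemma inL1_bounded f (B : R) : measurable_fun setT f ->
  (forall x, (modC (f x) <= B)%R) -> inL1 P f.
Proof.
move=> mf fB; split => //.
by rewrite (le_lt_trans (@Lpint_bounded 1 _ _ mf fB)) // ltry.
Qed.

Lemma inL1D f g : inL1 P f -> inL1 P g -> inL1 P (fun x => f x + g x)%R.
Proof.
move=> [mf f1] [mg g1]; split; first exact: cmeasD.
rewrite (le_lt_trans (@LpintD 1 f g mf mg)) //.
by apply: lte_mul_pinfty => //; exact: lte_add_pinfty.
Qed.

Lemma inL1N f : inL1 P f -> inL1 P (fun x => - f x)%R.
Proof.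
by move=> [mf f1]; split; [exact: cmeasN|rewrite L1normE LpintN].
Qed.

Lemma inL1B f g : inL1 P f -> inL1 P g -> inL1 P (fun x => f x - g x)%R.
Proof. by move=> f1 g1; apply: inL1D => //; exact: inL1N. Qed.

Lemma inL1M f g (B : R) : measurable_fun setT f -> inL1 P g ->
  (forall x, (modC (f x) <= B)%R) -> inL1 P (fun x => f x * g x)%R.
Proof.
move=> mf [mg g1] fB; split; first exact: cmeasM.
rewrite (le_lt_trans (@LpintM 1 f g B mf mg fB)) //.
by apply: lte_mul_pinfty => //; rewrite lee_fin expr1;
   apply: le_trans (fB point); exact: modC_ge0.
Qed.

Lemma inL1Z (c : R[i]) f : inL1 P f -> inL1 P (fun x => c * f x)%R.
Proof.
by move=> f1; apply: (@inL1M (fun=> c) f (modC c)) => //; exact: measurable_cst.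
Qed.

Lemma inL1_Re D f : measurable D -> inL1 P f ->
  P.-integrable D (EFin \o (fun x => ReC (f x))).
Proof.
move=> mD [mf f1]; apply: (@integrableS _ _ _ _ setT) => //.
have [mr mi] := (cmeasP f).1 mf.
apply/integrableP; split; first exact/measurable_EFinP.
apply: le_lt_trans f1; apply: Eint_le => //.
- exact: (measurableT_comp _ mr).
- exact: measurable_modC.
- by move=> x; exact: modC_ge_Re.
Qed.

Lemma inL1_Im D f : measurable D -> inL1 P f ->
  P.-integrable D (EFin \o (fun x => ImC (f x))).
Proof.
move=> mD [mf f1]; apply: (@integrableS _ _ _ _ setT) => //.
have [mr mi] := (cmeasP f).1 mf.
apply/integrableP; split; first exact/measurable_EFinP.
apply: le_lt_trans f1; apply: Eint_le => //.
- exact: (measurableT_comp _ mi).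
- exact: measurable_modC.
- by move=> x; exact: modC_ge_Im.
Qed.

Lemma eq_Cintegral D f g : (forall x, D x -> f x = g x) ->
  Cintegral P D f = Cintegral P D g.
Proof.
by move=> fg; rewrite /Cintegral; congr (_ +i* _)%C;
  apply: eq_Rintegral => x /set_mem Dx; rewrite fg.
Qed.

Lemma CintegralD D f g : measurable D -> inL1 P f -> inL1 P g ->
  Cintegral P D (fun x => f x + g x)%R = (Cintegral P D f + Cintegral P D g)%R.
Proof.
move=> mD f1 g1; apply: eq_ReIm; rewrite ReImE /=.
- rewrite -RintegralD //; [|exact: inL1_Re|exact: inL1_Re].
  by apply: eq_Rintegral => x _; rewrite ReCD.
- rewrite -RintegralD //; [|exact: inL1_Im|exact: inL1_Im].
  by apply: eq_Rintegral => x _; rewrite ImCD.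
Qed.

Lemma CintegralZ D (c : R[i]) f : measurable D -> inL1 P f ->
  Cintegral P D (fun x => c * f x)%R = (c * Cintegral P D f)%R.
Proof.
move=> mD f1; apply: eq_ReIm; rewrite ReImE /=.
- under eq_Rintegral do rewrite ReCM.
  rewrite RintegralB //= ?RintegralZl //; try exact: inL1_Re; try exact: inL1_Im.
  + by apply: (integrableZl mD (ReC c) (inL1_Re mD f1)).
  + by apply: (integrableZl mD (ImC c) (inL1_Im mD f1)).
- under eq_Rintegral do rewrite ImCM.
  rewrite RintegralD //= ?RintegralZl //; try exact: inL1_Re; try exact: inL1_Im.
  + by apply: (integrableZl mD (ReC c) (inL1_Im mD f1)).
  + by apply: (integrableZl mD (ImC c) (inL1_Re mD f1)).
Qed.

Lemma CintegralN D f : measurable D -> inL1 P f ->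
  Cintegral P D (fun x => - f x)%R = (- Cintegral P D f)%R.
Proof.
move=> mD f1; rewrite -mulN1r -CintegralZ //.
by apply: eq_Cintegral => x _; rewrite mulN1r.
Qed.

Lemma CintegralB D f g : measurable D -> inL1 P f -> inL1 P g ->
  Cintegral P D (fun x => f x - g x)%R = (Cintegral P D f - Cintegral P D g)%R.
Proof.
by move=> mD f1 g1; rewrite CintegralD ?CintegralN //; exact: inL1N.
Qed.

Lemma Cintegral_cst (c : R[i]) : Cintegral P setT (fun=> c) = c.
Proof.
have PT : fine (P setT) = 1%R by rewrite [X in fine X](@probability_setT _ _ _ P).
case: c => a b; rewrite /Cintegral /= !Rintegral_cst //.
by apply: eq_ReIm; rewrite /= [X in (_ * X)%R]PT mulr1.
Qed.

Lemma Cintegral0 D : measurable D -> Cintegral P D (fun=> 0%R) = 0%R.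
Proof. by move=> mD; rewrite /Cintegral !Rintegral_cst //= !mul0r. Qed.

Lemma inL1_sum I (r : seq I) (F : I -> T -> R[i]) :
  (forall i, inL1 P (F i)) -> inL1 P (fun x => \sum_(i <- r) F i x)%R.
Proof.
move=> F1; elim: r => [|i r IH].
  under eq_fun do rewrite big_nil.
  by apply: (@inL1_bounded _ 0%R); [exact: measurable_cst|move=> x; rewrite modC0].
by under eq_fun do rewrite big_cons; exact: inL1D.
Qed.

Lemma Cintegral_sum D I (r : seq I) (F : I -> T -> R[i]) : measurable D ->
  (forall i, inL1 P (F i)) ->
  Cintegral P D (fun x => \sum_(i <- r) F i x)%R = (\sum_(i <- r) Cintegral P D (F i))%R.
Proof.
move=> mD F1; elim: r => [|i r IH].
  transitivity (Cintegral P D (fun=> 0%R)); last by rewrite big_nil Cintegral0.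
  by apply: eq_Cintegral => x _; rewrite big_nil.
rewrite big_cons -IH -CintegralD //; last exact: inL1_sum.
by apply: eq_Cintegral => x _; exact: big_cons.
Qed.

Lemma CintegralJ D f : measurable D -> inL1 P f ->
  Cintegral P D (fun x => (f x)^*%C) = (Cintegral P D f)^*%C.
Proof.
move=> mD f1; apply: eq_ReIm; rewrite ReImE /=.
- by apply: eq_Rintegral => x _; rewrite ReCJ.
- rewrite -mulN1r -RintegralZl //; last exact: inL1_Im.
  by apply: eq_Rintegral => x _; rewrite ImCJ mulN1r.
Qed.

Lemma modC_Cintegral D f : measurable D -> inL1 P f ->
  (modC (Cintegral P D f))%:E <= 2%:E * L1norm P f.
Proof.
move=> mD f1; have [mf f1'] := f1; have [mr mi] := (cmeasP f).1 mf.
have part (h : T -> R) : measurable_fun setT h ->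
    P.-integrable D (EFin \o h) -> (forall x, `|h x| <= modC (f x))%R ->
    `|\int[P]_(x in D) h x|%R%:E <= L1norm P f.
  move=> mh ih hf; rewrite (EFin_normr_Rintegral mD ih).
  apply: le_trans (le_abse_integral _ mD _) _.
    by apply/measurable_EFinP; exact: measurable_funS mh.
  apply: (@le_trans _ _ (\int[P]_x `|(h x)%:E|)).
    apply: ge0_subset_integral => //.
    by apply/measurable_EFinP; exact: measurableT_comp.
  apply: Eint_le => //; first exact: measurableT_comp.
  exact: measurable_modC.
apply: (@le_trans _ _ (`|ReC (Cintegral P D f)| + `|ImC (Cintegral P D f)|)%R%:E).
  by rewrite lee_fin modC_le.
have -> : 2%:E * L1norm P f = L1norm P f + L1norm P f.
  by rewrite (_ : 2%R = (1 + 1)%R :> R) // EFinD ge0_muleDl ?mul1e.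
rewrite EFinD leeD //=; apply: part => //.
- exact: inL1_Re.
- by move=> x; exact: modC_ge_Re.
- exact: inL1_Im.
- by move=> x; exact: modC_ge_Im.
Qed.

End complex_integral.

(** * Integration on the circle and on products *)

Section circle_integral.
Variable R : realType.
Local Notation mu1 := (circle_prob R).

Lemma integral_uniform01_FTC (f F : R -> R) :
  (forall x, 0 <= f x) -> continuous f ->
  (forall x : R, is_derive x 1 F (f x)) ->
  (\int[uniform_prob (@ltr01 R)]_x (f x)%:E = (F 1 - F 0)%:E)%E.
Proof.
move=> f0 cf dF.
rewrite integral_uniform /=; last 2 first.
- by apply/measurable_EFinP; exact: continuous_measurable_fun.
- by move=> x; rewrite lee_fin.
rewrite subr0 invr1 mul1e (@continuous_FTC2 R f F) //.
- by apply: continuous_subspaceT.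
- have cF : continuous F.
    move=> x; apply: differentiable_continuous; apply/derivable1_diffP.
    by have [] := dF x.
  split.
  + by move=> x _; have [] := dF x.
  + exact/cvg_at_right_filter/cF.
  + exact/cvg_at_left_filter/cF.
- by move=> x _; rewrite derive1E; apply: derive_val.
Qed.

Lemma circle_norm (x : circle R) : modC (circle_val x) = 1.
Proof. by case: x => z /= /eqP; rewrite normCE => -[]. Qed.

Lemma measurable_circle_val : measurable_fun setT (@circle_val R).
Proof. by move=> _ B mB; rewrite setTI; exists B; rewrite ?setTI. Qed.

Lemma circle_val_exp (t : R) n :
  circle_val (circle_exp t) ^+ n =
  (cos (2 * pi * n%:R * t) +i* sin (2 * pi * n%:R * t))%C.
Proof.
elim: n => [|n IH]; first by rewrite expr0 mulr0 mul0r cos0 sin0.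
rewrite exprSr IH.
have -> : 2 * pi * n.+1%:R * t = 2 * pi * n%:R * t + 2 * pi * t.
  by rewrite -natr1; ring.
by rewrite cosD sinD; apply: eq_ReIm; rewrite !ReImE /=; ring.
Qed.

Lemma circle_integral_real (g : circle R -> R) :
  measurable_fun setT g -> (forall x, `|g x| <= 1) ->
  \int[mu1]_x g x =
  fine (\int[uniform_prob (@ltr01 R)]_t (1 + g (circle_exp t))%:E) - 1.
Proof.
move=> mg g1.
have ig : mu1.-integrable setT (EFin \o g).
  apply: measurable_bounded_integrable => //.
    by rewrite (le_lt_trans (probability_le1 _ _)) // ltry.
  exists 1; split => // M M1 x _ /=; apply: (le_trans (g1 x)); exact: ltW.
have ic : mu1.-integrable setT (EFin \o (fun=> 1)).
  by apply: finite_measure_integrable_cst.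
have -> : \int[mu1]_x g x = \int[mu1]_x (1 + g x) - 1.
  rewrite RintegralD // Rintegral_cst //.
  have -> : fine (mu1 setT) = 1 by rewrite probability_setT.
  by rewrite mul1r addrC addKr.
congr (fine _ - 1).
rewrite ge0_integral_distribution //.
  by apply/measurable_EFinP; exact: measurable_funD.
move=> x; rewrite lee_fin.
by have := g1 x; rewrite ler_norml => /andP[+ _]; rewrite -lerBlDl sub0r.
Qed.

Lemma circle_integral_cos (k : nat) : (0 < k)%N ->
  \int[mu1]_x ReC (circle_val x ^+ k) = 0.
Proof.
move=> k0; have [mr mi] := (cmeasP _).1 (cmeasX k measurable_circle_val).
rewrite circle_integral_real //; last first.
  move=> x; apply: (le_trans (modC_ge_Re _)).
  by rewrite modCX circle_norm expr1n.
pose a : R := 2 * pi * k%:R.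
have a0 : a != 0 by rewrite !mulf_neq0 ?pnatr_eq0 ?gt_eqF ?pi_gt0 // -lt0n.
have -> : (\int[uniform_prob (@ltr01 R)]_t
    (1 + ReC (circle_val (circle_exp t) ^+ k))%:E = 1)%E; last by rewrite subrr.
under eq_integral do rewrite circle_val_exp /= -/a.
have dF (x : R) : is_derive x 1 (fun t => t + a^-1 * sin (a * t)) (1 + cos (a * x)).
  apply: is_derive_eq.
  by rewrite /GRing.scale /= mulr1; field.
rewrite (@integral_uniform01_FTC _ _ _ _ dF).
- have sa : sin a = 0.
    rewrite /a mulr_natr mulr_natl; elim: (k) => [|m IH]; first by rewrite mulr0n sin0.
    by rewrite mulrSr sinD2pi.
  by rewrite mulr1 mulr0 sin0 sa !mulr0 !addr0 subr0.
- by move=> x; rewrite -lerBlDl sub0r cos_geN1.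
- move=> x; apply: (@continuousD _ R^o); first exact: cvg_cst.
  apply: continuous_comp; last exact: continuous_cos.
  by apply: continuousM => //; exact: cvg_cst.
Qed.

Lemma circle_integral_sin (k : nat) : (0 < k)%N ->
  \int[mu1]_x ImC (circle_val x ^+ k) = 0.
Proof.
move=> k0; have [mr mi] := (cmeasP _).1 (cmeasX k measurable_circle_val).
rewrite circle_integral_real //; last first.
  move=> x; apply: (le_trans (modC_ge_Im _)).
  by rewrite modCX circle_norm expr1n.
pose a : R := 2 * pi * k%:R.
have a0 : a != 0 by rewrite !mulf_neq0 ?pnatr_eq0 ?gt_eqF ?pi_gt0 // -lt0n.
have -> : (\int[uniform_prob (@ltr01 R)]_t
    (1 + ImC (circle_val (circle_exp t) ^+ k))%:E = 1)%E; last by rewrite subrr.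
under eq_integral do rewrite circle_val_exp /= -/a.
have dF (x : R) : is_derive x 1 (fun t => t - a^-1 * cos (a * t)) (1 + sin (a * x)).
  apply: is_derive_eq.
  by rewrite /GRing.scale /= mulr1; field.
rewrite (@integral_uniform01_FTC _ _ _ _ dF).
- have sa : cos a = 1.
    rewrite /a mulr_natr mulr_natl; elim: (k) => [|m IH]; first by rewrite mulr0n cos0.
    by rewrite mulrSr cosD2pi.
  by rewrite mulr1 mulr0 cos0 sa mulr1 sub0r opprK subrK.
- by move=> x; rewrite -lerBlDl sub0r sin_geN1.
- move=> x; apply: (@continuousD _ R^o); first exact: cvg_cst.
  apply: continuous_comp; last exact: continuous_sin.
  by apply: continuousM => //; exact: cvg_cst.
Qed.

Lemma circle_integralX (k : nat) :
  Cintegral mu1 setT (fun x => circle_val x ^+ k) = (k == 0)%:R.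
Proof.
case: k => [|k].
  by under [X in Cintegral _ _ X]eq_fun do rewrite expr0; rewrite Cintegral_cst.
by apply: eq_ReIm; [rewrite /= circle_integral_cos|rewrite /= circle_integral_sin].
Qed.

Lemma circle_neq0 (x : circle R) : circle_val x != 0.
Proof.
by apply/eqP => x0; have := circle_norm x; rewrite x0 modC0 => /eqP;
   rewrite eq_sym oner_eq0.
Qed.

Lemma circleV (x : circle R) : (circle_val x)^-1 = (circle_val x)^*%C.
Proof.
apply: (mulfI (circle_neq0 x)); rewrite mulfV ?circle_neq0 //.
by rewrite mulCJ circle_norm expr1n.
Qed.

Lemma circle_exprz_norm (x : circle R) (k : int) : modC (circle_val x ^ k) = 1.
Proof.
case: k => n; first by rewrite -exprnP modCX circle_norm expr1n.
by rewrite NegzE -exprnN modCV modCX circle_norm expr1n invr1.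
Qed.

Lemma circle_exprzN (x : circle R) (k : int) :
  circle_val x ^ (- k) = (circle_val x ^ k)^*%C.
Proof.
rewrite -invr_expz.
apply: (mulfI (_ : circle_val x ^ k != 0)); first by rewrite expfz_neq0 ?circle_neq0.
by rewrite mulfV ?expfz_neq0 ?circle_neq0 // mulCJ circle_exprz_norm expr1n.
Qed.

Lemma measurable_circle_exprz (k : int) :
  measurable_fun setT (fun x : circle R => circle_val x ^ k).
Proof.
case: k => n.
  under eq_fun do rewrite -exprnP.
  apply: cmeasX; exact: measurable_circle_val.
under eq_fun do rewrite NegzE circle_exprzN -exprnP.
by apply/cmeasJ/cmeasX; exact: measurable_circle_val.
Qed.

Lemma inL1_circle_exprz (k : int) : inL1 mu1 (fun x => circle_val x ^ k).
Proof.
apply: (@inL1_bounded _ _ _ _ _ 1); first exact: measurable_circle_exprz.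
by move=> x; rewrite circle_exprz_norm.
Qed.

Lemma circle_integral_exprz (k : int) :
  Cintegral mu1 setT (fun x => circle_val x ^ k) = (k == 0)%:R.
Proof.
case: k => n; first by under [X in Cintegral _ _ X]eq_fun do rewrite -exprnP;
  rewrite circle_integralX.
under [X in Cintegral _ _ X]eq_fun do rewrite NegzE circle_exprzN.
rewrite CintegralJ //; last exact: inL1_circle_exprz.
have -> : (fun x : circle R => circle_val x ^ n.+1) = (fun x => circle_val x ^+ n.+1).
  by apply/funext => x; rewrite -exprnP.
by rewrite circle_integralX; exact: conjc0.
Qed.

End circle_integral.

Section complex_fubini.
Context d1 d2 (T1 : measurableType d1) (T2 : measurableType d2) (R : realType).
Variables (P1 : probability T1 R) (P2 : probability T2 R).
Implicit Type f : T1 * T2 -> R[i].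

Lemma Rintegral_fubini (f : T1 * T2 -> R) (B : R) : measurable_fun setT f ->
  (forall x, `|f x| <= B) ->
  \int[(P1 \x P2)%E]_z f z = \int[P1]_x \int[P2]_y f (x, y).
Proof.
move=> mf fB.
have if2 : (P1 \x P2)%E.-integrable setT (EFin \o f).
  apply: measurable_bounded_integrable => //.
    by rewrite (le_lt_trans (probability_le1 _ _)) // ltry.
  exists B; split; first exact: num_real.
  by move=> M BM x _ /=; apply: (le_trans (fB x)); exact: ltW.
rewrite {1}/Rintegral -integral12_prod_meas1 //; congr fine.
apply: eq_integral => x _; rewrite /fubini_F /Rintegral fineK //.
apply: integrable_fin_num => //.
apply: measurable_bounded_integrable => //.
- by rewrite (le_lt_trans (probability_le1 _ _)) // ltry.
- by apply: (measurableT_comp mf); exact: pair1_measurable.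
- exists B; split; first exact: num_real.
  by move=> M BM y _ /=; apply: (le_trans (fB _)); exact: ltW.
Qed.

Lemma Cintegral_fubini f (B : R) : measurable_fun setT f ->
  (forall x, modC (f x) <= B) ->
  Cintegral (P1 \x P2)%E setT f =
  Cintegral P1 setT (fun x => Cintegral P2 setT (fun y => f (x, y))).
Proof.
move=> /cmeasP[mr mi] fB; apply: eq_ReIm => /=.
- rewrite (Rintegral_fubini (B := B)) // => x.
  exact: le_trans (modC_ge_Re _) (fB x).
- rewrite (Rintegral_fubini (B := B)) // => x.
  exact: le_trans (modC_ge_Im _) (fB x).
Qed.

Lemma Cintegral_distribution (X : {RV P1 >-> T2}) (f : T2 -> R[i]) (B : R) :
  measurable_fun setT f -> (forall x, modC (f x) <= B) ->
  Cintegral (distribution P1 X) setT f = Cintegral P1 setT (fun x => f (X x)).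
Proof.
move=> mf fB; have [mr mi] := (cmeasP _).1 mf.
have fX1 : inL1 P1 (fun x => f (X x)).
  by apply: (@inL1_bounded _ _ _ _ _ B) => //; exact: measurableT_comp.
apply: eq_ReIm => /=; congr fine; rewrite integral_distribution //.
- exact/measurable_EFinP.
- exact: (inL1_Re measurableT fX1).
- exact/measurable_EFinP.
- exact: (inL1_Im measurableT fX1).
Qed.

End complex_fubini.

(** * Analytic functions with positive real part *)

Section complex_inverse.
Variable R : realType.
Implicit Types z w : R[i].

Lemma ReCV z : ReC z^-1 = ReC z / (modC z ^+ 2).
Proof. by rewrite modC_sqr; case: z. Qed.
Lemma ImCV z : ImC z^-1 = - ImC z / (modC z ^+ 2).
Proof. by rewrite modC_sqr; case: z => a b /=; rewrite mulNr. Qed.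

Lemma cmeasV d (T : measurableType d) (f : T -> R[i]) :
  measurable_fun setT f -> measurable_fun setT (fun x => (f x)^-1).
Proof.
move=> mf; have [mr mi] := (cmeasP f).1 mf.
have mV : measurable_fun setT (fun x => (modC (f x) ^+ 2)^-1).
  under eq_fun do rewrite -powR_inv1 ?exprn_ge0 ?modC_ge0 //.
  by apply: (measurableT_comp (measurable_powR _)); exact: measurable_modCX.
apply/cmeasP; split.
- by under eq_fun do rewrite ReCV; exact: measurable_funM.
- under eq_fun do rewrite ImCV.
  by apply: measurable_funM => //; exact: measurable_funN.
Qed.

Lemma cmeas_horner d (T : measurableType d) (q : {poly R[i]}) (f : T -> R[i]) :
  measurable_fun setT f -> measurable_fun setT (fun x => q.[f x]).
Proof.
move=> mf; under eq_fun do rewrite horner_coef.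
by apply: cmeas_sum => i; apply: cmeasM; [exact: cmeas_cst|exact: cmeasX].
Qed.

Definition coef_norm (q : {poly R[i]}) : R := \sum_(i < size q) modC q`_i.

Lemma horner_bound (q : {poly R[i]}) (x : circle R) :
  modC q.[circle_val x] <= coef_norm q.
Proof.
rewrite horner_coef; apply: (le_trans (modC_sum _ _ _)).
apply: ler_sum => i _.
by rewrite modCM modCX circle_norm expr1n mulr1.
Qed.

Lemma coef_normXM (q : {poly R[i]}) : coef_norm ('X * q) = coef_norm q.
Proof.
have [->|q0] := eqVneq q 0; first by rewrite mulr0.
rewrite /coef_norm mulrC size_mulX // big_ord_recl coefMX eqxx modC0 add0r.
by apply: eq_bigr => i _; rewrite coefMX.
Qed.

End complex_inverse.

Section mean_value.
Variable R : realType.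
Local Notation mu1 := (circle_prob R).
Implicit Types (q p : {poly R[i]}) (bs : seq R[i]).

Let den bs (x : circle R) : R[i] := \prod_(b <- bs) (1 - b * circle_val x).

Lemma one_sub_ge (b : R[i]) (x : circle R) : 1 - modC b <= modC (1 - b * circle_val x).
Proof.
rewrite lerBlDr -[X in X <= _](modC1 R).
rewrite -{1}(subrK (b * circle_val x) 1); apply: (le_trans (modCD _ _)).
by rewrite lerD2l modCM circle_norm mulr1.
Qed.

Let den_bound bs (x : circle R) : all (fun b => modC b < 1) bs ->
  modC (den bs x)^-1 <= \prod_(b <- bs) (1 - modC b)^-1.
Proof.
rewrite modCV /den; elim: bs => [|b bs IH].
  by rewrite !big_nil modC1 invr1.
rewrite /= => /andP[b1 /IH {}IH]; rewrite !big_cons modCM invfM.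
apply: ler_pM => //; rewrite ?invr_ge0 ?modC_ge0 //.
rewrite lef_pV2 ?posrE ?subr_gt0 ?one_sub_ge //.
by apply: lt_le_trans (one_sub_ge b x); rewrite subr_gt0.
Qed.

Let measurable_den bs : measurable_fun setT (den bs).
Proof.
apply: cmeas_prod => b; apply: cmeasB; first exact: cmeas_cst.
by apply: cmeasM; [exact: cmeas_cst|exact: measurable_circle_val].
Qed.

Let measurable_quot bs q :
  measurable_fun setT (fun x : circle R => q.[circle_val x] / den bs x).
Proof.
apply: cmeasM; last exact: cmeasV.
apply: cmeas_horner; exact: measurable_circle_val.
Qed.

Let quot_bound bs q (x : circle R) : all (fun b => modC b < 1) bs ->
  modC (q.[circle_val x] / den bs x) <=
  coef_norm q * \prod_(b <- bs) (1 - modC b)^-1.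
Proof.
move=> bs1; rewrite modCM; apply: ler_pM; rewrite ?modC_ge0 //.
- exact: horner_bound.
- exact: den_bound.
Qed.

Lemma inL1_quot bs q : all (fun b => modC b < 1) bs ->
  inL1 mu1 (fun x => q.[circle_val x] / \prod_(b <- bs) (1 - b * circle_val x)).
Proof.
move=> bs1; apply: inL1_bounded; first exact: measurable_quot.
by move=> x; exact: quot_bound.
Qed.

Lemma mean_poly q : Cintegral mu1 setT (fun x => q.[circle_val x]) = q.[0].
Proof.
have iX i : inL1 mu1 (fun x => circle_val x ^+ i).
  by have := @inL1_circle_exprz R i; under eq_fun do rewrite -exprnP.
under [X in Cintegral _ _ X]eq_fun do rewrite horner_coef.
rewrite Cintegral_sum //; last by move=> i; exact: inL1Z.
rewrite horner_coef; apply: eq_bigr => i _.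
rewrite CintegralZ // circle_integralX.
by case: (val i) => [|n]; rewrite ?expr0 // exprS mul0r.
Qed.

(** Peeling one factor off with 1 / (1 - b x) = 1 + b x / (1 - b x) reduces the
    integral to that of x ^ n q(x), at the cost of b ^ n. *)
Lemma mean_rational bs q : all (fun b => modC b < 1) bs ->
  Cintegral mu1 setT
    (fun x => q.[circle_val x] / \prod_(b <- bs) (1 - b * circle_val x)) = q.[0].
Proof.
elim: bs q => [|b bs IH] q.
  move=> _; under [X in Cintegral _ _ X]eq_fun do rewrite big_nil divr1.
  exact: mean_poly.
move=> /[dup] bbs1 /= /andP[b1 bs1].
pose I q := Cintegral mu1 setT (fun x => q.[circle_val x] / den (b :: bs) x).
have step q' : I q' = q'.[0] + b * I ('X * q').
  rewrite -(IH q' bs1) /I -CintegralZ //; last exact: inL1_quot.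
  rewrite -CintegralD //; [|exact: inL1_quot|apply: inL1Z; exact: inL1_quot].
  apply: eq_Cintegral => x _; rewrite /den big_cons hornerM hornerX.
  have nz c : modC c < 1 -> 1 - c * circle_val x != 0.
    move=> c1; apply/eqP => e; have := one_sub_ge c x.
    by rewrite e modC0 leNgt subr_gt0 c1.
  have nzp : \prod_(c <- bs) (1 - c * circle_val x) != 0.
    rewrite prodf_seq_neq0; apply/allP => c /(allP bs1) c1 /=; exact: nz.
  have := nz b b1 => nzb; field.
  by rewrite nzp nzb.
have itn n : I ('X * q) = b ^+ n * I ('X ^+ n.+1 * q).
  elim: n => [|n ->]; first by rewrite expr0 mul1r expr1.
  rewrite step hornerM exprS hornerM hornerX !mul0r add0r mulrA -exprSr.
  by rewrite mulrA -!exprS.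
suff : I ('X * q) = 0.
  by move=> I0; rewrite -/(I q) step I0 mulr0 addr0.
pose K := 2 * (coef_norm q * \prod_(c <- b :: bs) (1 - modC c)^-1).
have IK n : modC (I ('X ^+ n.+1 * q)) <= K.
  have -> : K = 2 * (coef_norm ('X ^+ n.+1 * q) * \prod_(c <- b :: bs) (1 - modC c)^-1).
    congr (_ * (_ * _)); elim: (n.+1) => [|m IHm]; first by rewrite expr0 mul1r.
    by rewrite exprS -mulrA coef_normXM.
  rewrite -lee_fin; apply: (le_trans (modC_Cintegral _ _)) => //.
    exact: inL1_quot.
  rewrite EFinM lee_wpmul2l //.
  apply: (@Lpint_bounded _ _ _ mu1 1); first exact: measurable_quot.
  by move=> x; exact: quot_bound.
apply: modC_eq0; apply/eqP; rewrite eq_le modC_ge0 andbT.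
have cv : (modC b ^+ n * K) @[n --> \oo] --> (0 * K).
  apply: cvgM; last exact: cvg_cst.
  by apply: cvg_expr; rewrite ger0_norm ?modC_ge0.
rewrite mul0r in cv.
apply: (ler_cvg_to (cvg_cst (modC (I ('X * q)))) cv).
by near=> n; rewrite (itn n) modCM modCX ler_wpM2l ?exprn_ge0 ?modC_ge0.
Unshelve. all: by end_near.
Qed.

Definition circle_of (a : R[i]) (h : modC a = 1) : circle R :=
  @Circle R a (introT eqP (etrans (normCE a) (congr1 (real_complex R) h))).

(** If p had a root a in the disc, p times the Poisson kernel at a would be an
    analytic function vanishing at 0, although its real part is bounded below
    by a positive constant. *)
Lemma root_outside_disc p (lam : R) (a : R[i]) : 0 < lam ->
  (forall x : circle R, lam <= ReC p.[circle_val x]) -> root p a -> 1 < modC a.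
Proof.
move=> lam0 Rep pa; rewrite ltNge; apply/negP => a1.
have {}a1 : modC a < 1.
  rewrite lt_neqAle a1 andbT; apply/eqP => h.
  have := Rep (circle_of h); rewrite /= (rootP pa) /= leNgt lam0 //.
have /factor_theorem [q qE] := pa.
pose c : R := 1 - modC a ^+ 2.
have c0 : 0 < c by rewrite subr_gt0 expr_lt1 // modC_ge0.
pose b := (a^*)%C.
have b1 : all (fun b => modC b < 1) [:: b] by rewrite /= modCJ a1.
pose Q : {poly R[i]} := 'X * q * (c%:C)%C%:P.
pose g (x : circle R) := Q.[circle_val x] / \prod_(b <- [:: b]) (1 - b * circle_val x).
have gE x : g x = ((c / modC (1 - b * circle_val x) ^+ 2)%:C)%C * p.[circle_val x].
  have nz : 1 - b * circle_val x != 0.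
    apply/eqP => e; have := one_sub_ge b x.
    by rewrite e modC0 leNgt subr_gt0 modCJ a1.
  have xn := circle_neq0 x.
  have cE w : ((c / modC w ^+ 2)%:C)%C = c%:C%C / (w * w^*%C) :> R[i].
    by rewrite mulCJ -(fmorph_div (real_complex R)).
  have -> : p.[circle_val x] = q.[circle_val x] * (circle_val x - a).
    by rewrite qE hornerM hornerXsubC.
  rewrite cE /g /Q big_seq1 hornerM hornerM hornerX hornerC.
  have -> : ((1 - b * circle_val x)^*)%C = 1 - a / circle_val x.
    by rewrite rmorphB rmorphM rmorph1 /b /= conjcK circleV.
  have nz2 : circle_val x - a != 0.
    apply/eqP => /subr0_eq xa; move: a1; rewrite -xa circle_norm ltxx //.
  by field; rewrite nz nz2 xn.
have ig : inL1 mu1 g by exact: inL1_quot.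
have : Cintegral mu1 setT g = 0.
  by rewrite /g mean_rational // /Q !hornerE.
move=> /(congr1 (fun z => ReC z)) /= /eqP; rewrite gt_eqF //.
apply: (@lt_le_trans _ _ (\int[mu1]_x (lam * c / 4))).
  rewrite Rintegral_cst //.
  have -> : fine (mu1 setT) = 1 by rewrite probability_setT.
  by rewrite mulr1 divr_gt0 // mulr_gt0.
apply: le_Rintegral => //.
- exact: finite_measure_integrable_cst.
- exact: inL1_Re.
move=> x _; rewrite gE ReCM /= mul0r subr0.
have D0 : 0 < modC (1 - b * circle_val x).
  by apply: lt_le_trans (one_sub_ge b x); rewrite subr_gt0 modCJ.
have D2 : modC (1 - b * circle_val x) <= 2.
  apply: (le_trans (modCB _ _)); rewrite modC1 modCM circle_norm mulr1 modCJ.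
  by rewrite (_ : 2 = 1 + 1) // lerD2l ltW.
rewrite -mulrA mulrC; apply: ler_pM => //.
- by rewrite divr_ge0 // ltW.
- exact: ltW.
- rewrite ler_pM2l // lef_pV2 ?posrE ?exprn_gt0 //.
  have -> : 4 = 2 ^+ 2 :> R by rewrite expr2 -natrM.
  by rewrite lerXn2r // nnegrE ltW.
Qed.

(** The roots of p lie outside the closed disc, so 1 / p is a constant over a product
    of factors 1 - b x with |b| < 1. *)
Lemma mean_inverse p (lam : R) : 0 < lam ->
  (forall x : circle R, lam <= ReC p.[circle_val x]) ->
  inL1 mu1 (fun x => p.[circle_val x]^-1) /\
  Cintegral mu1 setT (fun x => p.[circle_val x]^-1) = p.[0]^-1.
Proof.
move=> lam0 Rep.
have [r pE] := closed_field_poly_normal p.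
have p0 : p != 0.
  apply/eqP => p0; have := Rep (circle1 R); rewrite p0 horner0 /= leNgt lam0 //.
have rout z : z \in r -> 1 < modC z.
  move=> zr; apply: (root_outside_disc lam0 Rep).
  by rewrite pE rootZ ?lead_coef_eq0 // root_prod_XsubC.
pose bs := [seq z^-1 | z <- r].
have bs1 : all (fun b => modC b < 1) bs.
  apply/allP => _ /mapP [z zr ->]; rewrite modCV invf_lt1 ?rout //.
  by apply: lt_trans (rout z zr).
have pe x : p.[x] = p.[0] * \prod_(b <- bs) (1 - b * x).
  rewrite pE !hornerZ !horner_prod -mulrA /bs big_map; congr (_ * _).
  rewrite -big_split /= !big_seq; apply: eq_bigr => z zr.
  rewrite !hornerE.
  have z0 : z != 0.
    by apply/eqP => z0; have := rout z zr; rewrite z0 modC0 ltr10.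
  by field.
have e : (fun x : circle R => p.[circle_val x]^-1) = (fun x : circle R =>
    (p.[0]^-1)%:P.[circle_val x] / \prod_(b <- bs) (1 - b * circle_val x)).
  by apply/funext => x; rewrite pe invfM hornerC.
rewrite e; split; first exact: inL1_quot.
by rewrite mean_rational // hornerC.
Qed.

End mean_value.

Section kolmogorov_weight.
Variable R : realType.
Variable lam : R.
Hypothesis lam0 : 0 < lam.

(** The real part of 2 z / (z + lam), written so that z occurs only in an inverse.
    It is harmonic and nonnegative on the right half-plane, at least 1 outside the
    disc of radius lam, and small at real points small compared with lam. *)
Definition kolm (z : R[i]) : R := ReC (2 - 2 * lam%:C%C * (z + lam%:C%C)^-1).

Lemma kolmE z : 0 <= ReC z -> kolm z =
  2 * (ReC z * (ReC z + lam) + ImC z ^+ 2) / ((ReC z + lam) ^+ 2 + ImC z ^+ 2).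
Proof.
move=> z0; have D0 : 0 < (ReC z + lam) ^+ 2 + ImC z ^+ 2.
  by rewrite ltr_wpDr ?sqr_ge0 // exprn_gt0 // ltr_wpDl.
rewrite /kolm !ReImE ReCV ImCV modC_sqr !ReImE /= !addr0.
rewrite /=; field; exact: lt0r_neq0.
Qed.

Lemma kolm_ge0 z : 0 <= ReC z -> 0 <= kolm z.
Proof.
move=> z0; rewrite kolmE // divr_ge0 // ?mulr_ge0 ?addr_ge0 ?sqr_ge0 //.
  by rewrite mulr_ge0 // addr_ge0 // ltW.
Qed.

Lemma kolm_ge1 z : 0 <= ReC z -> lam <= modC z -> 1 <= kolm z.
Proof.
move=> z0 lamz; rewrite kolmE //.
have D0 : 0 < (ReC z + lam) ^+ 2 + ImC z ^+ 2.
  by rewrite ltr_wpDr ?sqr_ge0 // exprn_gt0 // ltr_wpDl.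
rewrite ler_pdivlMr // mul1r.
have : lam ^+ 2 <= modC z ^+ 2 by rewrite lerXn2r ?nnegrE ?modC_ge0 // ltW.
by rewrite modC_sqr; nra.
Qed.

Lemma measurable_kolm d (T : measurableType d) (f : T -> R[i]) :
  measurable_fun setT f -> measurable_fun setT (fun x => kolm (f x)).
Proof.
move=> mf.
have mq : measurable_fun setT (fun x => 2 - 2 * lam%:C%C * (f x + lam%:C%C)^-1).
  apply: cmeasB; first exact: cmeas_cst.
  apply: cmeasM; first exact: cmeas_cst.
  by apply: cmeasV; apply: cmeasD => //; exact: cmeas_cst.
by have [] := (cmeasP _).1 mq.
Qed.

Lemma kolm_real (c : R) : 0 <= c -> kolm c%:C%C <= 2 * c / lam.
Proof.
move=> c0; rewrite kolmE //= expr0n /= !addr0.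
have cl : 0 < c + lam by rewrite ltr_wpDl.
have -> : 2 * (c * (c + lam)) / (c + lam) ^+ 2 = 2 * c / (c + lam).
  by field; exact: lt0r_neq0.
by rewrite ler_wpM2l ?mulr_ge0 // lef_pV2 ?posrE // lerDr.
Qed.

(** The mean value property of [kolm] along an analytic disc, which comes from
    that of the inverse of p + lam. *)
Lemma kolm_mean (p : {poly R[i]}) :
  (forall x : circle R, 0 <= ReC p.[circle_val x]) ->
  (\int[circle_prob R]_x (kolm p.[circle_val x])%:E = (kolm p.[0])%:E)%E.
Proof.
move=> Rep.
pose q := p + lam%:C%C%:P.
have qE x : q.[x] = p.[x] + lam%:C%C by rewrite !hornerE.
have Req (x : circle R) : lam <= ReC q.[circle_val x].
  by rewrite qE ReCD lerDr.
have [i1 m1] := mean_inverse lam0 Req.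
have ic : inL1 (circle_prob R) (fun=> 2 : R[i]).
  by apply: (@inL1_bounded _ _ _ _ _ (modC (2 : R[i]))) => //; exact: cmeas_cst.
have ik : inL1 (circle_prob R)
    (fun x => 2 - 2 * lam%:C%C * (p.[circle_val x] + lam%:C%C)^-1).
  apply: inL1B => //; apply: inL1Z.
  by under eq_fun do rewrite -qE.
have <- : \int[circle_prob R]_x kolm p.[circle_val x] = kolm p.[0].
  rewrite -[LHS]/(ReC (Cintegral (circle_prob R) setT
    (fun x => 2 - 2 * lam%:C%C * (p.[circle_val x] + lam%:C%C)^-1))).
  under [X in Cintegral _ _ X]eq_fun do rewrite -qE.
  rewrite CintegralB // ?CintegralZ //; last exact: inL1Z.
  by rewrite Cintegral_cst m1 qE.
rewrite /Rintegral fineK //.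
apply: integrable_fin_num => //; exact: inL1_Re ik.
Qed.

End kolmogorov_weight.

(** * Trigonometric polynomials on the torus *)

Section trig_poly.
Variable R : realType.

Definition ztail N (z : 'I_N.+1 -> int) : 'I_N -> int := fun i => z (lift ord0 i).

Definition zero_from N n (z : 'I_N -> int) : bool :=
  [forall i : 'I_N, (n <= i)%N ==> (z i == 0)].

(** A trigonometric polynomial is kept as a list of (coefficient, frequency)
    pairs, repetitions allowed, so that Fourier multipliers act termwise. *)
Definition trig N := seq (R[i] * ('I_N -> int)).

Definition teval N (p : trig N) (x : torus R N) : R[i] :=
  \sum_(t <- p) t.1 * torus_char t.2 x.

Definition tmult N (m : ('I_N -> int) -> R[i]) (p : trig N) : trig N :=
  [seq (m t.2 * t.1, t.2) | t <- p].

Definition tscale N (c : R[i]) (p : trig N) : trig N := tmult (fun=> c) p.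

Definition tconj N (p : trig N) : trig N :=
  [seq ((t.1^*)%C, fun i => - t.2 i) | t <- p].

Definition tprod N (p q : trig N) : trig N :=
  [seq (s.1 * t.1, fun i => s.2 i + t.2 i) | s <- p, t <- q].

Definition tsym N (p : trig N) : trig N :=
  tscale 2^-1 p ++ tscale 2^-1 (tconj p).

Definition tsec N (p : trig N.+1) (a : circle R) : trig N :=
  [seq (t.1 * circle_val a ^ t.2 ord0, ztail t.2) | t <- p].

(** Multipliers of the conditional expectation on the first n coordinates, of
    the conjugation in coordinate j, and of the transform being maximized. *)
Definition Em N n (z : 'I_N -> int) : R[i] := (zero_from n z)%:R.

Definition Hsgn (k : int) : R[i] := - 'i%C * (Num.sg k)%:~R.

Definition Hm N (j : 'I_N) (z : 'I_N -> int) : R[i] := Hsgn (z j).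

Definition Tm N n (z : 'I_N -> int) : R[i] :=
  \sum_(j < N | (j < n)%N) Hm j z * (Em j.+1 z - Em j z).

Definition tmean N (p : trig N) : R[i] := \sum_(t <- p) Em 0 t.2 * t.1.

Lemma torus_char_norm N z (x : torus R N) : modC (torus_char z x) = 1.
Proof.
rewrite /torus_char; elim/big_rec : _ => [|i y _ IH]; first exact: modC1.
by rewrite modCM IH circle_exprz_norm mulr1.
Qed.

Lemma torus_charD N (z w : 'I_N -> int) (x : torus R N) :
  torus_char (fun i => z i + w i) x = torus_char z x * torus_char w x.
Proof.
by rewrite /torus_char -big_split; apply: eq_bigr => i _;
   rewrite expfzDr // circle_neq0.
Qed.

Lemma torus_charN N (z : 'I_N -> int) (x : torus R N) :
  torus_char (fun i => - z i) x = (torus_char z x)^*%C.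
Proof.
rewrite /torus_char rmorph_prod; apply: eq_bigr => i _.
exact: circle_exprzN.
Qed.

Lemma torus_char_cons N (z : 'I_N.+1 -> int) a (x : torus R N) :
  torus_char z (tuple_cons (a, x)) =
  circle_val a ^ z ord0 * torus_char (ztail z) x.
Proof.
rewrite /torus_char big_ord_recl tnth0; congr (_ * _).
by apply: eq_bigr => i _; rewrite tnthS.
Qed.

Lemma torus_char0 N (z : 'I_N -> int) (x : torus R N) :
  zero_from 0 z -> torus_char z x = 1.
Proof.
move=> /forallP z0; rewrite /torus_char big1 // => i _.
by have /= /eqP -> := z0 i; rewrite expr0z.
Qed.

Lemma measurable_torus_char N (z : 'I_N -> int) :
  measurable_fun setT (fun x : torus R N => torus_char z x).
Proof.
apply: cmeas_prod => i.
by apply: (measurableT_comp (measurable_circle_exprz _)); exact: measurable_tnth.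
Qed.

Lemma measurable_teval N (p : trig N) : measurable_fun setT (teval p).
Proof.
by apply: cmeas_sum => t; apply: cmeasM; [exact: cmeas_cst|
  exact: measurable_torus_char].
Qed.

Definition tnorm N (p : trig N) : R := \sum_(t <- p) modC t.1.

Lemma teval_bound N (p : trig N) x : modC (teval p x) <= tnorm p.
Proof.
apply: (le_trans (modC_sum _ _ _)); apply: ler_sum => t _.
by rewrite modCM torus_char_norm mulr1.
Qed.

Lemma inL1_torus_char N (z : 'I_N -> int) :
  inL1 (torus_prob R N) (fun x => torus_char z x).
Proof.
apply: (@inL1_bounded _ _ _ _ _ 1); first exact: measurable_torus_char.
by move=> x; rewrite torus_char_norm.
Qed.

Lemma inL1_teval N (p : trig N) : inL1 (torus_prob R N) (teval p).
Proof.
by apply: inL1_bounded; [exact: measurable_teval|exact: teval_bound].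
Qed.

Lemma zero_fromS N n (z : 'I_N.+1 -> int) :
  zero_from n.+1 z = zero_from n (ztail z).
Proof.
apply/forallP/forallP => z0 i; first by have := z0 (lift ord0 i).
case: (unliftP ord0 i) => [j ->|-> //]; exact: (z0 j).
Qed.

Lemma zero_from0 N (z : 'I_N.+1 -> int) :
  zero_from 0 z = (z ord0 == 0) && zero_from 0 (ztail z).
Proof.
apply/forallP/andP => [z0|[z0 /forallP zt] i].
  by split; [exact: (z0 ord0)|apply/forallP => i; exact: (z0 (lift ord0 i))].
case: (unliftP ord0 i) => [j ->|->]; first exact: (zt j).
by rewrite z0.
Qed.

Lemma teval_cat N (p q : trig N) x : teval (p ++ q) x = teval p x + teval q x.
Proof. exact: big_cat. Qed.

Lemma teval_mult N m (p : trig N) x :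
  teval (tmult m p) x = \sum_(t <- p) m t.2 * (t.1 * torus_char t.2 x).
Proof. by rewrite /teval big_map; apply: eq_bigr => t _; rewrite mulrA. Qed.

Lemma teval_scale N c (p : trig N) x : teval (tscale c p) x = c * teval p x.
Proof. by rewrite teval_mult -mulr_sumr. Qed.

Lemma teval_conj N (p : trig N) x : teval (tconj p) x = (teval p x)^*%C.
Proof.
rewrite /teval big_map rmorph_sum; apply: eq_bigr => t _.
by rewrite /= torus_charN rmorphM.
Qed.

Lemma teval_prod N (p q : trig N) x : teval (tprod p q) x = teval p x * teval q x.
Proof.
rewrite /teval /tprod big_allpairs_dep /= mulr_suml; apply: eq_bigr => s _.
rewrite mulr_sumr; apply: eq_bigr => t _.
by rewrite torus_charD; ring.
Qed.

Lemma tmult_cat N m (p q : trig N) : tmult m (p ++ q) = tmult m p ++ tmult m q.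
Proof. exact: map_cat. Qed.

Lemma teval_mult_scale N m c (p : trig N) x :
  teval (tmult m (tscale c p)) x = c * teval (tmult m p) x.
Proof.
rewrite !teval_mult big_map mulr_sumr; apply: eq_bigr => t _ /=; ring.
Qed.

Lemma teval_mult_conj N m (p : trig N) x :
  (forall z, m (fun i => - z i) = (m z)^*%C) ->
  teval (tmult m (tconj p)) x = (teval (tmult m p) x)^*%C.
Proof.
move=> mJ; rewrite !teval_mult big_map rmorph_sum; apply: eq_bigr => t _ /=.
by rewrite torus_charN mJ -!rmorphM.
Qed.

Lemma half_addJ (w : R[i]) : 2^-1 * w + 2^-1 * w^*%C = ((ReC w)%:C)%C.
Proof. by rewrite -mulrDr addcJ mulrA mulVf ?mul1r // pnatr_eq0. Qed.

Lemma teval_mult_sym N m (p : trig N) x :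
  (forall z, m (fun i => - z i) = (m z)^*%C) ->
  teval (tmult m (tsym p)) x = ((ReC (teval (tmult m p) x))%:C)%C.
Proof.
move=> mJ; rewrite /tsym tmult_cat teval_cat !teval_mult_scale.
by rewrite teval_mult_conj // half_addJ.
Qed.

Lemma teval_sym N (p : trig N) x : teval (tsym p) x = ((ReC (teval p x))%:C)%C.
Proof. by rewrite /tsym teval_cat !teval_scale teval_conj half_addJ. Qed.

Lemma EmN N n (z : 'I_N -> int) : Em n (fun i => - z i) = (Em n z)^*%C.
Proof.
rewrite conjc_nat; congr (_%:R); congr (nat_of_bool _).
by apply: eq_forallb => i; rewrite oppr_eq0.
Qed.

Lemma HsgnN k : Hsgn (- k) = (Hsgn k)^*%C.
Proof.
rewrite /Hsgn sgrN; have -> : (- Num.sg k)%:~R = - (Num.sg k)%:~R :> R[i].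
  by rewrite mulrNz.
have -> : (Num.sg k)%:~R = ((Num.sg k)%:~R : R)%:C%C :> R[i] by rewrite rmorph_int.
by apply: eq_ReIm; rewrite !ReImE /=; ring.
Qed.

Lemma HmN N j (z : 'I_N -> int) : Hm j (fun i => - z i) = (Hm j z)^*%C.
Proof. exact: HsgnN. Qed.

Lemma TmN N n (z : 'I_N -> int) : Tm n (fun i => - z i) = (Tm n z)^*%C.
Proof.
rewrite /Tm rmorph_sum; apply: eq_bigr => j _.
by rewrite HmN !EmN -rmorphB -rmorphM.
Qed.

Lemma teval_cons N (p : trig N.+1) a x :
  teval p (tuple_cons (a, x)) = teval (tsec p a) x.
Proof.
by rewrite /teval big_map; apply: eq_bigr => t _; rewrite torus_char_cons mulrA.
Qed.

Lemma tmult_sec N m m' (p : trig N.+1) a : (forall z, m z = m' (ztail z)) ->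
  tsec (tmult m p) a = tmult m' (tsec p a).
Proof.
move=> mm; rewrite /tsec /tmult -!map_comp; apply: eq_map => t /=.
by rewrite mm mulrA.
Qed.

Lemma TmS N n (z : 'I_N.+1 -> int) :
  Tm n.+1 z = Hsgn (z ord0) * Em 0 (ztail z) + Tm n (ztail z).
Proof.
rewrite /Tm big_mkcond big_ord_recl /= [X in _ = _ + X]big_mkcond; congr (_ + _).
  rewrite /Em zero_fromS zero_from0 /Hm.
  by case: eqP => [->|_]; rewrite ?subr0 // /Hsgn sgr0 mulr0 !mul0r.
apply: eq_bigr => j _; rewrite /bump add1n ltnS.
by case: ifP => // _; rewrite /Em !zero_fromS.
Qed.

End trig_poly.

Section torus_integral.
Variable R : realType.

Lemma torus_integral_cons N (f : torus R N.+1 -> R[i]) (B : R) :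
  measurable_fun setT f -> (forall x, modC (f x) <= B) ->
  Cintegral (torus_prob R N.+1) setT f =
  Cintegral (circle_prob R) setT (fun a =>
    Cintegral (torus_prob R N) setT (fun x => f (tuple_cons (a, x)))).
Proof.
move=> mf fB; rewrite [LHS](@Cintegral_distribution _ _ _ _ _ _ _ _ B) //.
rewrite (@Cintegral_fubini _ _ _ _ _ _ _ _ B) //.
by apply: (measurableT_comp mf); exact: measurable_tuple_cons.
Qed.

Lemma torus_integral_char N (z : 'I_N -> int) :
  Cintegral (torus_prob R N) setT (fun x => torus_char z x) = Em R 0 z.
Proof.
elim: N z => [|N IH] z.
  have -> : Em R 0 z = 1 by rewrite /Em (_ : zero_from 0 z) //; apply/forallP => -[].
  rewrite -[RHS](Cintegral_cst (torus_prob R 0)).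
  by apply: eq_Cintegral => x _; rewrite /torus_char big_ord0.
rewrite (torus_integral_cons (B := 1)); last 2 first.
- exact: measurable_torus_char.
- by move=> x; rewrite torus_char_norm.
rewrite [RHS](_ : _ = Em R 0 (ztail z) * (z ord0 == 0)%:R); last first.
  by rewrite /Em zero_from0 -mulnb natrM mulrC.
rewrite -circle_integral_exprz -CintegralZ //; last exact: inL1_circle_exprz.
apply: eq_Cintegral => a _.
under [X in Cintegral _ _ X]eq_fun do rewrite torus_char_cons.
by rewrite CintegralZ ?IH 1?mulrC //; exact: inL1_torus_char.
Qed.

Lemma torus_integral_teval N (p : trig R N) :
  Cintegral (torus_prob R N) setT (teval p) = tmean p.
Proof.
rewrite /teval Cintegral_sum //; last by move=> t; apply: inL1Z; exact: inL1_torus_char.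
apply: eq_bigr => t _; rewrite CintegralZ //; last exact: inL1_torus_char.
by rewrite torus_integral_char mulrC.
Qed.

Lemma tmean_ge0 N (p : trig R N) : (forall x, 0 <= ReC (teval p x)) ->
  0 <= ReC (tmean p).
Proof.
by move=> p0; rewrite -torus_integral_teval; apply: Rintegral_ge0 => x _.
Qed.

(** A character that oscillates in a coordinate from n on is orthogonal to every
    function of the first n coordinates. *)
Lemma torus_integral_low N n (g : torus R N -> R[i]) (B : R) z :
  measurable_fun setT g -> (forall x, modC (g x) <= B) ->
  (forall x y : torus R N,
     (forall i : 'I_N, (i < n)%N -> tnth x i = tnth y i) -> g x = g y) ->
  ~~ zero_from n z ->
  Cintegral (torus_prob R N) setT (fun x => g x * torus_char z x) = 0.
Proof.
elim: N n g z => [|N IH] n g z mg gB gn; first by move/forallPn => [[]].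
case: n gn => [|n] gn zn.
  under [X in Cintegral _ _ X]eq_fun do rewrite (gn _ point) //.
  rewrite CintegralZ //; last exact: inL1_torus_char.
  by rewrite torus_integral_char /Em (negbTE zn) mulr0.
rewrite (torus_integral_cons (B := B)); last 2 first.
- by apply: cmeasM => //; exact: measurable_torus_char.
- by move=> x; rewrite modCM torus_char_norm mulr1.
rewrite -[RHS](Cintegral_cst (circle_prob R)); apply: eq_Cintegral => a _.
have mga : measurable_fun setT (fun x : torus R N => g (tuple_cons (a, x))).
  apply: (measurableT_comp mg).
  by apply: (measurableT_comp (@measurable_tuple_cons _ _ _)); exact: pair1_measurable.
have -> : (fun x : torus R N => g (tuple_cons (a, x)) * torus_char z (tuple_cons (a, x))) =
  (fun x => circle_val a ^ z ord0 *
     (g (tuple_cons (a, x)) * torus_char (ztail z) x)).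
  by apply/funext => x; rewrite torus_char_cons; ring.
rewrite CintegralZ //; last first.
  apply: (@inL1M _ _ _ _ _ _ B) => //; exact: inL1_torus_char.
rewrite (IH n) ?mulr0 //; last by rewrite -zero_fromS.
move=> x y xy; apply: gn => i; case: (unliftP ord0 i) => [j ->|->] /= ij.
  by rewrite !tnthS; apply: xy.
by rewrite !tnth0.
Qed.

End torus_integral.

(** * Weak type inequalities for trigonometric polynomials *)

Section weak_type_trig.
Variable R : realType.
Local Notation mu1 := (circle_prob R).
Local Notation PT N := (torus_prob R N).

Let consset N (A : set (torus R N.+1)) : set (circle R * torus R N) :=
  @tuple_cons _ _ N @^-1` A.

Let measurable_consset N (A : set (torus R N.+1)) :
  measurable A -> measurable (consset A).
Proof.
by move=> mA; rewrite /consset -[X in measurable X]setTI; exact: measurable_tuple_cons.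
Qed.

Let xsectionE N (A : set (torus R N.+1)) a :
  xsection (consset A) a = [set x | A (tuple_cons (a, x))].
Proof. by apply/seteqP; split => x; rewrite /xsection /= ?inE // => /set_mem. Qed.

Lemma torus_prob_cons N (A : set (torus R N.+1)) : measurable A ->
  (PT N.+1 A = \int[mu1]_a PT N [set x | A (tuple_cons (a, x))])%E.
Proof.
move=> mA; rewrite [LHS](_ : _ = \int[mu1]_a (PT N \o xsection (consset A)) a)%E //.
by apply: eq_integral => a _; rewrite /= xsectionE.
Qed.

Lemma measurable_section_prob N (A : set (torus R N.+1)) : measurable A ->
  measurable_fun setT (fun a => PT N [set x | A (tuple_cons (a, x))]).
Proof.
move=> mA; have := measurable_fun_xsection (PT N) (measurable_consset mA).
by apply: eq_measurable_fun => a _; rewrite /= xsectionE.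
Qed.

Lemma measurable_section N (A : set (torus R N.+1)) a : measurable A ->
  measurable [set x | A (tuple_cons (a, x))].
Proof. by move=> mA; rewrite -xsectionE; apply: measurable_xsection; exact: measurable_consset. Qed.

Lemma torus_prob_cons_swap N (A : set (torus R N.+1)) : measurable A ->
  (PT N.+1 A = \int[PT N]_x mu1 [set a | A (tuple_cons (a, x))])%E.
Proof.
move=> mA; have mB := measurable_consset mA.
rewrite [LHS](_ : _ = (mu1 \x PT N)%E (consset A)) //.
have <- : (\int[(mu1 \x PT N)%E]_z (\1_(consset A) z)%:E = (mu1 \x PT N) (consset A))%E.
  by rewrite integral_indic // setIT.
rewrite fubini_tonelli2 //; last first.
  by apply/measurable_EFinP; exact: measurable_indic.
apply: eq_integral => x _; rewrite /fubini_G.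
have mS : measurable [set a | A (tuple_cons (a, x))].
  rewrite [X in measurable X](_ : _ = ysection (consset A) x).
    exact: measurable_ysection.
  by apply/seteqP; split => a; rewrite /ysection /= ?inE // => /set_mem.
by rewrite -(setIT [set a | _]) -integral_indic.
Qed.

(** Symmetrizing the terms w a^k into their real parts turns the sum and its
    conjugate function into the real and imaginary parts of an analytic
    polynomial: w X^k for k > 0, the conjugate of w times X^-k for k < 0. *)
Lemma analytic_completion (ws : seq (R[i] * int)) :
  exists Phi : {poly R[i]},
    (forall a : circle R, Phi.[circle_val a] =
       (ReC (\sum_(t <- ws) t.1 * circle_val a ^ t.2) +i*
        ReC (\sum_(t <- ws) Hsgn R t.2 * (t.1 * circle_val a ^ t.2)))%C) /\
    Phi.[0] = ((ReC (\sum_(t <- ws) (t.2 == 0)%:R * t.1))%:C)%C.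
Proof.
elim: ws => [|[w k] ws [Phi [PhiE Phi0]]].
  by exists 0; split=> [a|]; rewrite horner0 !big_nil.
suff [Q [QE Q0]] : exists Q : {poly R[i]},
    (forall a : circle R, Q.[circle_val a] =
      (ReC (w * circle_val a ^ k) +i* ReC (Hsgn R k * (w * circle_val a ^ k)))%C) /\
    Q.[0] = ((ReC ((k == 0)%:R * w))%:C)%C.
  exists (Q + Phi); split=> [a|]; rewrite hornerD.
    by rewrite QE PhiE !big_cons /=; apply: eq_ReIm; rewrite !ReImE //=.
  by rewrite Q0 Phi0 big_cons /=; apply: eq_ReIm; rewrite !ReImE //= addr0.
have HE : Hsgn R k = (0 +i* (- (Num.sg k)%:~R))%C.
  rewrite /Hsgn (_ : (Num.sg k)%:~R = ((Num.sg k)%:~R : R)%:C%C :> R[i]); last first.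
    by rewrite rmorph_int.
  by apply: eq_ReIm; rewrite !ReImE /=; ring.
have [k0|k0|k0] := ltrgtP k 0; last rewrite k0.
- exists ((w^*)%C%:P * 'X^`|k|); split=> [a|].
    rewrite hornerM hornerC hornerXn.
    have -> : circle_val a ^+ `|k| = (circle_val a ^ k)^*%C.
      by rewrite -circle_exprzN exprnP abszE ltr0_norm.
    rewrite -rmorphM HE ltr0_sg //; apply: eq_ReIm; rewrite !ReImE /= //.
    by ring.
  rewrite hornerM hornerC hornerXn expr0n absz_eq0 (lt_eqF k0) mulr0 mul0r.
  by [].
- exists (w%:P * 'X^`|k|); split=> [a|].
    rewrite hornerM hornerC hornerXn.
    have -> : circle_val a ^+ `|k| = circle_val a ^ k.
      by rewrite exprnP abszE gtr0_norm.
    rewrite HE gtr0_sg //; apply: eq_ReIm; rewrite !ReImE /= //.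
    by ring.
  rewrite hornerM hornerC hornerXn expr0n absz_eq0 (gt_eqF k0) mulr0 mul0r.
  by [].
- exists ((ReC w)%:C%C)%:P; split=> [a|]; rewrite hornerC.
    by rewrite /Hsgn sgr0 mulr0 mul0r expr0z mulr1.
  by rewrite mul1r.
Qed.

(** The analytic martingale with real part the conditional expectation of Re p on
    the first n coordinates. Its starting height beta makes room, when the first
    coordinate is fixed, for the conjugate function in that coordinate. *)
Definition amart N (beta : R) (p : trig R N) n (x : torus R N) : R[i] :=
  (ReC (teval (tmult (Em R n) p) x) +i*
   (beta + ReC (teval (tmult (Tm R n) p) x)))%C.

Lemma amart0 N beta (p : trig R N) x : amart beta p 0 x = (ReC (tmean p) +i* beta)%C.
Proof.
rewrite /amart; congr (_ +i* _)%C.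
  congr ReC; rewrite teval_mult; apply: eq_bigr => t _.
  by rewrite /Em; case: (boolP (zero_from 0 t.2)) => [z0|_];
    rewrite ?mul0r // torus_char0 ?mulr1.
rewrite teval_mult big1 ?addr0 // => t _.
by rewrite /Tm big_pred0 ?mul0r // => j.
Qed.

(** The terms of the conditional expectation of p on the first coordinate. *)
Let slice_terms N (p : trig R N.+1) : seq (R[i] * int) :=
  [seq (Em R 0 (ztail t.2) * t.1, t.2 ord0) | t <- p].

Let tmean_slice N (p : trig R N.+1) a :
  tmean (tsec p a) = \sum_(t <- slice_terms p) t.1 * circle_val a ^ t.2.
Proof.
by rewrite /tmean /tsec /slice_terms !big_map; apply: eq_bigr => t _ /=; rewrite mulrA.
Qed.

Let tmean_slice0 N (p : trig R N.+1) :
  tmean p = \sum_(t <- slice_terms p) (t.2 == 0)%:R * t.1.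
Proof.
rewrite /tmean /slice_terms big_map; apply: eq_bigr => t _ /=.
by rewrite /Em zero_from0 -mulnb natrM mulrA.
Qed.

(** Fixing the first coordinate leaves a martingale of the same kind, on one
    dimension less. *)
Lemma amartS N beta (p : trig R N.+1) n a x :
  amart beta p n.+1 (tuple_cons (a, x)) =
  amart (beta + ReC (\sum_(t <- slice_terms p) Hsgn R t.2 * (t.1 * circle_val a ^ t.2)))
    (tsec p a) n x.
Proof.
rewrite /amart; congr (_ +i* _)%C.
  rewrite teval_cons (@tmult_sec _ _ _ (Em R n)) //.
  by move=> z; rewrite /Em zero_fromS.
rewrite -addrA; congr (_ + _); rewrite -ReCD; congr ReC.
rewrite !teval_mult /slice_terms /tsec !big_map -big_split /=.
apply: eq_bigr => t _; rewrite torus_char_cons TmS mulrDl; congr (_ + _); last by ring.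
rewrite /Em; case: (boolP (zero_from 0 (ztail t.2))) => [z0|_];
  last by rewrite !(mulr0, mul0r).
by rewrite torus_char0 // !mulr1 mul1r.
Qed.

Lemma measurable_amart N beta (p : trig R N) n : measurable_fun setT (amart beta p n).
Proof.
apply/cmeasP; split => /=.
  by have [] := (cmeasP _).1 (measurable_teval (tmult (Em R n) p)).
apply: measurable_funD => //.
by have [] := (cmeasP _).1 (measurable_teval (tmult (Tm R n) p)).
Qed.

Definition amart_max N beta (p : trig R N) (lam : R) : set (torus R N) :=
  [set x | exists n, lam <= modC (amart beta p n x)].

Lemma measurable_amart_max N beta (p : trig R N) (lam : R) :
  measurable (amart_max beta p lam).
Proof.
have -> : amart_max beta p lam =
    \bigcup_n [set x | lam <= modC (amart beta p n x)].
  by apply/seteqP; split => x [n]; [move=> h; exists n|move=> _ h; exists n].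
apply: bigcup_measurable => n _; apply: measurable_ge_set.
by apply: measurable_modC; exact: measurable_amart.
Qed.

(** Doob's maximal inequality for the nonnegative martingale kolm lam (amart n),
    by induction on the dimension: either the starting point already has modulus
    at least lam and the right-hand side is at least 1, or the first coordinate
    is integrated out with [kolm_mean]. *)
Lemma amart_max_le N beta (p : trig R N) (lam : R) : 0 < lam ->
  (forall x, 0 <= ReC (teval p x)) ->
  (PT N (amart_max beta p lam) <= (kolm lam (ReC (tmean p) +i* beta)%C)%:E)%E.
Proof.
move=> lam0; elim: N beta p => [|N IH] beta p p0.
all: have m0 : 0 <= ReC (tmean p) by exact: tmean_ge0.
all: have [cl|cl] := leP lam (modC (ReC (tmean p) +i* beta)%C);
  first by apply: (le_trans (probability_le1 _ (measurable_amart_max _ _ _)));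
    rewrite lee_fin kolm_ge1.
  rewrite (_ : amart_max beta p lam = set0).
    by rewrite measure0 lee_fin kolm_ge0.
  apply/seteqP; split => // x [n]; rewrite leNgt.
  suff -> : amart beta p n x = (ReC (tmean p) +i* beta)%C by rewrite cl.
  rewrite -(amart0 beta p x) /amart; congr (ReC _ +i* (_ + ReC _))%C.
    rewrite !teval_mult; apply: eq_bigr => t _; congr (_ * _).
    by rewrite /Em; congr (_%:R); congr (nat_of_bool _); apply: eq_forallb => -[].
  rewrite !teval_mult; apply: eq_bigr => t _; congr (_ * _).
  by rewrite /Tm !big_ord0.
rewrite torus_prob_cons; last exact: measurable_amart_max.
have [Phi [PhiE Phi0]] := analytic_completion (slice_terms p).
pose Psi := Phi + (0 +i* beta)%C%:P.
have PsiE (a : circle R) : Psi.[circle_val a] = (ReC (tmean (tsec p a)) +i* (beta +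
    ReC (\sum_(t <- slice_terms p) Hsgn R t.2 * (t.1 * circle_val a ^ t.2))))%C.
  rewrite hornerD hornerC PhiE tmean_slice.
  by apply: eq_ReIm; rewrite !ReImE /= ?addr0 // addrC.
have sec0 a x : 0 <= ReC (teval (tsec p a) x) by rewrite -teval_cons.
have Psi_ge0 (a : circle R) : 0 <= ReC Psi.[circle_val a].
  by rewrite PsiE /=; exact: tmean_ge0.
have Psi0 : Psi.[0] = (ReC (tmean p) +i* beta)%C.
  rewrite hornerD hornerC Phi0 tmean_slice0.
  by apply: eq_ReIm; rewrite !ReImE /= ?addr0 ?add0r.
rewrite -Psi0 -(kolm_mean lam0 Psi_ge0).
apply: ge0_le_integral => //.
- exact: measurable_section_prob (measurable_amart_max _ _ _).
- apply/measurable_EFinP; apply: measurable_kolm.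
  by apply: cmeas_horner; exact: measurable_circle_val.
move=> a _; rewrite PsiE; apply: le_trans (IH _ _ (sec0 a)).
apply: le_measure; rewrite ?inE.
- exact: (measurable_section _ (measurable_amart_max _ _ _)).
- exact: measurable_amart_max.
move=> x [[|n]]; first by rewrite amart0 leNgt cl.
by rewrite amartS => h; exists n.
Qed.

Lemma Eint_Re d (T : measurableType d) (P : probability T R) (f : T -> R[i]) :
  inL1 P f -> (\int[P]_x (ReC (f x))%:E = (ReC (Cintegral P setT f))%:E)%E.
Proof.
move=> f1; rewrite /= /Rintegral fineK //.
by apply: integrable_fin_num => //; exact: inL1_Re.
Qed.

(** Started at height 0, the martingale begins at a real point, where [kolm] is at
    most 2 (mean of p) / lam. *)
Lemma max_weak_type N (p : trig R N) (lam : R) : 0 < lam ->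
  (forall x, 0 <= ReC (teval p x)) ->
  (PT N [set x | exists n, (lam <= `|ReC (teval (tmult (Tm R n) p) x)|)%R]
    <= (2 * ReC (tmean p) / lam)%:E)%E.
Proof.
move=> lam0 p0; have m0 : 0 <= ReC (tmean p) by exact: tmean_ge0.
apply: (@le_trans _ _ (PT N (amart_max 0 p lam))); last first.
  apply: (le_trans (amart_max_le _ lam0 p0)).
  by rewrite lee_fin; exact: kolm_real.
apply: le_measure; rewrite ?inE.
- rewrite [X in measurable X](_ : _ =
    \bigcup_n [set x | lam <= `|ReC (teval (tmult (Tm R n) p) x)|]); last first.
    by apply/seteqP; split => x [n]; [move=> h; exists n|move=> _ h; exists n].
  apply: bigcup_measurable => n _; apply: measurable_ge_set.
  apply: measurableT_comp => //.
  by have [] := (cmeasP _).1 (measurable_teval (tmult (Tm R n) p)).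
- exact: measurable_amart_max.
move=> x [n h]; exists n; apply: (le_trans h).
by have := modC_ge_Im (amart 0 p n x); rewrite /= add0r.
Qed.

Let Hset N (j : 'I_N) (p : trig R N) (lam : R) : set (torus R N) :=
  [set x | lam <= `|ReC (teval (tmult (Hm R j) p) x)|].

Let measurable_Hset N (j : 'I_N) (p : trig R N) (lam : R) : measurable (Hset j p lam).
Proof.
apply: measurable_ge_set.
apply: measurableT_comp => //.
by have [] := (cmeasP _).1 (measurable_teval (tmult (Hm R j) p)).
Qed.

(** Kolmogorov's inequality in the first coordinate, the others being fixed. *)
Let Hset_first N (p : trig R N.+1) (lam : R) (x : torus R N) : 0 < lam ->
  (forall x, 0 <= ReC (teval p x)) ->
  (mu1 [set a | Hset ord0 p lam (tuple_cons (a, x))] <=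
   (2 * ReC (teval [seq ((t.2 ord0 == 0)%:R * t.1, ztail t.2) | t <- p] x) / lam)%:E)%E.
Proof.
move=> lam0 p0.
pose ws := [seq (t.1 * torus_char (ztail t.2) x, t.2 ord0) | t <- p].
have [Phi [PhiE Phi0]] := analytic_completion ws.
have PhiRe (a : circle R) : ReC Phi.[circle_val a] = ReC (teval p (tuple_cons (a, x))).
  rewrite PhiE /=; congr ReC; rewrite /ws big_map; apply: eq_bigr => t _ /=.
  by rewrite torus_char_cons; ring.
have PhiIm (a : circle R) : ImC Phi.[circle_val a] =
    ReC (teval (tmult (Hm R ord0) p) (tuple_cons (a, x))).
  rewrite PhiE /=; congr ReC; rewrite /ws teval_mult big_map; apply: eq_bigr => t _ /=.
  by rewrite torus_char_cons /Hm; ring.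
have Phi_ge0 (a : circle R) : 0 <= ReC Phi.[circle_val a] by rewrite PhiRe.
have Phi0E : Phi.[0] = ((ReC (teval
    [seq ((t.2 ord0 == 0)%:R * t.1, ztail t.2) | t <- p] x))%:C)%C.
  rewrite Phi0; congr (ReC _)%:C%C; rewrite /teval /ws !big_map.
  by apply: eq_bigr => t _ /=; ring.
have c0 : 0 <= ReC Phi.[0].
  rewrite -(mean_poly Phi); apply: Rintegral_ge0 => a _; exact: Phi_ge0.
have mP : measurable_fun setT (fun a : circle R => Phi.[circle_val a]).
  apply: cmeas_horner; exact: measurable_circle_val.
have mk := measurable_kolm lam mP.
rewrite Phi0E /= in c0.
apply: (@le_trans _ _ (kolm lam Phi.[0])%:E); last first.
  by rewrite Phi0E lee_fin kolm_real.
rewrite -(kolm_mean lam0 Phi_ge0).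
have := Eint_chebyshev mu1 mk (fun a => kolm_ge0 lam0 (Phi_ge0 a)) ler01.
rewrite mul1e; apply: le_trans; apply: le_measure; rewrite ?inE.
- rewrite [X in measurable X](_ : _ = [set a | lam <= `|ImC Phi.[circle_val a]|]).
    apply: measurable_ge_set.
    apply: measurableT_comp => //.
    by have [] := (cmeasP _).1 mP.
  by apply/seteqP; split => a; rewrite /Hset /= PhiIm.
- exact: measurable_ge_set.
move=> a; rewrite /Hset /= -PhiIm => h; apply: kolm_ge1 => //.
exact: le_trans h (modC_ge_Im _).
Qed.

(** Slicing along the first coordinate reduces j to 0. For j = 0 the slices are
    taken the other way, each is bounded by [Hset_first], and the right-hand sides
    integrate to the mean of p. *)
Lemma conjugate_weak_type N (j : 'I_N) (p : trig R N) (lam : R) : 0 < lam ->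
  (forall x, 0 <= ReC (teval p x)) ->
  (PT N [set x | (lam <= `|ReC (teval (tmult (Hm R j) p) x)|)%R]
    <= (2 * ReC (tmean p) / lam)%:E)%E.
Proof.
move=> lam0; rewrite -/(Hset j p lam).
elim: N j p => [[]//|N IH] j p p0; rewrite -/(Hset j p lam).
have lamE c : 2 * c / lam = 2 / lam * c by ring.
have lam20 : 0 <= 2 / lam by rewrite divr_ge0 // ltW.
case: (unliftP ord0 j) => [i ->|->].
  have sec0 a x : 0 <= ReC (teval (tsec p a) x) by rewrite -teval_cons.
  rewrite torus_prob_cons; last exact: measurable_Hset.
  have iS : inL1 mu1 (fun a => tmean (tsec p a)).
    under eq_fun do rewrite tmean_slice.
    by apply: inL1_sum => t; apply: inL1Z; exact: inL1_circle_exprz.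
  have -> : ((2 * ReC (tmean p) / lam)%:E =
      \int[mu1]_a (2 * ReC (tmean (tsec p a)) / lam)%:E)%E.
    under eq_integral do rewrite lamE.
    rewrite EintZ //; last 2 first.
    - by have [] := (cmeasP _).1 iS.1.
    - by move=> a; exact: tmean_ge0.
    rewrite Eint_Re // lamE EFinM; congr (_ * (ReC _)%:E)%E.
    under [X in Cintegral _ _ X]eq_fun do rewrite tmean_slice.
    rewrite Cintegral_sum; [|by []|by move=> t; apply: inL1Z; exact: inL1_circle_exprz].
    rewrite tmean_slice0; apply: eq_bigr => t _.
    by rewrite CintegralZ ?circle_integral_exprz 1?mulrC //; exact: inL1_circle_exprz.
  apply: ge0_le_integral => //.
  - exact: measurable_section_prob (measurable_Hset _ _ _).
  - apply/measurable_EFinP; under eq_fun do rewrite lamE.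
    apply: measurable_funM; first exact: measurable_cst.
    by have [] := (cmeasP _).1 iS.1.
  move=> a _; apply: le_trans (IH i _ (sec0 a)).
  rewrite (_ : [set x | _] = Hset i (tsec p a) lam) //.
  by apply/seteqP; split => x; rewrite /Hset /= teval_cons (@tmult_sec _ _ _ (Hm R i)).
rewrite torus_prob_cons_swap; last exact: measurable_Hset.
pose q := [seq ((t.2 ord0 == 0)%:R * t.1, ztail t.2) | t <- p] : trig R N.
have q0 x : 0 <= ReC (teval q x).
  have := le_trans (measure_ge0 _ _) (Hset_first x lam0 p0).
  rewrite lee_fin lamE pmulr_rge0 // divr_gt0 //.
have -> : ((2 * ReC (tmean p) / lam)%:E = \int[PT N]_x (2 * ReC (teval q x) / lam)%:E)%E.
  under eq_integral do rewrite lamE.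
  rewrite EintZ //; last first.
    by have [] := (cmeasP _).1 (measurable_teval q).
  rewrite Eint_Re; last exact: inL1_teval.
  rewrite lamE EFinM torus_integral_teval; congr (_ * (ReC _)%:E)%E.
  rewrite /tmean /q big_map; apply: eq_bigr => t _ /=.
  by rewrite /Em zero_from0 -mulnb natrM; ring.
apply: ge0_le_integral => //.
- have mB := measurable_consset (measurable_Hset ord0 p lam).
  have := measurable_fun_ysection mu1 mB.
  apply: eq_measurable_fun => x _ /=; congr (mu1 _).
  by apply/seteqP; split => a; rewrite /ysection /= ?inE // => /set_mem.
- apply/measurable_EFinP; under eq_fun do rewrite lamE.
  apply: measurable_funM; first exact: measurable_cst.
  by have [] := (cmeasP _).1 (measurable_teval q).
- by move=> x _; exact: Hset_first.
Qed.

End weak_type_trig.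

(** * Density of trigonometric polynomials *)

Section dominated.
Context d (T : measurableType d) (R : realType) (P : probability T R).

Lemma dominated_cvg_small (a : nat -> T -> R) (g : T -> R) :
  (forall k, measurable_fun setT (a k)) -> measurable_fun setT g ->
  (forall k x, 0 <= a k x <= g x) -> (\int[P]_x (g x)%:E < +oo)%E ->
  (forall x, a ^~ x @ \oo --> 0) ->
  forall e : R, 0 < e -> exists k, (\int[P]_x (a k x)%:E <= e%:E)%E.
Proof.
move=> ma mg ag gi a0 e e0.
have g0 x : 0 <= g x by have /andP[h1 h2] := ag O x; exact: le_trans h1 h2.
have := @dominated_cvg _ T R P setT measurableT (fun k x => (a k x)%:E) (cst 0%E)
  (fun x => (g x)%:E).
rewrite integral0.
move=> H; have {H} : (\int[P]_x (a k x)%:E)%E @[k --> \oo] --> 0%E.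
  apply: H.
  - by move=> k; exact/measurable_EFinP.
  - by move=> x _; apply: cvg_EFin; [exact: nearW|exact: a0].
  - by [].
  - apply/integrableP; split; first exact/measurable_EFinP.
    by under eq_integral do rewrite gee0_abs ?lee_fin //.
  - move=> k x _; have /andP[h1 h2] := ag k x.
    by rewrite gee0_abs ?lee_fin.
move=> /fine_cvgP[fin cv].
have /cvgr0Pnorm_lt /(_ e e0) cv' := cv.
have [k [fk ek]] : exists k, (\int[P]_x (a k x)%:E)%E \is a fin_num /\
    `|fine (\int[P]_x (a k x)%:E)%E| < e.
  near \oo => k; exists k; split; near: k; [exact: fin|exact: cv'].
exists k; rewrite -(fineK fk) lee_fin; apply: ltW.
exact: le_lt_trans (ler_norm _) ek.
Unshelve. all: by end_near.
Qed.

End dominated.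

Section smoothstep.
Variable R : realType.
Implicit Types t u : R.

(** The polynomial with fixed points 0, 1/2 and 1, whose iterates sort the unit
    interval around 1/2. *)
Definition smoothstep t : R := 3 * t ^+ 2 - 2 * t ^+ 3.

Lemma smoothstep01 t : 0 <= t <= 1 -> 0 <= smoothstep t <= 1.
Proof.
move=> /andP[t0 t1]; rewrite /smoothstep; apply/andP; split.
  have -> : 3 * t ^+ 2 - 2 * t ^+ 3 = t ^+ 2 * (3 - 2 * t) by ring.
  by rewrite mulr_ge0 ?sqr_ge0 //; lra.
rewrite -subr_ge0.
have -> : 1 - (3 * t ^+ 2 - 2 * t ^+ 3) = (1 - t) ^+ 2 * (1 + 2 * t) by ring.
by rewrite mulr_ge0 ?sqr_ge0 //; lra.
Qed.

Lemma smoothstepC t : smoothstep (1 - t) = 1 - smoothstep t.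
Proof. by rewrite /smoothstep; ring. Qed.

Lemma iter_smoothstep01 n t : 0 <= t <= 1 -> 0 <= iter n smoothstep t <= 1.
Proof. by move=> t01; elim: n => // n; exact: smoothstep01. Qed.

Lemma iter_smoothstepC n t : iter n smoothstep (1 - t) = 1 - iter n smoothstep t.
Proof. by elim: n => // n IH; rewrite !iterS IH smoothstepC. Qed.

Lemma iter_smoothstep_le n t : 0 <= t < 2^-1 ->
  iter n smoothstep t <= (t * (3 - 2 * t)) ^+ n * t.
Proof.
move=> /andP[t0 t2]; set r := t * (3 - 2 * t).
have r0 : 0 <= r by rewrite mulr_ge0 //; lra.
have r1 : r <= 1 by rewrite /r; nra.
elim: n => [|n IH]; first by rewrite expr0 mul1r.
rewrite iterS; set u := iter n smoothstep t.
have u0 : 0 <= u by have /andP[] := @iter_smoothstep01 n t ltac:(lra).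
have ut : u <= t.
  by apply: (le_trans IH); rewrite ler_piMl // exprn_ile1.
have -> : smoothstep u = u * (3 - 2 * u) * u by rewrite /smoothstep; ring.
have -> : r ^+ n.+1 * t = r * (r ^+ n * t) by rewrite exprS mulrA.
apply: ler_pM => //; first by rewrite mulr_ge0 //; lra.
by rewrite /r; nra.
Qed.

Lemma cvg_iter_smoothstep_lt t : 0 <= t < 2^-1 ->
  (iter n smoothstep t) @[n --> \oo] --> 0.
Proof.
move=> t02; have /andP[t0 t2] := t02.
have cv : ((t * (3 - 2 * t)) ^+ n * t) @[n --> \oo] --> 0.
  rewrite -[X in _ --> X](mul0r t); apply: cvgM; last exact: cvg_cst.
  apply: cvg_expr; rewrite ger0_norm; last by rewrite mulr_ge0 //; lra.
  by nra.
apply: (@squeeze_cvgr _ _ _ _ (cst 0) _ _ _ _ (cvg_cst 0) cv).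
apply: nearW => n; rewrite iter_smoothstep_le // andbT.
by have /andP[] := @iter_smoothstep01 n t ltac:(lra).
Qed.

(** Composing with t (2 t - 1), which kills the middle fixed point, gives a
    polynomial approximation of the indicator of t > 1/2 valid at every point. *)
Definition sharpstep n t : R :=
  iter n smoothstep t * (2 * iter n smoothstep t - 1).

Lemma cvg_sharpstep t : 0 <= t <= 1 ->
  sharpstep ^~ t @ \oo --> ((2^-1 < t)%R%:R : R).
Proof.
move=> /andP[t0 t1]; rewrite /sharpstep.
have lim (l : R) : (iter n smoothstep t) @[n --> \oo] --> l ->
   (iter n smoothstep t * (2 * iter n smoothstep t - 1)) @[n --> \oo] --> l * (2 * l - 1).
  move=> cl; apply: cvgM => //; apply: cvgB; last exact: cvg_cst.
  by apply: cvgM => //; exact: cvg_cst.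
have [tl|tg|te] := ltrgtP t 2^-1.
- have /lim : iter n smoothstep t @[n --> \oo] --> (0 : R).
    by apply: cvg_iter_smoothstep_lt; rewrite t0.
  by rewrite mul0r.
- have /lim : iter n smoothstep t @[n --> \oo] --> (1 : R).
    have -> : (fun n => iter n smoothstep t) =
        (fun n => 1 - iter n smoothstep (1 - t)).
      by apply/funext => n; rewrite iter_smoothstepC subKr.
    rewrite -[X in _ --> X](subr0 1); apply: cvgB; first exact: cvg_cst.
    by apply: cvg_iter_smoothstep_lt; apply/andP; split; lra.
  by rewrite (_ : 1 * (2 * 1 - 1) = 1) //; lra.
- have /lim : iter n smoothstep t @[n --> \oo] --> (2^-1 : R).
    have -> : (fun n => iter n smoothstep t) = cst 2^-1.
      apply/funext => n; rewrite te; elim: n => //= n ->; rewrite /smoothstep /=.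
      by field.
    exact: cvg_cst.
  by rewrite mulfV ?pnatr_eq0 // subrr mulr0.
Qed.

End smoothstep.

Section arithmetic.
Variable R : realFieldType.
Implicit Types e : R.

Lemma split_error4 e : 0 < e -> 2 ^+ 4 * (e / 32 + e / 32) <= e.
Proof. by move=> e0; lra. Qed.

Lemma split_error_mul e (K : R) : 0 < e -> 0 <= K -> K * (e / (K + 1)) <= e.
Proof.
move=> e0 K0; have K1 : 0 < K + 1 by lra.
by rewrite mulrA ler_pdivrMr // mulrC ler_pM2l //; lra.
Qed.

(** With s = psi(x), m = |r(x)| and E = |psi(x) - r(x)|, this bounds
    |psi^2 - |r|^2|^2 by fourth powers of the error; the quadratic term is
    absorbed by E^2 <= eta + E^4 / eta. *)
Lemma sqr_diff_bound (B eta s m E : R) : 0 < eta -> 0 <= B -> 0 <= s -> 0 <= m ->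
  0 <= E -> s ^+ 2 <= B -> m <= s + E -> s <= m + E ->
  `|s ^+ 2 - m ^+ 2| ^+ 2 <= 8 * B * eta + (2 + 8 * B / eta) * E ^+ 4.
Proof.
move=> eta0 B0 s0 m0 E0 s2 h1 h2.
rewrite subr_sqr normrM exprMn.
have h3 : `|s - m| ^+ 2 <= E ^+ 2.
  by rewrite lerXn2r ?nnegrE // ler_norml; apply/andP; split; lra.
have h4 : `|s + m| ^+ 2 <= 2 * E ^+ 2 + 8 * B.
  rewrite real_normK ?num_real //.
  have : (s + m) ^+ 2 <= (2 * s + E) ^+ 2 by rewrite lerXn2r ?nnegrE; lra.
  by have := sqr_ge0 (2 * s - E); nra.
have h5 : E ^+ 2 <= eta + E ^+ 4 / eta.
  rewrite -(ler_pM2r eta0) mulrDl divfK ?lt0r_neq0 //.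
  have -> : E ^+ 4 = (E ^+ 2) ^+ 2 by rewrite -exprM.
  move: (E ^+ 2) (sqr_ge0 E) => u u0.
  by have := sqr_ge0 (u - eta); nra.
apply: (@le_trans _ _ (E ^+ 2 * (2 * E ^+ 2 + 8 * B))).
  by apply: ler_pM => //; exact: sqr_ge0.
have -> : E ^+ 2 * (2 * E ^+ 2 + 8 * B) = 2 * E ^+ 4 + 8 * B * E ^+ 2 by ring.
have -> : 8 * B * eta + (2 + 8 * B / eta) * E ^+ 4 =
    2 * E ^+ 4 + 8 * B * (eta + E ^+ 4 / eta) by ring.
by rewrite lerD2l ler_wpM2l // mulr_ge0.
Qed.

Lemma split_error_eta e (B : R) : 0 < e -> 0 <= B ->
  8 * B * (e / (16 * (B + 1))) + e / 2 <= e.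
Proof.
move=> e0 B0; have B1 : 0 < B + 1 by lra.
have -> : 8 * B * (e / (16 * (B + 1))) = (e / 2) * (B / (B + 1)).
  by field; exact: lt0r_neq0.
have : e / 2 * (B / (B + 1)) <= e / 2.
  by rewrite ler_piMr ?ler_pdivrMr ?mul1r //; lra.
by lra.
Qed.

Lemma affine01 (B a t : R) : 0 <= B -> `|t| <= B ->
  0 <= 2^-1 + (2 * (1 + `|a| + B))^-1 * (t - a) <= 1.
Proof.
move=> B0 tB; set c := 1 + `|a| + B.
have c0 : 0 < c by rewrite /c; have := normr_ge0 a; lra.
have : `|t - a| <= c.
  by apply: (le_trans (ler_normB _ _)); rewrite /c; lra.
rewrite ler_norml => /andP[h1 h2].
have i0 : 0 < (2 * c)^-1 by rewrite invr_gt0 mulr_gt0.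
have ic : (2 * c)^-1 * c = 2^-1 by field; exact: lt0r_neq0.
by apply/andP; split; nra.
Qed.

End arithmetic.

Section density.
Variables (R : realType) (N : nat).
Local Notation P := (torus_prob R N).
Local Notation tr := (trig R N).
Implicit Types (f g : torus R N -> R[i]) (phi psi : torus R N -> R).

Definition approx4 f := forall e : R, 0 < e ->
  exists p : tr, (Lpint P 4 (fun x => f x - teval p x)%R <= e%:E)%E.

Lemma approx4_closed f : measurable_fun setT f ->
  (forall e : R, 0 < e -> exists g, [/\ measurable_fun setT g, approx4 g &
    (Lpint P 4 (fun x => f x - g x)%R <= e%:E)%E]) -> approx4 f.
Proof.
move=> mf H e e0; have e20 : 0 < e / 32 by rewrite divr_gt0.
have [g [mg /(_ _ e20)[p gp] fg]] := H _ e20.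
exists p.
have -> : (fun x => f x - teval p x) = (fun x => (f x - g x) + (g x - teval p x)).
  by apply/funext => x; rewrite addrA subrK.
have mp := measurable_teval p.
apply: (le_trans (LpintD P 4 (cmeasB mf mg) (cmeasB mg mp))).
apply: (@le_trans _ _ ((2 ^+ 4)%:E * ((e / 32)%:E + (e / 32)%:E))%E).
  by apply: lee_wpmul2l; [rewrite lee_fin exprn_ge0|exact: leeD].
by rewrite -EFinD -EFinM lee_fin split_error4.
Qed.

Lemma approx4_teval (p : tr) : approx4 (teval p).
Proof.
move=> e e0; exists p; under eq_fun do rewrite subrr.
apply: (le_trans (@Lpint_bounded _ _ _ P 4 _ 0 _ _)).
- exact: cmeas_cst.
- by move=> x; rewrite modC0.
- by rewrite lee_fin expr0n /= ltW.
Qed.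

Lemma approx4D f g : measurable_fun setT f -> measurable_fun setT g ->
  approx4 f -> approx4 g -> approx4 (fun x => f x + g x).
Proof.
move=> mf mg af ag e e0; have e20 : 0 < e / 32 by rewrite divr_gt0.
have [p fp] := af _ e20; have [q gq] := ag _ e20.
exists (p ++ q).
have -> : (fun x => f x + g x - teval (p ++ q) x) =
    (fun x => (f x - teval p x) + (g x - teval q x)).
  by apply/funext => x; rewrite teval_cat; ring.
have mp := measurable_teval p; have mq := measurable_teval q.
apply: (le_trans (LpintD P 4 (cmeasB mf mp) (cmeasB mg mq))).
apply: (@le_trans _ _ ((2 ^+ 4)%:E * ((e / 32)%:E + (e / 32)%:E))%E).
  by apply: lee_wpmul2l; [rewrite lee_fin exprn_ge0|exact: leeD].
by rewrite -EFinD -EFinM lee_fin split_error4.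
Qed.

Let approx4M_aux f g (B : R) e : 0 < e -> measurable_fun setT f ->
  measurable_fun setT g -> (forall x, modC (f x) <= B) ->
  (Lpint P 4 g <= (e / (B ^+ 4 + 1))%:E)%E ->
  (Lpint P 4 (fun x => f x * g x)%R <= e%:E)%E.
Proof.
move=> e0 mf mg fB ge.
have B0 : 0 <= B := le_trans (modC_ge0 _) (fB point).
have B4 : 0 <= B ^+ 4 by rewrite exprn_ge0.
apply: (le_trans (LpintM P 4 mf mg fB)).
apply: (@le_trans _ _ ((B ^+ 4)%:E * (e / (B ^+ 4 + 1))%:E)%E).
  by apply: lee_wpmul2l.
by rewrite -EFinM lee_fin split_error_mul.
Qed.

Lemma approx4M f g (B B' : R) : measurable_fun setT f -> measurable_fun setT g ->
  (forall x, modC (f x) <= B) -> (forall x, modC (g x) <= B') ->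
  approx4 f -> approx4 g -> approx4 (fun x => f x * g x).
Proof.
move=> mf mg fB gB' af ag.
have small (h : R) e : 0 < e -> 0 < e / (h ^+ 4 + 1).
  by move=> e0; rewrite divr_gt0 // ltr_wpDl // exprn_even_ge0.
have afp (p : tr) : approx4 (fun x => teval p x * f x).
  move=> e e0; have [q fq] := af _ (small (tnorm p) e e0).
  exists (tprod p q).
  have -> : (fun x => teval p x * f x - teval (tprod p q) x) =
      (fun x => teval p x * (f x - teval q x)).
    by apply/funext => x; rewrite teval_prod mulrBr.
  apply: (@approx4M_aux _ _ (tnorm p)) => //.
  - exact: measurable_teval.
  - by apply: cmeasB => //; exact: measurable_teval.
  - exact: teval_bound.
apply: approx4_closed; first exact: cmeasM.
move=> e e0; have [q gq] := ag _ (small B e e0).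
exists (fun x => teval q x * f x); split => //.
  by apply: cmeasM => //; exact: measurable_teval.
have -> : (fun x => f x * g x - teval q x * f x) = (fun x => f x * (g x - teval q x)).
  by apply/funext => x; ring.
apply: (@approx4M_aux _ _ B) => //.
by apply: cmeasB => //; exact: measurable_teval.
Qed.

(** The bounded real functions in the L4 closure of the trigonometric
    polynomials: an algebra closed under bounded pointwise limits. Closeness in L4
    is what makes squared moduli close in L2. *)
Definition good phi := [/\ measurable_fun setT phi, (exists B, forall x, `|phi x| <= B) &
  approx4 (fun x => (phi x)%:C%C)].

Lemma good_cst (c : R) : good (fun=> c).
Proof.
split; first exact: measurable_cst.
  by exists `|c| => x.
have -> : (fun=> c%:C%C) = teval [:: (c%:C%C, fun=> 0)] :> (torus R N -> R[i]).
  apply/funext => x; rewrite /teval big_seq1 /torus_char big1 ?mulr1 //.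
exact: approx4_teval.
Qed.

Lemma goodD phi psi : good phi -> good psi -> good (fun x => phi x + psi x).
Proof.
move=> [m1 [B1 b1] a1] [m2 [B2 b2] a2]; split; first exact: measurable_funD.
  by exists (B1 + B2) => x; apply: (le_trans (ler_normD _ _)); rewrite lerD.
under eq_fun do rewrite rmorphD.
by apply: approx4D => //; exact: cmeas_real.
Qed.

Lemma goodM phi psi : good phi -> good psi -> good (fun x => phi x * psi x).
Proof.
move=> [m1 [B1 b1] a1] [m2 [B2 b2] a2]; split; first exact: measurable_funM.
  by exists (B1 * B2) => x; rewrite normrM ler_pM.
under eq_fun do rewrite rmorphM.
apply: (@approx4M _ _ B1 B2) => //; try exact: cmeas_real.
- by move=> x; rewrite modC_real.
- by move=> x; rewrite modC_real.
Qed.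

Lemma goodB phi psi : good phi -> good psi -> good (fun x => phi x - psi x).
Proof.
move=> g1 g2; have := goodD g1 (goodM (good_cst (-1)) g2).
by under eq_fun do rewrite mulN1r.
Qed.

Lemma good_sum I (r : seq I) (F : I -> torus R N -> R) :
  (forall i, good (F i)) -> good (fun x => \sum_(i <- r) F i x).
Proof.
move=> gF; elim: r => [|i r IH].
  by under eq_fun do rewrite big_nil; exact: good_cst.
by under eq_fun do rewrite big_cons; exact: goodD.
Qed.

Lemma good_lim (phi_ : nat -> torus R N -> R) phi (B : R) :
  (forall n, good (phi_ n)) -> (forall n x, `|phi_ n x| <= B) ->
  (forall x, phi_ ^~ x @ \oo --> phi x) -> good phi.
Proof.
move=> gn bn cn.
have mphi : measurable_fun setT phi.
  apply: (measurable_fun_cvg (h := phi_)) => // n; by have [] := gn n.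
have bphi x : `|phi x| <= B.
  have cn' : (`|phi_ n x|) @[n --> \oo] --> `|phi x| by apply: cvg_norm; exact: cn.
  apply: (cvgr_to_le cn'); exact: nearW.
split => //; first by exists B.
apply: approx4_closed; first exact: cmeas_real.
move=> e e0.
have [k ke] : exists k, (\int[P]_x (`|phi x - phi_ k x| ^+ 4)%:E <= e%:E)%E.
  apply: (@dominated_cvg_small _ _ _ P _ (fun=> (2 * B) ^+ 4)) => //.
  - move=> k; apply: measurable_funX; apply: measurableT_comp => //.
    by apply: measurable_funB => //; have [] := gn k.
  - move=> k x; rewrite exprn_ge0 //= lerXn2r ?nnegrE //.
      by rewrite mulr_ge0 //; apply: le_trans (bphi x).
    apply: (le_trans (ler_normB _ _)).
    by rewrite mulr_natl mulr2n lerD.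
  - by rewrite Eint_cst ltry.
  - move=> x; rewrite -[X in _ --> X](_ : `|phi x - phi x| ^+ 4 = 0); last first.
      by rewrite subrr normr0 expr0n.
    have := @exprn_continuous _ 4 `|phi x - phi x|.
    apply: cvg_comp; apply: cvg_norm; apply: cvgB; [exact: cvg_cst|exact: cn].
exists (fun x => (phi_ k x)%:C%C); split.
- by apply: cmeas_real; have [] := gn k.
- by have [] := gn k.
- rewrite /Lpint; under eq_integral do rewrite -rmorphB modC_real //.
  exact: ke.
Qed.

(** Polynomials in a good function are good, and the iterated polynomials
    [sharpstep] converge to an indicator, so superlevel sets of good functions have
    good indicators. *)
Lemma good_iter_smoothstep phi n : good phi -> good (fun x => iter n (@smoothstep R) (phi x)).
Proof.
move=> gphi; elim: n => // n gn.
have -> : (fun x => iter n.+1 (@smoothstep R) (phi x)) = (fun x =>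
   3 * (iter n (@smoothstep R) (phi x) * iter n (@smoothstep R) (phi x)) -
   2 * (iter n (@smoothstep R) (phi x) *
   (iter n (@smoothstep R) (phi x) * iter n (@smoothstep R) (phi x)))).
  by apply/funext => x; rewrite iterS /smoothstep; ring.
by apply: goodB; apply: goodM; [exact: good_cst|exact: goodM|exact: good_cst|
  apply: goodM => //; exact: goodM].
Qed.

Lemma good_gt_half phi : good phi -> (forall x, 0 <= phi x <= 1) ->
  good (fun x => ((2^-1 < phi x)%R%:R : R)).
Proof.
move=> gphi phi01.
apply: (@good_lim (fun n x => sharpstep n (phi x)) _ 1).
- move=> n; rewrite /sharpstep; apply: goodM; first exact: good_iter_smoothstep.
  apply: goodB; last exact: good_cst.
  apply: goodM; [exact: good_cst|exact: good_iter_smoothstep].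
- move=> n x; rewrite /sharpstep; set u := iter n _ _.
  have /andP[u0 u1] : 0 <= u <= 1 by exact: iter_smoothstep01.
  by rewrite normrM -[1]mulr1 ler_pM // ler_norml; apply/andP; split; move: u0 u1; clear; lra.
- by move=> x; exact: cvg_sharpstep.
Qed.

Lemma good_gt phi (a : R) : good phi -> good (fun x => ((a < phi x)%R%:R : R)).
Proof.
move=> gphi; have [_ [B bphi] _] := gphi.
have B0 : 0 <= B by apply: le_trans (bphi point).
pose c := 1 + `|a| + B.
have c0 : 0 < c by rewrite /c; have := normr_ge0 a; lra.
have -> : (fun x => ((a < phi x)%R%:R : R)) =
    (fun x => (2^-1 < 2^-1 + (2 * c)^-1 * (phi x - a))%R%:R).
  apply/funext => x; congr (nat_of_bool _)%:R.
  by rewrite ltrDl pmulr_rgt0 ?subr_gt0 // invr_gt0 mulr_gt0.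
apply: good_gt_half.
  apply: goodD; first exact: good_cst.
  by apply: goodM; [exact: good_cst|apply: goodB => //; exact: good_cst].
by move=> x; apply: affine01.
Qed.

Definition goodset : set (set (torus R N)) :=
  [set D | good (fun x => (\1_D x : R))].

Lemma sigma_algebra_goodset : sigma_algebra setT goodset.
Proof.
split.
- rewrite /goodset /= (_ : (fun x => \1_set0 x) = (fun=> 0 : R)); first exact: good_cst.
  by apply/funext => x; rewrite indic0.
- move=> D gD; rewrite /goodset /= (_ : (fun x => \1_(setT `\` D) x) = (fun x => 1 - \1_D x : R)).
    by apply: goodB => //; exact: good_cst.
  apply/funext => x; rewrite !indicE in_setD in_setT /=.
  by case: (x \in D); rewrite /= ?subrr ?subr0.
- move=> F gF.
  have gU n : good (fun x => (\1_(\bigcup_(i < n) F i) x : R)).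
    elim: n => [|n IH].
      rewrite (_ : (fun x => _) = (fun=> 0 : R)); first exact: good_cst.
      by apply/funext => x; rewrite bigcup_mkord big_ord0 indic0.
    rewrite (_ : (fun x => _) = (fun x =>
       1 - (1 - \1_(\bigcup_(i < n) F i) x) * (1 - \1_(F n) x) : R)).
      apply: goodB; first exact: good_cst.
      by apply: goodM; apply: goodB => //; try exact: good_cst; exact: gF.
    apply/funext => x; rewrite !bigcup_mkord big_ord_recr /= !indicE in_setU.
    by case: (x \in _); case: (x \in _) => /=; ring.
  apply: (@good_lim (fun n x => \1_(\bigcup_(i < n) F i) x) _ 1) => //.
  + by move=> n x; rewrite indicE ger0_norm // lern1 leq_b1.
  + move=> x; rewrite indicE; have [|xF] := boolP (x \in \bigcup_k F k).
      move=> /set_mem [k _ Fkx].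
      apply: cvg_near_cst; exists k.+1 => // n /= kn; rewrite indicE mem_set //.
      by exists k.
    apply: cvg_near_cst; apply: nearW => n; rewrite indicE memNset //.
    move=> [k _ Fkx]; move/negP: xF; apply; rewrite inE; by exists k.
Qed.

Definition tcoord (c : R[i]) (i : 'I_N) : tr := [:: (c, fun j => (j == i)%:Z)].

Lemma teval_coord c i x : teval (tcoord c i) x = c * circle_val (tnth x i).
Proof.
rewrite /teval big_seq1 /= /torus_char (bigD1 i) //= eqxx expr1z big1 ?mulr1 // => j ji.
by rewrite (negbTE ji) expr0z.
Qed.

Lemma good_Re (p : tr) : good (fun x => ReC (teval p x)).
Proof.
split.
- by have [] := (cmeasP _).1 (measurable_teval p).
- exists (tnorm p) => x; exact: le_trans (modC_ge_Re _) (teval_bound _ _).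
- by under eq_fun do rewrite -teval_sym; exact: approx4_teval.
Qed.

(** The real and imaginary parts of the coordinates are good, and by [good_gt] good
    functions are measurable for the sigma-algebra [goodset], which therefore
    contains the one that the coordinates generate. *)
Lemma measurable_goodset (D : set (torus R N)) : measurable D -> goodset D.
Proof.
pose T' : measurableType _ := g_sigma_algebraType goodset.
have goodE : <<s goodset >> = goodset by rewrite sigma_algebra_id //; exact: sigma_algebra_goodset.
have mgood phi : good phi -> measurable_fun (setT : set T') phi.
  move=> gphi; apply: (measurability (@RGenOInfty.G R)).
    exact: RGenOInfty.measurableE.
  move=> _ [_ [a ->] <-]; apply: sub_sigma_algebra.
  rewrite /goodset /= (_ : (fun x => _) = (fun x => (a < phi x)%R%:R : R)); first exact: good_gt.
  apply/funext => x; rewrite indicE; congr (nat_of_bool _)%:R.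
  by apply/idP/idP; rewrite !inE setTI /= in_itv /= andbT.
have mid : measurable_fun (setT : set T') (fun x : T' => x : torus R N).
  apply/measurable_fun_tnthP => i _ _ [B mB <-].
  have mi : measurable_fun (setT : set T') (fun x : T' => circle_val (tnth (x : torus R N) i)).
    apply: measurable_complex.
    - under eq_fun do rewrite -[circle_val _]mul1r -teval_coord.
      by apply: mgood; exact: good_Re.
    - have -> : (fun x : torus R N => ImC (circle_val (tnth x i))) =
          (fun x => ReC (teval (tcoord (- 'i%C) i) x)).
        by apply/funext => x; rewrite teval_coord !ReImE /=; ring.
      by apply: mgood; exact: good_Re.
  by have := mi measurableT B mB; rewrite !setTI.
by move=> mD; have := mid measurableT D mD; rewrite setTI => mD'; rewrite -goodE.
Qed.

Import HBNNSimple.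

Lemma good_bounded phi (B : R) : measurable_fun setT phi ->
  (forall x, 0 <= phi x <= B) -> good phi.
Proof.
move=> mphi phiB.
have mphiE : measurable_fun setT (EFin \o phi) by exact/measurable_EFinP.
pose s := nnsfun_approx measurableT mphiE.
have phi0 x : setT x -> (0 <= (EFin \o phi) x)%E.
  by move=> _; rewrite lee_fin; have /andP[] := phiB x.
have gs n : good (s n).
  have -> : (s n : torus R N -> R) = (fun x =>
      \sum_(r \in range (s n)) r * \1_(s n @^-1` [set r]) x).
    by apply/funext => x; exact: fimfunE.
  under eq_fun do rewrite fsbig_finite //.
  apply: good_sum => r; apply: goodM; first exact: good_cst.
  by apply: measurable_goodset; exact: measurable_funPTI.
have bs n x : `|s n x| <= B.
  rewrite ger0_norm // /s nnsfun_approxE.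
  have := le_approx n phi0 (I : setT x).
  rewrite lee_fin => /le_trans; apply; by have /andP[] := phiB x.
have cs x : (fun n => s n x) @ \oo --> phi x.
  by have /fine_cvgP[] := cvg_nnsfun_approx measurableT mphiE phi0 (I : setT x).
exact: (good_lim gs bs cs).
Qed.

Definition tsq (r : tr) : tr := tsym (tprod r (tconj r)).

Lemma teval_sq r x : teval (tsq r) x = ((modC (teval r x) ^+ 2)%:C)%C.
Proof. by rewrite teval_sym teval_prod teval_conj mulCJ. Qed.

(** The polynomial r approximates the square root of phi in L4. *)
Lemma tsq_bounded_approx phi (B : R) : measurable_fun setT phi ->
  (forall x, 0 <= phi x <= B) -> forall e : R, 0 < e ->
  exists r : tr, (Lpint P 2 (fun x => (phi x)%:C%C - teval (tsq r) x)%R <= e%:E)%E.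
Proof.
move=> mphi phiB e e0.
pose psi x := Num.sqrt (phi x).
have mpsi : measurable_fun setT psi.
  exact: (measurableT_comp (continuous_measurable_fun (@sqrt_continuous R))).
have psi0 x : 0 <= psi x by exact: sqrtr_ge0.
have psi2 x : psi x ^+ 2 = phi x by rewrite sqr_sqrtr //; have /andP[] := phiB x.
have B0 : 0 <= B by have /andP[h1 h2] := phiB point; exact: le_trans h1 h2.
have gpsi : good psi.
  apply: (@good_bounded _ (Num.sqrt B)) => // x.
  by rewrite psi0 /=; apply: ler_wsqrtr; have /andP[] := phiB x.
pose eta := e / (16 * (B + 1)).
have eta0 : 0 < eta by rewrite divr_gt0 // mulr_gt0 // ltr_wpDl.
pose K := 2 + 8 * B / eta.
have K0 : 0 < K.
  by apply: ltr_wpDr => //; apply: divr_ge0; [exact: mulr_ge0|exact: ltW].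
pose dl := e / (2 * K).
have dl0 : 0 < dl by rewrite divr_gt0 // mulr_gt0.
have [_ _ apsi] := gpsi; have [r rdl] := apsi _ dl0.
exists r.
pose E x := modC ((psi x)%:C%C - teval r x).
have ptw x : modC ((phi x)%:C%C - teval (tsq r) x) ^+ 2 <= 8 * B * eta + K * E x ^+ 4.
  rewrite teval_sq -rmorphB modC_real -psi2; apply: sqr_diff_bound => //.
  - exact: modC_ge0.
  - exact: modC_ge0.
  - by rewrite psi2; have /andP[] := phiB x.
  - rewrite -{1}(subrK ((psi x)%:C%C) (teval r x)); apply: (le_trans (modCD _ _)).
    by rewrite modC_real ger0_norm // modCBC addrC.
  - rewrite -[X in X <= _]ger0_norm // -modC_real -{1}(subrK (teval r x) ((psi x)%:C%C)).
    by apply: (le_trans (modCD _ _)); rewrite addrC.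
have mE : measurable_fun setT (fun x => E x ^+ 4).
  apply: measurable_modCX; apply: cmeasB; last exact: measurable_teval.
  exact: cmeas_real.
apply: (@le_trans _ _ (\int[P]_x (8 * B * eta + K * E x ^+ 4)%:E)%E).
  apply: Eint_le => //.
  - apply: measurable_modCX; apply: cmeasB; last exact: measurable_teval.
    exact: cmeas_real.
  - apply: measurable_funD; first exact: measurable_cst.
    by apply: measurable_funM => //; exact: measurable_cst.
  - by move=> x; rewrite exprn_ge0 // modC_ge0.
rewrite EintD //; last 3 first.
- by apply: measurable_funM => //; exact: measurable_cst.
- by move=> _; apply: mulr_ge0; [exact: mulr_ge0|exact: ltW].
- by move=> x; apply: mulr_ge0; [exact: ltW|rewrite exprn_ge0 // modC_ge0].
rewrite Eint_cst EintZ //; last 2 first.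
- exact: ltW.
- by move=> x; rewrite exprn_ge0 // modC_ge0.
apply: (@le_trans _ _ ((8 * B * eta)%:E + K%:E * dl%:E)%E).
  by apply: leeD => //; apply: lee_wpmul2l => //; rewrite lee_fin ltW.
rewrite -EFinM -EFinD lee_fin.
have -> : K * dl = e / 2 by rewrite /dl; field; exact: lt0r_neq0.
exact: split_error_eta.
Qed.

End density.

(** * Approximation by squared moduli *)

Section nonneg_approx.
Variables (R : realType) (N : nat).
Local Notation P := (torus_prob R N).
Local Notation tr := (trig R N).
Implicit Types (f g : torus R N -> R[i]) (phi psi : torus R N -> R).

(** Pointwise, t <= eta + t^2 / eta. *)
Lemma Lpint1_le2 d (T : measurableType d) (Q : probability T R) (f : T -> R[i]) (eta : R) :
  0 < eta -> measurable_fun setT f ->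
  (Lpint Q 1 f <= eta%:E + (eta^-1)%:E * Lpint Q 2 f)%E.
Proof.
move=> eta0 mf; have m2 := measurable_modCX 2 mf.
have i0 : 0 <= eta^-1 by rewrite invr_ge0 ltW.
have sq0 x : 0 <= modC (f x) ^+ 2 by rewrite exprn_ge0 // modC_ge0.
rewrite /Lpint -EintZ // -[X in (X + _)%E](Eint_cst Q) -EintD //; last 3 first.
- by apply: measurable_funM => //; exact: measurable_cst.
- by move=> x; exact: ltW.
- by move=> x; rewrite mulr_ge0.
apply: Eint_le.
- exact: measurable_modCX.
- apply: measurable_funD; first exact: measurable_cst.
  by apply: measurable_funM => //; exact: measurable_cst.
- by move=> x; rewrite expr1 modC_ge0.
move=> x; rewrite expr1 -(ler_pM2r eta0) mulrDl mulrAC mulVf ?lt0r_neq0 // mul1r.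
by have := modC_ge0 (f x); nra.
Qed.

(** Truncation at a large height reduces to bounded functions. *)
Lemma tsq_approx p phi : (0 < p <= 2)%N -> measurable_fun setT phi ->
  (forall x, 0 <= phi x) -> (Lpint P p (fun x => (phi x)%:C%C)%R < +oo)%E ->
  forall e : R, 0 < e ->
  exists r : tr, (Lpint P p (fun x => (phi x)%:C%C - teval (tsq r) x)%R <= e%:E)%E.
Proof.
move=> p12 mphi phi0 phip e e0.
have e80 : 0 < e / 8 by rewrite divr_gt0.
have mmin k : measurable_fun setT (fun x => Num.min (phi x) k%:R).
  by apply: measurable_minr => //; exact: measurable_cst.
have [k hk] : exists k, (\int[P]_x ((phi x - Num.min (phi x) k%:R) ^+ p)%:E <= (e / 8)%:E)%E.
  apply: (@dominated_cvg_small _ _ _ P _ (fun x => phi x ^+ p)) => //.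
  - by move=> k; apply: measurable_funX; exact: measurable_funB.
  - exact: measurable_funX.
  - move=> k x; have h : 0 <= phi x - Num.min (phi x) k%:R <= phi x.
      by rewrite subr_ge0 ge_min lexx /= gerBl le_min phi0 ler0n.
    have /andP[h1 h2] := h.
    by rewrite exprn_ge0 //= lerXn2r ?nnegrE.
  - move: phip; rewrite /Lpint; congr (_ < _)%E; apply: eq_integral => x _.
    by rewrite modC_real ger0_norm.
  - move=> x; apply: cvg_near_cst; near=> k.
    rewrite min_l ?subrr ?expr0n.
      by case: (p) p12 => // -[].
    near: k; exact: nbhs_infty_ger.
pose phik x := Num.min (phi x) k%:R.
have phikB x : 0 <= phik x <= k%:R.
  by rewrite /phik le_min phi0 ler0n /= ge_min lexx orbT.
have mphik : measurable_fun setT phik := mmin k.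
have [r hr] : exists r : tr,
    (Lpint P p (fun x => (phik x)%:C%C - teval (tsq r) x)%R <= (e / 8)%:E)%E.
  case: p p12 {hk phip} => [//|[|[|//]]] _; last exact: tsq_bounded_approx (mmin k) phikB _ e80.
  have e160 : 0 < e / 16 by rewrite divr_gt0.
  have e2 : 0 < e / 16 * (e / 16) by rewrite mulr_gt0.
  have [r hr] := tsq_bounded_approx (mmin k) phikB e2.
  exists r; apply: (le_trans (Lpint1_le2 P e160 _)).
    by apply: cmeasB; [exact: cmeas_real (mmin k)|exact: measurable_teval].
  apply: (@le_trans _ _ ((e / 16)%:E + ((e / 16)^-1)%:E * (e / 16 * (e / 16))%:E)%E).
    by apply: leeD => //; apply: lee_wpmul2l => //; rewrite lee_fin invr_ge0 ltW.
  rewrite -EFinM -EFinD mulKf ?lt0r_neq0 //.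
  by rewrite (_ : e / 16 + e / 16 = e / 8) //; field.
exists r.
have -> : (fun x => (phi x)%:C%C - teval (tsq r) x) = (fun x =>
    ((phi x)%:C%C - (phik x)%:C%C) + ((phik x)%:C%C - teval (tsq r) x)).
  by apply/funext => x; rewrite addrA subrK.
apply: (le_trans (LpintD P p _ _)).
- by apply: cmeasB; exact: cmeas_real.
- by apply: cmeasB; [exact: cmeas_real|exact: measurable_teval].
apply: (@le_trans _ _ ((2 ^+ 2)%:E * ((e / 8)%:E + (e / 8)%:E))%E).
  apply: lee_pmul => //.
  - by apply: adde_ge0; exact: Lpint_ge0.
  - by rewrite lee_fin ler_weXn2l ?ler1n //; have /andP[] := p12.
  - apply: leeD => //; apply: le_trans hk; rewrite /Lpint le_eqVlt; apply/orP; left.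
    apply/eqP; apply: eq_integral => x _; rewrite -rmorphB modC_real ger0_norm //.
    by rewrite subr_ge0 ge_min lexx.
by rewrite -EFinD -EFinM (_ : 2 ^+ 2 * (e / 8 + e / 8) = e) //; field.
Unshelve. all: by end_near.
Qed.

(** The positive and negative parts of Re f and Im f, in the order given by the
    rotations i^k of [qpartE]. *)
Definition qpart (k : nat) f (x : torus R N) : R :=
  Num.max (ReC ((- 'i%C) ^+ k * f x)) 0.

Lemma qpart_ge0 k f x : 0 <= qpart k f x.
Proof. by rewrite /qpart le_max lexx orbT. Qed.

Lemma measurable_qpart k f : measurable_fun setT f -> measurable_fun setT (qpart k f).
Proof.
move=> mf; apply: measurable_maxr; last exact: measurable_cst.
have mm : measurable_fun setT (fun x => (- 'i%C) ^+ k * f x).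
  by apply: cmeasM => //; exact: cmeas_cst.
by have [] := (cmeasP _).1 mm.
Qed.

Lemma qpart_le k f x : qpart k f x <= modC (f x).
Proof.
rewrite /qpart ge_max modC_ge0 andbT; apply: (le_trans (ler_norm _)).
apply: (le_trans (modC_ge_Re _)); rewrite modCM modCX modCN modCi expr1n mul1r //.
Qed.

Lemma qpartE f x : f x = \sum_(k < 4) 'i%C ^+ k * (qpart k f x)%:C%C.
Proof.
have pn (t : R) : Num.max t 0 - Num.max (- t) 0 = t.
  have [t0|t0] := leP 0 t.
    by rewrite max_r ?subr0 // oppr_le0.
  by rewrite max_l ?oppr_ge0 ?ltW // sub0r opprK.
rewrite !big_ord_recr big_ord0 /= /qpart.
have i2 : 'i%C ^+ 2 = -1 :> R[i] by exact: sqr_i.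
have i3 : 'i%C ^+ 3 = - 'i%C :> R[i] by rewrite exprS i2 mulrN1.
have ni2 : (- 'i%C) ^+ 2 = -1 :> R[i] by rewrite sqrrN.
have ni3 : (- 'i%C) ^+ 3 = 'i%C :> R[i] by rewrite exprS ni2 mulrN1 opprK.
rewrite i2 i3 ni2 ni3 !expr0 !expr1.
have r1 : ReC (- 'i%C * f x) = ImC (f x) by rewrite !ReImE /=; ring.
have r3 : ReC ('i%C * f x) = - ImC (f x) by rewrite !ReImE /=; ring.
rewrite r1 r3 mulN1r !mul1r ReCN; apply: eq_ReIm; rewrite !ReImE /=.
- by rewrite -[LHS]pn; ring.
- by rewrite -[LHS]pn; ring.
Qed.

Definition tcomb (r : 'I_4 -> tr) : tr :=
  flatten [seq tscale ('i%C ^+ k) (tsq (r k)) | k : 'I_4 <- enum 'I_4].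

Lemma teval_flatten (I : Type) (s : seq I) (F : I -> tr) m x :
  teval (tmult m (flatten [seq F k | k <- s])) x = \sum_(k <- s) teval (tmult m (F k)) x.
Proof.
elim: s => [|k s IH]; first by rewrite big_nil /teval big_nil.
by rewrite big_cons /= tmult_cat teval_cat IH.
Qed.

Lemma teval_mult_comb m r x : teval (tmult m (tcomb r)) x =
  \sum_(k < 4) 'i%C ^+ k * teval (tmult m (tsq (r k))) x.
Proof.
rewrite /tcomb teval_flatten big_enum /=; apply: eq_bigr => k _.
exact: teval_mult_scale.
Qed.

Lemma teval_mult1 (p : tr) x : teval (tmult (fun=> 1) p) x = teval p x.
Proof. by rewrite teval_mult; apply: eq_bigr => t _; rewrite mul1r. Qed.

Lemma teval_comb r x : teval (tcomb r) x = \sum_(k < 4) 'i%C ^+ k * teval (tsq (r k)) x.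
Proof.
rewrite -teval_mult1 teval_mult_comb; apply: eq_bigr => k _.
by rewrite teval_mult1.
Qed.

Lemma Lpint_sum_small d (T : measurableType d) (Q : probability T R) p n :
  exists2 K : R, 0 < K & forall (F : 'I_n -> T -> R[i]) (dl : R), 0 <= dl ->
    (forall i, measurable_fun setT (F i)) ->
    (forall i, Lpint Q p (F i) <= dl%:E)%E -> (0 < p)%N ->
    (Lpint Q p (fun x => \sum_(i < n) F i x)%R <= (K * dl)%:E)%E.
Proof.
elim: n => [|n [K K0 IH]].
  exists 1 => // F dl dl0 mF Fd p0; under eq_fun do rewrite big_ord0.
  apply: (le_trans (@Lpint_bounded _ _ _ Q p _ 0 _ _)).
  - exact: cmeas_cst.
  - by move=> x; rewrite modC0.
  - by rewrite lee_fin expr0n; case: (p) p0 => // m _; rewrite mul1r.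
exists (2 ^+ p * (K + 1)); first by rewrite mulr_gt0 ?exprn_gt0 // ltr_wpDr // ltW.
move=> F dl dl0 mF Fd p0; under eq_fun do rewrite big_ord_recr /=.
apply: (le_trans (LpintD Q p _ _)) => //; first exact: cmeas_sum.
rewrite -mulrA EFinM; apply: lee_wpmul2l; first by rewrite lee_fin exprn_ge0.
by rewrite mulrDl mul1r EFinD; apply: leeD => //; exact: IH.
Qed.

(** Every function in Lp, for p = 1 or 2, is approximated by a combination with
    coefficients 1, i, -1, -i of squared moduli of trigonometric polynomials, so
    that each of the four pieces is nonnegative and controlled in norm by f. *)
Lemma tcomb_approx p f : (0 < p <= 2)%N -> measurable_fun setT f ->
  (Lpint P p f < +oo)%E -> forall e : R, 0 < e ->
  exists r : 'I_4 -> tr, (Lpint P p (fun x => f x - teval (tcomb r) x)%R <= e%:E)%E /\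
    forall k : 'I_4, (Lpint P p (fun x => (qpart k f x)%:C%C - teval (tsq (r k)) x)%R <= e%:E)%E.
Proof.
move=> p12 mf fp e e0; have [K K0 HK] := Lpint_sum_small P p 4.
pose dl := Num.min e (e / K).
have dl0 : 0 < dl by rewrite lt_min e0 divr_gt0.
have mq k := measurable_qpart k mf.
have : forall k : 'I_4, exists r : tr,
    (Lpint P p (fun x => (qpart k f x)%:C%C - teval (tsq r) x)%R <= dl%:E)%E.
  move=> k; apply: tsq_approx => //; first by move=> x; exact: qpart_ge0.
  apply: le_lt_trans fp; apply: Lpint_le => //; first exact: cmeas_real.
  by move=> x; rewrite modC_real ger0_norm ?qpart_ge0 // qpart_le.
move=> /choice [r hr]; exists r; split; last first.
  by move=> k; apply: (le_trans (hr k)); rewrite lee_fin ge_min lexx.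
have -> : (fun x => f x - teval (tcomb r) x) =
    (fun x => \sum_(k < 4) 'i%C ^+ k * ((qpart k f x)%:C%C - teval (tsq (r k)) x)).
  apply/funext => x; rewrite {1}(qpartE f x) teval_comb -sumrB.
  by apply: eq_bigr => k _; rewrite mulrBr.
have mk (k : 'I_4) : measurable_fun setT (fun x => (qpart k f x)%:C%C - teval (tsq (r k)) x).
  by apply: cmeasB; [exact: cmeas_real|exact: measurable_teval].
have /andP[p0 _] := p12.
apply: (@le_trans _ _ (K * dl)%:E); last first.
  by rewrite lee_fin mulrC -ler_pdivlMr // ge_min lexx orbT.
apply: HK => //; first exact: ltW.
  by move=> k; apply: cmeasM => //; exact: cmeas_cst.
move=> k; apply: le_trans (hr k); apply: Lpint_le => //.
  by apply: cmeasM => //; exact: cmeas_cst.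
by move=> x; rewrite modCM modCX modCi expr1n mul1r.
Qed.

End nonneg_approx.

(** * Conjugation on L2 *)

Section L2_theory.
Variables (R : realType) (N : nat).
Local Notation P := (torus_prob R N).
Local Notation tr := (trig R N).
Local Notation freq := ('I_N -> int).
Implicit Types (f g e q u v : torus R N -> R[i]) (S : seq freq) (z : freq).

Lemma inL2_inL1 f : inL2 P f -> inL1 P f.
Proof.
move=> [mf f2]; split => //.
apply: (le_lt_trans (Lpint1_le2 P ltr01 mf)).
by rewrite invr1 mul1e lte_add_pinfty // ltry.
Qed.

Lemma inL2_bounded f (B : R) : measurable_fun setT f ->
  (forall x, modC (f x) <= B) -> inL2 P f.
Proof.
by move=> mf fB; split => //; apply: le_lt_trans (Lpint_bounded P 2 mf fB) (ltry _).
Qed.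

Lemma inL2_teval (p : tr) : inL2 P (teval p).
Proof. by apply: inL2_bounded; [exact: measurable_teval|exact: teval_bound]. Qed.

Lemma inL2B f g : inL2 P f -> inL2 P g -> inL2 P (fun x => f x - g x).
Proof.
move=> [mf f2] [mg g2]; split; first exact: cmeasB.
apply: (le_lt_trans (LpintB P 2 mf mg)).
by apply: lte_mul_pinfty => //; exact: lte_add_pinfty.
Qed.

Let integrable_sq f : inL2 P f -> P.-integrable setT (EFin \o (fun x => modC (f x) ^+ 2)).
Proof.
move=> [mf f2]; apply/integrableP; split.
  by apply/measurable_EFinP; exact: measurable_modCX.
apply: le_lt_trans f2; rewrite le_eqVlt; apply/orP; left; apply/eqP.
by apply: eq_integral => x _ /=; rewrite ger0_norm // exprn_ge0 // modC_ge0.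
Qed.

Let Lpint2E f : inL2 P f -> Lpint P 2 f = (\int[P]_x (modC (f x) ^+ 2))%:E.
Proof.
by move=> f2; rewrite /Rintegral fineK //; apply: integrable_fin_num => //;
   exact: integrable_sq.
Qed.

(** Boundedness of q makes the product integrable without an appeal to the
    Cauchy-Schwarz inequality. *)
Lemma pythagoras e q (B : R) : inL2 P e -> measurable_fun setT q ->
  (forall x, modC (q x) <= B) ->
  Cintegral P setT (fun x => e x * (q x)^*%C)%R = 0 ->
  (Lpint P 2 (fun x => e x + q x)%R = Lpint P 2 e + Lpint P 2 q)%E.
Proof.
move=> e2 mq qB eq0; have q2 := inL2_bounded mq qB; have [me _] := e2.
have h1 : inL1 P (fun x => e x * (q x)^*%C).
  under eq_fun do rewrite mulrC.
  apply: (@inL1M _ _ _ _ _ _ B).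
  - exact: cmeasJ.
  - exact: inL2_inL1.
  - by move=> x; rewrite modCJ.
have eqq2 : inL2 P (fun x => e x + q x).
  have := inL2B e2 (inL2_bounded (cmeasN mq) (fun x => _ : _ <= B)).
  under eq_fun do rewrite opprK; apply=> x; by rewrite modCN.
have ih : P.-integrable setT (EFin \o (fun x => 2 * ReC (e x * (q x)^*%C))).
  by apply: (integrableZl measurableT 2 (inL1_Re measurableT h1)).
have ie := integrable_sq e2; have iq := integrable_sq q2.
rewrite !Lpint2E // -EFinD; congr (_%:E).
rewrite -[RHS]addr0.
have <- : \int[P]_x (2 * ReC (e x * (q x)^*%C)) = 0.
  rewrite RintegralZl //; last exact: inL1_Re.
  have /(congr1 (fun w : R[i] => ReC w)) /= -> := eq0.
  by rewrite mulr0.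
rewrite -RintegralD // -RintegralD //; last by have := integrableD measurableT ie iq.
by apply: eq_Rintegral => x _; rewrite !modC_sqr !ReImE; ring.
Qed.

Lemma fourier_coef_char z w :
  fourier_coef (fun x : torus R N => torus_char w x) z = Em R 0 (fun i => w i - z i).
Proof.
rewrite -torus_integral_char; apply: eq_Cintegral => x _.
rewrite -[LHS]/(torus_char w x * (torus_char z x)^*%C).
by rewrite -torus_charN -torus_charD.
Qed.

Lemma inL1_fourier f z : inL1 P f -> inL1 P (fun x => f x * (torus_char z x)^*%C).
Proof.
move=> f1; under eq_fun do rewrite mulrC.
apply: (@inL1M _ _ _ _ _ _ 1) => //.
- by apply: cmeasJ; exact: measurable_torus_char.
- by move=> x; rewrite modCJ torus_char_norm.
Qed.

Lemma fourier_coefB f g z : inL1 P f -> inL1 P g ->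
  fourier_coef (fun x => f x - g x) z = fourier_coef f z - fourier_coef g z.
Proof.
move=> f1 g1; rewrite /fourier_coef -CintegralB //; try exact: inL1_fourier.
by apply: eq_Cintegral => x _; rewrite mulrBl.
Qed.

Lemma fourier_teval (p : tr) z :
  fourier_coef (teval p) z = \sum_(t <- p) t.1 * Em R 0 (fun i => t.2 i - z i).
Proof.
have i1 (t : R[i] * freq) : inL1 P (fun x => t.1 * (torus_char t.2 x * (torus_char z x)^*%C)).
  by apply: inL1Z; apply: inL1_fourier; exact: inL1_torus_char.
transitivity (Cintegral P setT
    (fun x => \sum_(t <- p) t.1 * (torus_char t.2 x * (torus_char z x)^*%C))%R).
  by apply: eq_Cintegral => x _; rewrite mulr_suml; apply: eq_bigr => t _; rewrite mulrA.
rewrite Cintegral_sum //; apply: eq_bigr => t _.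
rewrite CintegralZ //; last by apply: inL1_fourier; exact: inL1_torus_char.
by congr (_ * _); exact: fourier_coef_char.
Qed.

Definition tproj S f : tr := [seq (fourier_coef f z, z) | z <- S].

Lemma EmB_neq z w : w != z -> Em R 0 (fun i => w i - z i) = 0.
Proof.
move=> wz; rewrite /Em; case: (boolP (zero_from 0 _)) => // /forallP h.
case/eqP: wz; apply/funext => i; apply/eqP; rewrite -subr_eq0; exact: (h i).
Qed.

Lemma Em0B z : Em R 0 (fun i => z i - z i) = 1.
Proof. by rewrite /Em (_ : zero_from 0 _) //; apply/forallP => i; rewrite subrr. Qed.

Lemma fourier_tproj S f z : uniq S -> z \in S ->
  fourier_coef (teval (tproj S f)) z = fourier_coef f z.
Proof.
move=> uS zS; rewrite fourier_teval big_map (bigD1_seq z) //= Em0B mulr1.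
rewrite big1_seq ?addr0 // => w /andP[wz _]; by rewrite EmB_neq ?mulr0.
Qed.

Lemma orthogonal_teval e (p : tr) : inL1 P e ->
  (forall t, t \in [seq t.2 | t <- p] -> fourier_coef e t = 0) ->
  Cintegral P setT (fun x => e x * (teval p x)^*%C)%R = 0.
Proof.
move=> e1 eo.
have i1 (t : R[i] * freq) : inL1 P (fun x => t.1^*%C * (e x * (torus_char t.2 x)^*%C)).
  by apply: inL1Z; exact: inL1_fourier.
transitivity (Cintegral P setT
    (fun x => \sum_(t <- p) t.1^*%C * (e x * (torus_char t.2 x)^*%C))%R).
  apply: eq_Cintegral => x _; rewrite /teval rmorph_sum mulr_sumr.
  by apply: eq_bigr => t _; rewrite rmorphM mulrCA.
rewrite Cintegral_sum //; elim: p eo => [|t p IH] eo; first by rewrite big_nil.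
rewrite big_cons IH ?addr0; last by move=> w wp; apply: eo; rewrite inE wp orbT.
rewrite CintegralZ //; last exact: inL1_fourier.
rewrite -/(fourier_coef e t.2) eo ?mulr0 //; by rewrite inE eqxx.
Qed.

Lemma fourier_residual S f z : inL2 P f -> uniq S -> z \in S ->
  fourier_coef (fun x => f x - teval (tproj S f) x) z = 0.
Proof.
move=> f2 uS zS; rewrite fourier_coefB; [|exact: inL2_inL1|exact: inL1_teval].
by rewrite fourier_tproj // subrr.
Qed.

Lemma residual_pythagoras S f (p : tr) : inL2 P f -> uniq S ->
  {subset [seq t.2 | t <- p] <= S} ->
  (Lpint P 2 (fun x => (f x - teval (tproj S f) x) + teval p x)%R =
   Lpint P 2 (fun x => f x - teval (tproj S f) x)%R + Lpint P 2 (teval p))%E.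
Proof.
move=> f2 uS pS; have e2 := inL2B f2 (inL2_teval (tproj S f)).
apply: (@pythagoras _ _ (tnorm p)) => //.
- exact: measurable_teval.
- exact: teval_bound.
apply: orthogonal_teval; first exact: inL2_inL1.
by move=> z /pS zS; exact: fourier_residual.
Qed.

Lemma tproj_freq S f : [seq t.2 | t <- tproj S f] = S.
Proof. by rewrite -map_comp map_id_in. Qed.

Lemma bessel S f : inL2 P f -> uniq S ->
  (Lpint P 2 f = Lpint P 2 (fun x => f x - teval (tproj S f) x)%R +
                 Lpint P 2 (teval (tproj S f)))%E.
Proof.
move=> f2 uS; rewrite -residual_pythagoras //; last by rewrite tproj_freq.
by congr (Lpint _ _ _); apply/funext => x; rewrite subrK.
Qed.

Lemma best_approximation S f (p : tr) : inL2 P f -> uniq S ->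
  {subset [seq t.2 | t <- p] <= S} ->
  (Lpint P 2 (fun x => f x - teval (tproj S f) x)%R <=
   Lpint P 2 (fun x => f x - teval p x)%R)%E.
Proof.
move=> f2 uS pS.
have -> : (fun x => f x - teval p x) = (fun x => (f x - teval (tproj S f) x) +
    teval (tproj S f ++ tscale (-1) p) x).
  by apply/funext => x; rewrite teval_cat teval_scale; ring.
rewrite residual_pythagoras ?leeDl //; first exact: Lpint_ge0.
move=> z; rewrite map_cat mem_cat tproj_freq => /orP[//|].
by rewrite -map_comp => /pS.
Qed.

Lemma Lpint_tproj S f : uniq S ->
  Lpint P 2 (teval (tproj S f)) = (\sum_(z <- S) modC (fourier_coef f z) ^+ 2)%:E.
Proof.
elim: S => [_|z S IH /= /andP[zS uS]].
  rewrite big_nil /tproj /=; apply/eqP; rewrite eq_le Lpint_ge0 andbT.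
  have m0 : measurable_fun setT (teval ([::] : tr)) by exact: measurable_teval.
  apply: (le_trans (@Lpint_bounded _ _ _ P 2 _ 0 m0 _)).
    by move=> x; rewrite /teval big_nil modC0.
  by rewrite expr0n.
rewrite big_cons EFinD -IH // addeC.
pose c := fourier_coef f z; pose q : tr := [:: (c, z)].
have <- : Lpint P 2 (teval q) = (modC c ^+ 2)%:E.
  rewrite -[RHS](Eint_cst P); apply: eq_integral => x _.
  by rewrite /teval big_seq1 modCM torus_char_norm mulr1.
have -> : teval (tproj (z :: S) f) = (fun x => teval (tproj S f) x + teval q x).
  by apply/funext => x; rewrite addrC -teval_cat.
apply: (@pythagoras _ _ (tnorm q)).
- exact: inL2_teval.
- exact: measurable_teval.
- exact: teval_bound.
apply: orthogonal_teval; first exact: inL1_teval.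
move=> w; rewrite inE => /eqP ->; rewrite fourier_teval big_map big1_seq // => w' /andP[_ wS].
rewrite EmB_neq ?mulr0 //; apply: contraNneq zS => /= <- //.
Qed.

Lemma Hm_norm j z : modC (Hm R j z) <= 1.
Proof.
rewrite /Hm /Hsgn modCM modCN modCi mul1r.
have -> : (Num.sg (z j))%:~R = ((Num.sg (z j))%:~R : R)%:C%C :> R[i] by rewrite rmorph_int.
by rewrite modC_real; case: sgrP => _; rewrite /= ?mulr0z ?mulr1z ?mulrN1z ?normrN ?normr0 ?normr1.
Qed.

Lemma conjugate_L2_coef j u v z : conjugate_L2 j u v ->
  fourier_coef v z = Hm R j z * fourier_coef u z.
Proof. by move=> [_ _ ->]; rewrite /Hm /Hsgn. Qed.

(** By density of trigonometric polynomials v is carried up to e by finitely many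
    frequencies, where the Fourier coefficients of v are dominated by those of u. *)
Lemma conjugate_L2_contraction j u v : conjugate_L2 j u v ->
  (Lpint P 2 v <= Lpint P 2 u)%E.
Proof.
move=> uv; have [u2 v2 _] := uv; have [mv v2'] := v2.
apply/lee_addgt0Pr => e e0.
have [r [hr _]] := tcomb_approx (isT : (0 < 2 <= 2)%N) mv v2' e0.
pose S := undup [seq t.2 | t <- tcomb r].
have uS : uniq S by exact: undup_uniq.
have sS : {subset [seq t.2 | t <- tcomb r] <= S} by move=> z; rewrite mem_undup.
rewrite (bessel v2 uS) addeC; apply: leeD; last first.
  exact: le_trans (best_approximation v2 uS sS) hr.
rewrite (bessel u2 uS) Lpint_tproj // Lpint_tproj //.
apply: (@le_trans _ _ (\sum_(z <- S) modC (fourier_coef u z) ^+ 2)%:E); last first.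
  by rewrite leeDr // Lpint_ge0.
rewrite lee_fin; apply: ler_sum => z _; rewrite (conjugate_L2_coef z uv) modCM.
rewrite lerXn2r ?nnegrE ?mulr_ge0 ?modC_ge0 //.
by rewrite ler_piMl ?modC_ge0 // Hm_norm.
Qed.

Lemma conjugate_L2_teval j (p : tr) : conjugate_L2 j (teval p) (teval (tmult (Hm R j) p)).
Proof.
split; [exact: inL2_teval|exact: inL2_teval|move=> z].
rewrite !fourier_teval big_map mulr_sumr; apply: eq_bigr => t _ /=.
have [->|tz] := eqVneq t.2 z; first by rewrite /Hm /Hsgn; ring.
by rewrite EmB_neq // !mulr0.
Qed.

Lemma conjugate_L2B j u v u' v' : conjugate_L2 j u v -> conjugate_L2 j u' v' ->
  conjugate_L2 j (fun x => u x - u' x) (fun x => v x - v' x).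
Proof.
move=> [u2 v2 uv] [u2' v2' uv']; split; try exact: inL2B.
by move=> z; rewrite !fourier_coefB ?uv ?uv' ?mulrBr //; exact: inL2_inL1.
Qed.

Lemma Hm_tsq j (r : tr) x : modC (teval (tmult (Hm R j) (tsq r)) x) =
  `|ReC (teval (tmult (Hm R j) (tprod r (tconj r))) x)|.
Proof. by rewrite teval_mult_sym ?modC_real // => z; exact: HmN. Qed.

Lemma ReC_tprodJ_ge0 (r : tr) x : 0 <= ReC (teval (tprod r (tconj r)) x).
Proof. by rewrite teval_prod teval_conj mulCJ /= exprn_ge0 // modC_ge0. Qed.

Lemma tmean_tsq (r : tr) : (ReC (tmean (tprod r (tconj r))))%:E = L1norm P (teval (tsq r)).
Proof.
rewrite -torus_integral_teval -Eint_Re; last exact: inL1_teval.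
apply: eq_integral => x _; rewrite teval_sq modC_real teval_prod teval_conj mulCJ /=.
by rewrite ger0_norm // exprn_ge0 // modC_ge0.
Qed.

Lemma tsq_L1norm_le k (r : tr) f (e : R) : measurable_fun setT f ->
  (Lpint P 1 (fun x => (qpart k f x)%:C%C - teval (tsq r) x)%R <= e%:E)%E ->
  (L1norm P (teval (tsq r)) <= 2%:E * (L1norm P f + e%:E))%E.
Proof.
move=> mf h; have mq := cmeas_real (measurable_qpart k mf).
have mt := measurable_teval (tsq r).
have -> : teval (tsq r) = (fun x => (qpart k f x)%:C%C - ((qpart k f x)%:C%C - teval (tsq r) x)).
  by apply/funext => x; rewrite subKr.
rewrite L1normE; apply: (le_trans (LpintB P 1 mq (cmeasB mq mt))).
rewrite expr1; apply: lee_wpmul2l => //; apply: leeD => //.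
apply: Lpint_le => // x; by rewrite modC_real ger0_norm ?qpart_ge0 // qpart_le.
Qed.

Lemma conjugate_tsq_weak j (r : tr) (y : R) : 0 < y ->
  (P [set x | (y <= modC (teval (tmult (Hm R j) (tsq r)) x))%R] <=
   (2 / y)%:E * L1norm P (teval (tsq r)))%E.
Proof.
move=> y0; rewrite -tmean_tsq -EFinM.
have -> : 2 / y * ReC (tmean (tprod r (tconj r))) =
  2 * ReC (tmean (tprod r (tconj r))) / y by ring.
apply: le_trans (conjugate_weak_type j y0 (ReC_tprodJ_ge0 r)).
by under eq_set do rewrite Hm_tsq.
Qed.

End L2_theory.

(** * Limits along rapidly converging sequences *)

Section prob_bounds.
Context d (T : measurableType d) (R : realType) (P : probability T R).

Lemma prob_unionI n (B : 'I_n -> set T) (b : \bar R) : (0 <= b)%E ->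
  (forall k, measurable (B k)) -> (forall k, P (B k) <= b)%E ->
  (measurable [set x | exists k, B k x] /\ P [set x | exists k, B k x] <= n%:R%:E * b)%E.
Proof.
move=> b0; elim: n B => [|n IH] B mB Bb.
  have -> : [set x | exists k : 'I_0, B k x] = set0.
    by apply/seteqP; split => // x [[]].
  by rewrite measure0 mul0e; split.
have [mU Ub] := IH (fun k => B (widen_ord (leqnSn n) k)) (fun k => mB _) (fun k => Bb _).
have -> : [set x | exists k : 'I_n.+1, B k x] =
    [set x | exists k : 'I_n, B (widen_ord (leqnSn n) k) x] `|` B ord_max.
  apply/seteqP; split => x /=.
    move=> [k Bk]; have [kn|nk] := ltnP k n.
      by left; exists (Ordinal kn); rewrite (_ : widen_ord _ _ = k) //; exact: val_inj.
    right; rewrite (_ : ord_max = k) //; apply: val_inj => /=; apply/eqP.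
    by rewrite eqn_leq nk /= -ltnS ltn_ord.
  by case=> [[k Bk]|Bn]; [exists (widen_ord (leqnSn n) k)|exists ord_max].
split; first exact: measurableU.
apply: (le_trans (measureU2 P mU (mB _))).
rewrite -natr1 EFinD ge0_muleDl ?mul1e ?lee_fin //.
by apply: leeD; [exact: Ub|exact: Bb].
Qed.

End prob_bounds.

Section fatou_bound.
Context d (T : measurableType d) (R : realType) (P : probability T R).

Lemma limn_einf_ge (u : nat -> \bar R) (t : \bar R) :
  (\forall m \near \oo, (t <= u m)%E) -> (t <= limn_einf u)%E.
Proof.
move=> [n _ tu]; rewrite limn_einf_lim.
apply: (@le_trans _ _ (einfs u n)).
  apply: le_ereal_inf_tmp => _ [m /= nm <-]; exact: tu.
apply: lime_ge; first exact: is_cvg_einfs.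
by exists n => // m /= nm; apply: nondecreasing_einfs.
Qed.

Lemma limn_einf_le (u : nat -> \bar R) (t : \bar R) :
  (\forall m \near \oo, (u m <= t)%E) -> (limn_einf u <= t)%E.
Proof.
move=> [n _ ut]; rewrite limn_einf_lim; apply: lime_le; first exact: is_cvg_einfs.
exists n => // m /= nm; apply: (@le_trans _ _ (u m)); last exact: ut.
by apply: ereal_inf_lbound; exists m => /=.
Qed.

(** Fatou's lemma for a function lying almost everywhere below the lower limit
    of a sequence with bounded integrals. *)
Lemma fatou_bound (h : nat -> T -> R) (H : T -> R) (Z : set T) (b : \bar R) :
  (forall m, measurable_fun setT (h m)) -> measurable_fun setT H ->
  (forall m x, 0 <= h m x) -> (forall x, 0 <= H x) ->
  measurable Z -> P Z = 0%E ->
  (forall x, ~ Z x -> forall t, t < H x -> \forall m \near \oo, t <= h m x) ->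
  (\forall m \near \oo, (\int[P]_x (h m x)%:E <= b)%E) ->
  (\int[P]_x (H x)%:E <= b)%E.
Proof.
move=> mh mH h0 H0 mZ PZ hH hb.
have mh' m : measurable_fun setT (fun x => (h m x)%:E) by exact/measurable_EFinP.
apply: (@le_trans _ _ (\int[P]_x limn_einf (fun m => (h m x)%:E))%E); last first.
  apply: (le_trans (fatou P measurableT mh' _)); first by move=> m x _; rewrite lee_fin.
  exact: limn_einf_le.
have mL : measurable_fun setT (fun x => limn_einf (fun m => (h m x)%:E)).
  apply: measurableT_comp => //; apply: measurable_fun_limn_esup => m.
  exact: measurableT_comp.
have L0 x : (0 <= limn_einf (fun m => (h m x)%:E))%E.
  by apply: limn_einf_ge; apply: nearW => m; rewrite lee_fin.
apply: ae_ge0_le_integral => //.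
- by move=> x _; rewrite lee_fin.
- exact/measurable_EFinP.
exists Z; split => // x /= /not_implyP[_ nH]; apply: contrapT => nZ; apply: nH.
apply/lee_subgt0Pr => e e0; rewrite -EFinB; apply: limn_einf_ge.
have := hH x nZ (H x - e); rewrite gtrBl => /(_ e0).
by apply: filterS => m; rewrite lee_fin.
Qed.

End fatou_bound.

Section rapid_limit.
Context d (T : measurableType d) (R : realType) (P : probability T R).
Variable g : nat -> T -> R[i].
Hypothesis mg : forall k, measurable_fun setT (g k).

(** The pointwise limit of g wherever it exists; the value elsewhere is chosen so
    as to depend measurably on the sequence. *)
Definition climit (x : T) : R[i] :=
  (fine (limn_esup (fun k => (ReC (g k x))%:E)) +i*
   fine (limn_esup (fun k => (ImC (g k x))%:E)))%C.

Lemma climit_eq x y : (forall k, g k x = g k y) -> climit x = climit y.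
Proof.
move=> xy; rewrite /climit.
have -> : (fun k => (ReC (g k x))%:E) = (fun k => (ReC (g k y))%:E).
  by apply/funext => k; rewrite xy.
suff -> : (fun k => (ImC (g k x))%:E) = (fun k => (ImC (g k y))%:E) by [].
by apply/funext => k; rewrite xy.
Qed.

Lemma measurable_climit : measurable_fun setT climit.
Proof.
apply/cmeasP; split => /=; apply: (measurableT_comp (f := fine)) => //.
- apply: measurable_fun_limn_esup => k; apply/measurable_EFinP.
  by have [] := (cmeasP _).1 (mg k).
- apply: measurable_fun_limn_esup => k; apply/measurable_EFinP.
  by have [] := (cmeasP _).1 (mg k).
Qed.

Lemma cvg_rapid_real (a : nat -> R) n :
  (forall k, (n <= k)%N -> `|a k.+1 - a k| <= 2^-1 ^+ k) ->
  a @ \oo --> fine (limn_esup (fun k => (a k)%:E)).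
Proof.
move=> an.
pose b k := a (k + n)%N.
have cb : cvgn (series (telescope b)).
  apply: normed_cvg; apply: (@series_le_cvg _ _ (geometric 1 2^-1)).
  - by move=> k; rewrite normr_ge0.
  - by move=> k; rewrite /geometric /= mul1r exprn_ge0.
  - move=> k; rewrite /telescope /b /geometric /= mul1r addSn.
    apply: (le_trans (an _ (leq_addl _ _))).
    rewrite exprD ler_piMr ?exprn_ge0 // exprn_ile1 // invf_le1 // ler1n //.
  - apply: is_cvg_geometric_series; rewrite ger0_norm //; lra.
have {cb} cb : b @ \oo --> (b 0%N + limn (series (telescope b))).
  have cb' : (fun k => b 0%N + series (telescope b) k) @ \oo -->
      (b 0%N + limn (series (telescope b))).
    by apply: cvgD; [exact: cvg_cst|exact: cb].
  rewrite [X in X @ _](_ : b = (fun k => b 0%N + series (telescope b) k)) //.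
  by apply/funext => k; exact: eq_sum_telescope.
have ca : a @ \oo --> (b 0%N + limn (series (telescope b))).
  by rewrite -(cvg_shiftn n).
have ce : (fun k => (a k)%:E) @ \oo --> (b 0%N + limn (series (telescope b)))%:E.
  by apply/fine_cvgP; split; [exact: nearW|exact: ca].
by rewrite (cvg_limn_einf_sup ce).2.
Qed.

Lemma climit_cvg x n : (forall k, (n <= k)%N -> modC (g k.+1 x - g k x) < 2^-1 ^+ k) ->
  (fun k => modC (g k x - climit x)) @ \oo --> 0.
Proof.
move=> gn.
have cr : (fun k => ReC (g k x)) @ \oo --> ReC (climit x).
  apply: (@cvg_rapid_real _ n) => k /gn /ltW; apply: le_trans.
  by rewrite -ReCN -ReCD; exact: modC_ge_Re.
have ci : (fun k => ImC (g k x)) @ \oo --> ImC (climit x).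
  apply: (@cvg_rapid_real _ n) => k /gn /ltW; apply: le_trans.
  by rewrite -ImCN -ImCD; exact: modC_ge_Im.
have cc : (fun k => `|ReC (g k x) - ReC (climit x)| + `|ImC (g k x) - ImC (climit x)|)
    @ \oo --> 0.
  rewrite -[X in _ --> X](addr0 0) -[in X in X + _](normr0 R) -[in X in _ + X](normr0 R).
  rewrite -{1}(subrr (ReC (climit x))) -(subrr (ImC (climit x))).
  by apply: cvgD; apply: cvg_norm; apply: cvgB => //; exact: cvg_cst.
apply: (@squeeze_cvgr _ _ _ _ (cst 0) _ _ _ _ (cvg_cst 0) cc).
apply: nearW => k; rewrite modC_ge0 /=; apply: (le_trans (modC_le _)).
by rewrite !ReImE.
Qed.

Variable c : R.
Hypothesis gc : forall k,
  (P [set x | (2^-1 ^+ k <= modC (g k.+1 x - g k x))%R] <= (c * 2^-1 ^+ k)%:E)%E.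

(** The bounds [gc] are summable, so by Borel-Cantelli almost every point satisfies
    the hypothesis of [climit_cvg]. *)
Lemma climit_ae : exists Z, [/\ measurable Z, P Z = 0%E &
  forall x, ~ Z x -> (fun k => modC (g k x - climit x)) @ \oo --> 0].
Proof.
pose F k := [set x | 2^-1 ^+ k <= modC (g k.+1 x - g k x)].
have mF k : measurable (F k).
  by apply: measurable_ge_set; apply: measurable_modC; exact: cmeasB.
exists (lim_sup_set F); split.
- by apply: bigcap_measurable => // n _; exact: bigcup_measurable.
- apply: lim_sup_set_cvg0 => //.
  apply: (@le_lt_trans _ _ (\sum_(0 <= k <oo) (c * 2^-1 ^+ k)%:E)%E).
    by apply: lee_nneseries => // k _; exact: gc.
  have c0 : 0 <= c.
    by have := le_trans (measure_ge0 _ _) (gc 0); rewrite lee_fin expr0 mulr1.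
  have S n : (\sum_(0 <= k < n) (c * 2^-1 ^+ k)%:E = (2 * c * (1 - 2^-1 ^+ n))%:E)%E.
    elim: n => [|n IH]; first by rewrite big_geq // expr0 subrr mulr0.
    rewrite big_nat_recr //= IH -EFinD exprS; congr (_%:E); by field.
  apply: (@le_lt_trans _ _ (2 * c)%:E); last exact: ltry.
  apply: lime_le; first by apply: is_cvg_nneseries => k _ _; rewrite lee_fin mulr_ge0.
  apply: nearW => n; rewrite S lee_fin ler_piMr ?mulr_ge0 //.
move=> x nZ; have [n nF] : exists n, forall k, (n <= k)%N -> ~ F k x.
  apply: contrapT => h; apply: nZ => n _; apply: contrapT => h'; apply: h; exists n.
  by move=> k nk Fk; apply: h'; exists k.
by apply: (@climit_cvg x n) => k nk; rewrite ltNge; apply/negP; exact: nF.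
Qed.

Lemma climit_weak k (y : R) (b : \bar R) :
  (\forall m \near \oo, (P [set x | (y < modC (g m x - g k x))%R] <= b)%E) ->
  (P [set x | (y < modC (climit x - g k x))%R] <= b)%E.
Proof.
move=> hb; have [Z [mZ PZ cZ]] := climit_ae.
have mc := measurable_climit.
have mS (f : T -> R[i]) : measurable_fun setT f ->
    measurable [set x | (y < modC (f x - g k x))%R].
  by move=> mf; apply: measurable_gt_set; apply: measurable_modC; exact: cmeasB.
rewrite -[X in P X]setIT -integral_indic //; last exact: mS.
apply: (@fatou_bound _ _ _ P (fun m => \1_[set x | (y < modC (g m x - g k x))%R]) _ Z) => //.
- by move=> m; apply: measurable_indic; exact: mS.
- by apply: measurable_indic; exact: mS.
- move=> x nZ t; rewrite indicE; have [/set_mem /= yx t1|_ t0] := boolP (x \in _).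
    have d0 : 0 < modC (climit x - g k x) - y by rewrite subr_gt0.
    have /cvgr0Pnorm_lt /(_ _ d0) := cZ x nZ.
    apply: filterS => m; rewrite ger0_norm ?modC_ge0 // => hm.
    rewrite indicE mem_set ?ltW //=; rewrite ltrBrDl in hm.
    have := modCD (climit x - g m x) (g m x - g k x).
    rewrite addrA subrK modCBC => h'.
    by have := lt_le_trans hm h'; rewrite [X in X < _]addrC ltrD2l.
  by apply: nearW => m; rewrite (le_trans (ltW t0)).
- by apply: filterS hb => m; rewrite integral_indic ?setIT //; exact: mS.
Qed.

Lemma climit_L1 k (b : \bar R) :
  (\forall m \near \oo, (L1norm P (fun x => g m x - g k x)%R <= b)%E) ->
  (L1norm P (fun x => climit x - g k x)%R <= b)%E.
Proof.
move=> hb; have [Z [mZ PZ cZ]] := climit_ae.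
apply: (@fatou_bound _ _ _ P (fun m x => modC (g m x - g k x)) _ Z) => //.
- by move=> m; apply: measurable_modC; exact: cmeasB.
- by apply: measurable_modC; apply: cmeasB => //; exact: measurable_climit.
- by move=> m x; exact: modC_ge0.
- by move=> x; exact: modC_ge0.
move=> x nZ t tx.
have d0 : 0 < modC (climit x - g k x) - t by rewrite subr_gt0.
have /cvgr0Pnorm_lt /(_ _ d0) := cZ x nZ.
apply: filterS => m; rewrite ger0_norm ?modC_ge0 // => hm.
rewrite ltrBrDl in hm.
have := modCD (climit x - g m x) (g m x - g k x).
rewrite addrA subrK modCBC => h'; apply: ltW.
by have := lt_le_trans hm h'; rewrite [X in X < _]addrC ltrD2l.
Qed.

End rapid_limit.

(** * Weak type of the conjugation on L2 *)

Section conjugate_weak_type_L2.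
Variables (R : realType) (N : nat).
Local Notation P := (torus_prob R N).
Local Notation tr := (trig R N).
Implicit Types (f g u v : torus R N -> R[i]).

(** Choice of the two parameters of [conjugate_L2_weak]: e0 is the L2 error and t
    the parameter eta with which [Lpint1_le2] turns it into an L1 error. *)
Lemma weak_slack (y e B : R) : 0 < y -> 0 < e -> 0 <= B ->
  exists t e0 : R, [/\ 0 < t, 0 < e0 &
    (4 / y ^+ 2) * e0 + 4 * (16 / y * (2 * (B + (t + t^-1 * e0)))) <= 128 / y * B + e].
Proof.
move=> y0 e1 B0; pose t := y * e / 8 / 8 / 8; pose e0 := Num.min (t ^+ 2) (y ^+ 2 * e / 8).
have t0 : 0 < t by rewrite /t !divr_gt0 // mulr_gt0.
have y2 : 0 < y ^+ 2 by rewrite exprn_gt0.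
have e00 : 0 < e0 by rewrite lt_min exprn_gt0 //= divr_gt0 ?mulr_gt0.
exists t, e0; split => //.
have h1 : t^-1 * e0 <= t.
  by rewrite -(ler_pM2l t0) mulrA mulfV ?lt0r_neq0 // mul1r -expr2 ge_min lexx.
have h2 : 4 / y ^+ 2 * e0 <= e / 2.
  apply: (@le_trans _ _ (4 / y ^+ 2 * (y ^+ 2 * e / 8))).
    apply: ler_wpM2l; first by apply: divr_ge0 => //; exact: ltW.
    by rewrite ge_min lexx orbT.
  by rewrite le_eqVlt; apply/orP; left; apply/eqP; field; exact: lt0r_neq0.
have h3 : 4 * (16 / y * (2 * (B + (t + t^-1 * e0)))) <= 128 / y * B + e / 2.
  apply: (@le_trans _ _ (4 * (16 / y * (2 * (B + (t + t)))))).
    rewrite ler_pM2l // ler_pM2l ?divr_gt0 // ler_pM2l //.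
    by rewrite !lerD2l.
  by rewrite le_eqVlt; apply/orP; left; apply/eqP; rewrite /t; field; exact: lt0r_neq0.
by apply: (le_trans (lerD h2 h3)); rewrite le_eqVlt; apply/orP; left; apply/eqP; field; exact: lt0r_neq0.
Qed.

(** Up to a small L2 error u is a combination of four nonnegative trigonometric
    polynomials, to which [conjugate_tsq_weak] applies; the error is handled by the
    L2 contraction. The levels y / 2 for the error and y / 8 for each of the four
    pieces add up to y. *)
Lemma conjugate_L2_weak j u v (y : R) : conjugate_L2 j u v -> 0 < y ->
  (P [set x | (y <= modC (v x))%R] <= (128 / y)%:E * L1norm P u)%E.
Proof.
move=> uv y0; have [u2 v2 _] := uv; have [mu u2'] := u2; have [mv _] := v2.
have [_ u1] := inL2_inL1 u2.
have n0 : (0 <= L1norm P u)%E by exact: (Lpint_ge0 P 1).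
have nE : L1norm P u = (fine (L1norm P u))%:E by rewrite fineK // ge0_fin_numE.
have B0 : 0 <= fine (L1norm P u) by exact: fine_ge0.
apply/lee_addgt0Pr => e e1.
have [t [e0 [t0 e00 slack]]] := weak_slack y0 e1 B0.
have [r [hr hk]] := tcomb_approx (isT : (0 < 2 <= 2)%N) mu u2' e00.
pose Hc := teval (tmult (Hm R j) (tcomb r)).
pose Hk k := teval (tmult (Hm R j) (tsq (r k))).
have mE : measurable_fun setT (fun x => v x - Hc x).
  by apply: cmeasB => //; exact: measurable_teval.
pose A := [set x | y / 2 <= modC (v x - Hc x)].
pose Bk k := [set x | y / 8 <= modC (Hk k x)].
have mA : measurable A by apply: measurable_ge_set; exact: measurable_modC.
have mB k : measurable (Bk k).
  by apply: measurable_ge_set; apply: measurable_modC; exact: measurable_teval.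
have PA : (P A <= (4 / y ^+ 2 * e0)%:E)%E.
  have yh : 0 < y / 2 by rewrite divr_gt0.
  have y20 : 0 < (y / 2) ^+ 2 by rewrite exprn_gt0.
  have pair := conjugate_L2B uv (conjugate_L2_teval j (tcomb r)).
  have := le_trans (Lpint_chebyshev P (isT : (0 < 2)%N) mE (ltW yh))
    (le_trans (conjugate_L2_contraction pair) hr).
  rewrite -/A => h.
  have -> : 4 / y ^+ 2 * e0 = ((y / 2) ^+ 2)^-1 * e0 by field; exact: lt0r_neq0.
  by rewrite EFinM lee_pdivlMl.
have PB k : (P (Bk k) <= (16 / y * (2 * (fine (L1norm P u) + (t + t^-1 * e0))))%:E)%E.
  have y8 : 0 < y / 8 by rewrite divr_gt0.
  apply: (le_trans (conjugate_tsq_weak j (r k) y8)).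
  have -> : 2 / (y / 8) = 16 / y by field; exact: lt0r_neq0.
  rewrite [X in (_ <= X)%E]EFinM; apply: lee_wpmul2l.
    by rewrite lee_fin divr_ge0 // ltW.
  have -> : (2 * (fine (L1norm P u) + (t + t^-1 * e0)))%:E =
      (2%:E * (L1norm P u + (t + t^-1 * e0)%:E))%E.
    by rewrite [in RHS]nE.
  apply: (@tsq_L1norm_le _ _ k) => //.
  apply: (le_trans (Lpint1_le2 P t0 _)).
    by apply: cmeasB; [apply: cmeas_real; exact: measurable_qpart|exact: measurable_teval].
  by rewrite EFinD EFinM; apply: leeD => //; apply: lee_wpmul2l => //;
     rewrite lee_fin invr_ge0 ltW.
have [mU PU] := @prob_unionI _ _ _ P 4 Bk _ (le_trans (measure_ge0 _ _) (PB ord0)) mB PB.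
apply: (@le_trans _ _ (P (A `|` [set x | exists k, Bk k x]))).
  apply: le_measure; rewrite ?inE.
  - by apply: measurable_ge_set; exact: measurable_modC.
  - exact: measurableU.
  move=> x /= yv; apply: contrapT => /not_orP[/negP nA nB].
  move: yv; apply/negP; rewrite -ltNge.
  rewrite -ltNge in nA.
  have vE : v x = (v x - Hc x) + \sum_(k < 4) 'i%C ^+ k * Hk k x.
    by rewrite -teval_mult_comb subrK.
  rewrite vE; apply: (le_lt_trans (modCD _ _)).
  have -> : y = y / 2 + y / 8 *+ 4 by field.
  apply: ltr_leD => //; apply: (le_trans (modC_sum _ _ _)).
  rewrite -[X in _ <= _ *+ X](card_ord 4) -sumr_const; apply: ler_sum => k _.
  rewrite modCM modCX modCi expr1n mul1r leNgt; apply/negP => h.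
  by apply: nB; exists k; exact: ltW.
apply: (le_trans (measureU2 P mA mU)).
apply: (le_trans (leeD PA PU)).
by rewrite -EFinM -EFinD nE -EFinM -EFinD lee_fin.
Qed.

End conjugate_weak_type_L2.

(** * Conditional expectations *)

Section coordinate_algebra.
Variables (R : realType) (N : nat).
Local Notation P := (torus_prob R N).
Local Notation tr := (trig R N).
Implicit Types (f g : torus R N -> R[i]) (D : set (torus R N)).

Definition truncate n (x : torus R N) : torus R N :=
  [tuple if (i < n)%N then tnth x i else circle1 R | i < N].

Lemma tnth_truncate n x (i : 'I_N) :
  tnth (truncate n x) i = if (i < n)%N then tnth x i else circle1 R.
Proof. exact: tnth_mktuple. Qed.

Lemma eq_truncate n (x y : torus R N) :
  (forall i : 'I_N, (i < n)%N -> tnth x i = tnth y i) -> truncate n x = truncate n y.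
Proof.
move=> xy; apply: eq_from_tnth => i; rewrite !tnth_truncate.
by case: ifP => // /xy.
Qed.

(** An explicit description of the n-th coordinate sigma-algebra, in which
    membership can be checked directly; see [coord_salgebraP]. *)
Definition lowset n D := measurable D /\ forall x, D x <-> D (truncate n x).

Lemma coord_salgebraP n D : coord_salgebra n D <-> lowset n D.
Proof.
split.
- move: D; apply: smallest_sub.
    split.
    + by split.
    + move=> D [mD hD]; rewrite setTD; split; first exact: measurableC.
      by move=> x; split => nD /(hD x).
    + move=> F hF; split; first by apply: bigcup_measurable => k _; exact: (hF k).1.
      by move=> x; split => -[k _ Fk]; exists k => //; apply/((hF k).2 x).
  move=> D [i /= iin [B mB <-]]; rewrite setTI; split.
    by rewrite -[X in measurable X]setTI; exact: measurable_tnth.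
  by move=> x; rewrite /= tnth_truncate iin.
move=> [mD hD].
pose G := \bigcup_(i in [set i : 'I_N | (i < n)%N])
  preimage_set_system setT (fun x : torus R N => tnth x i) measurable.
pose T' : measurableType _ := g_sigma_algebraType G.
have mt : measurable_fun (setT : set T') (truncate n : T' -> torus R N).
  apply/measurable_fun_tnthP => i; have [iin|nin] := boolP (i < n)%N.
    move=> _ B mB; apply: sub_sigma_algebra; exists i => //.
    exists B => //; apply/seteqP; split => x /=; by rewrite tnth_truncate iin.
  have -> : (tnth (T := circle R) ^~ i \o (truncate n : T' -> torus R N)) =
      (fun=> circle1 R) by apply/funext => x /=; rewrite tnth_truncate (negbTE nin).
  exact: measurable_cst.
have -> : D = setT `&` truncate n @^-1` D.
  by rewrite setTI; apply/seteqP; split => x; [move/(hD x)|move=> h; apply/(hD x)].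
exact: (mt measurableT D mD).
Qed.

Lemma measurable_set1C (w : R[i]) : measurable [set w].
Proof.
exists ([set ReC w] `*` [set ImC w]); first exact: measurableX.
apply/seteqP; split => z /=.
  by rewrite /complex_pair => -[_ [/= h1 h2]]; exact: eq_ReIm.
by move=> ->.
Qed.

Lemma low_measurableP n g :
  (forall B, measurable B -> coord_salgebra n (g @^-1` B)) <->
  measurable_fun setT g /\ forall x, g (truncate n x) = g x.
Proof.
split=> [hg|[mg tg] B mB].
  split; first by move=> _ B mB; rewrite setTI; exact: ((coord_salgebraP _ _).1 (hg B mB)).1.
  move=> x; have [_ h] := (coord_salgebraP _ _).1 (hg _ (measurable_set1C (g x))).
  exact: (h x).1.
apply/coord_salgebraP; split; first by rewrite -[X in measurable X]setTI; exact: mg.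
by move=> x; rewrite /= tg.
Qed.

Lemma is_condexpP n f g : is_condexp P (coord_salgebra n) f g <->
  [/\ inL1 P g, forall x, g (truncate n x) = g x &
    forall D, lowset n D -> Cintegral P D g = Cintegral P D f].
Proof.
split=> [[/low_measurableP[mg tg] g1 gD]|[g1 tg gD]].
  by split => // D /coord_salgebraP; exact: gD.
split => //; first by apply/low_measurableP; split => //; case: g1.
by move=> D /coord_salgebraP; exact: gD.
Qed.

Lemma is_condexpB n f f' g g' : inL1 P f -> inL1 P f' ->
  is_condexp P (coord_salgebra n) f g -> is_condexp P (coord_salgebra n) f' g' ->
  is_condexp P (coord_salgebra n) (fun x => f x - f' x) (fun x => g x - g' x).
Proof.
move=> f1 f1' /is_condexpP[g1 tg gD] /is_condexpP[g1' tg' gD']; apply/is_condexpP; split.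
- exact: inL1B.
- by move=> x; rewrite tg tg'.
- by move=> D lD; have [mD _] := lD; rewrite !CintegralB // gD // gD'.
Qed.

Lemma Cintegral_indic D f : measurable D ->
  Cintegral P D f = Cintegral P setT (fun x => (\1_D x)%:C%C * f x)%R.
Proof.
move=> mD; rewrite /Cintegral; congr (_ +i* _)%C; rewrite Rintegral_mkcond;
  apply: eq_Rintegral => x _; rewrite patchE indicE;
  by case: (x \in D); rewrite !ReImE /= ?mul1r ?mul0r ?subr0 ?addr0 ?add0r.
Qed.

Lemma torus_char_truncate n (z : 'I_N -> int) x : zero_from n z ->
  torus_char z (truncate n x) = torus_char z x.
Proof.
move=> /forallP z0; apply: eq_bigr => i _; rewrite tnth_truncate.
have [//|ni] := ltnP i n.
by have := z0 i; rewrite ni => /eqP ->; rewrite !expr0z.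
Qed.

(** Frequencies that live on the first n coordinates are kept; the other
    characters integrate to 0 over every set of the n-th coordinate
    sigma-algebra, by [torus_integral_low]. *)
Lemma is_condexp_teval n (p : tr) :
  is_condexp P (coord_salgebra n) (teval p) (teval (tmult (Em R n) p)).
Proof.
apply/is_condexpP; split.
- exact: inL1_teval.
- move=> x; rewrite !teval_mult; apply: eq_bigr => t _; rewrite /Em.
  by case: (boolP (zero_from n t.2)) => [/torus_char_truncate -> //|_]; rewrite !mul0r.
move=> D [mD hD].
have i1 m (t : R[i] * ('I_N -> int)) : inL1 P (fun x => m t.2 * (t.1 * torus_char t.2 x)).
  by apply: inL1Z; apply: inL1Z; exact: inL1_torus_char.
transitivity (Cintegral P D (teval (tmult (fun=> 1) p))); last first.
  by apply: eq_Cintegral => x _; exact: teval_mult1.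
have teE m : Cintegral P D (teval (tmult m p)) =
    \sum_(t <- p) m t.2 * (t.1 * Cintegral P D (fun x => torus_char t.2 x)).
  transitivity (Cintegral P D (fun x => \sum_(t <- p) m t.2 * (t.1 * torus_char t.2 x))%R).
    by apply: eq_Cintegral => x _; exact: teval_mult.
  rewrite Cintegral_sum //; apply: eq_bigr => t _.
  rewrite CintegralZ // ?CintegralZ //; last by apply: inL1Z; exact: inL1_torus_char.
  exact: inL1_torus_char.
rewrite !teE; apply: eq_bigr => t _; rewrite /Em.
case: (boolP (zero_from n t.2)) => [//|nz].
rewrite [X in _ * (_ * X) = _]Cintegral_indic // [X in _ = _ * (_ * X)]Cintegral_indic //.
rewrite (@torus_integral_low _ _ n _ 1) ?mulr0 //.
- by apply: cmeas_real; exact: measurable_indic.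
- by move=> x; rewrite modC_real indicE ger0_norm // lern1 leq_b1.
- move=> x y xy; congr (_%:C)%C; rewrite !indicE; congr (nat_of_bool _)%:R.
  apply/idP/idP; rewrite !inE => /hD h; apply/hD.
    by rewrite -(eq_truncate xy).
  by rewrite (eq_truncate xy).
Qed.

(** Testing on the set where h is positive and on its complement recovers the L1
    norm of h; each test is bounded by the L1 norm of k. *)
Lemma abs_integral_le (h k : torus R N -> R) (D : set (torus R N)) :
  P.-integrable setT (EFin \o h) -> P.-integrable setT (EFin \o k) ->
  D = [set x | 0 < h x] -> measurable D ->
  \int[P]_(x in D) h x = \int[P]_(x in D) k x ->
  \int[P]_(x in ~` D) h x = \int[P]_(x in ~` D) k x ->
  (\int[P]_x `|h x|%:E <= 2%:E * \int[P]_x `|k x|%:E)%E.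
Proof.
move=> ih ik DE mD hD hC.
have inh := integrable_norm ih; have ink := integrable_norm ik.
have mC : measurable (~` D) by exact: measurableC.
have fk (a : torus R N -> R) : P.-integrable setT (EFin \o a) ->
    (\int[P]_x (a x)%:E = (\int[P]_x a x)%:E)%E.
  by move=> ia; rewrite /Rintegral fineK //; exact: integrable_fin_num.
rewrite (fk _ inh) (fk _ ink) -EFinM lee_fin.
have ihS E : measurable E -> P.-integrable E (EFin \o h).
  by move=> mE; exact: integrableS ih.
have ikS E : measurable E -> P.-integrable E (EFin \o k).
  by move=> mE; exact: integrableS ik.
have bound E : measurable E -> `|\int[P]_(x in E) k x| <= \int[P]_x `|k x|.
  move=> mE; apply: (le_trans (le_normr_Rintegral mE (ikS E mE))).
  rewrite -lee_fin -(fk _ ink) /Rintegral fineK; last first.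
    by apply: integrable_fin_num => //; exact: integrableS ink.
  apply: ge0_subset_integral => //.
  by have := measurable_int _ ink.
have -> : \int[P]_x `|h x| = \int[P]_(x in D) h x - \int[P]_(x in ~` D) h x.
  rewrite [X in X - _]Rintegral_mkcond [X in _ - X]Rintegral_mkcond -RintegralB //; last 2 first.
  - by have := (integrable_mkcond _ mD).1 (ihS D mD); rewrite restrict_EFin.
  - by have := (integrable_mkcond _ mC).1 (ihS _ mC); rewrite restrict_EFin.
  apply: eq_Rintegral => x _; rewrite !patchE in_setC.
  have pt0 : point = 0 :> R by [].
  have [/set_mem xD|/negP xD] := boolP (x \in D); rewrite /= pt0.
    by rewrite DE in xD; rewrite subr0 gtr0_norm.
  rewrite sub0r ler0_norm // leNgt; apply/negP => hx; apply: xD.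
  by rewrite DE; exact: mem_set.
rewrite hD hC mulr_natl mulr2n.
by apply: (le_trans (ler_norm _)); apply: (le_trans (ler_normB _ _)); apply: lerD; exact: bound.
Qed.

(** The real and imaginary parts are treated separately, each at the cost of the
    factor 2 of [abs_integral_le]. *)
Lemma condexp_contraction n f g : inL1 P f ->
  is_condexp P (coord_salgebra n) f g -> (L1norm P g <= 4%:E * L1norm P f)%E.
Proof.
move=> f1 /is_condexpP[g1 tg gD].
have [mf _] := f1; have [mfr mfi] := (cmeasP f).1 mf.
have [mg _] := g1; have [mgr mgi] := (cmeasP g).1 mg.
have part (pr : R[i] -> R) :
    (forall z, `|pr z| <= modC z) ->
    measurable_fun setT (fun x => pr (g x)) -> measurable_fun setT (fun x => pr (f x)) ->
    P.-integrable setT (EFin \o (fun x => pr (g x))) ->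
    P.-integrable setT (EFin \o (fun x => pr (f x))) ->
    (forall D, lowset n D -> \int[P]_(x in D) pr (g x) = \int[P]_(x in D) pr (f x)) ->
    (\int[P]_x `|pr (g x)|%:E <= 2%:E * L1norm P f)%E.
  move=> prn mpg mpf ig1 if1 hD.
  have mD : measurable [set x | 0 < pr (g x)] by exact: measurable_gt_set.
  apply: (le_trans (abs_integral_le ig1 if1 erefl mD _ _)).
  - by apply: hD; split => // x /=; rewrite tg.
  - apply: hD; split; first exact: measurableC.
    by move=> x /=; rewrite tg.
  apply: lee_wpmul2l => //; apply: Eint_le => //.
    by apply: measurableT_comp.
  exact: measurable_modC.
have hr : (\int[P]_x `|ReC (g x)|%:E <= 2%:E * L1norm P f)%E.
  apply: (part (fun z => ReC z)) => //.
  - exact: modC_ge_Re.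
  - exact: inL1_Re.
  - exact: inL1_Re.
  - by move=> D /gD /(congr1 (fun z : R[i] => ReC z)).
have hi : (\int[P]_x `|ImC (g x)|%:E <= 2%:E * L1norm P f)%E.
  apply: (part (fun z => ImC z)) => //.
  - exact: modC_ge_Im.
  - exact: inL1_Im.
  - exact: inL1_Im.
  - by move=> D /gD /(congr1 (fun z : R[i] => ImC z)).
have -> : (4%:E * L1norm P f = 2%:E * L1norm P f + 2%:E * L1norm P f)%E.
  by rewrite -ge0_muleDl // -EFinD; congr (_%:E * _)%E; ring.
apply: le_trans (leeD hr hi).
have mnr : measurable_fun setT (fun x => `|ReC (g x)|) by exact: measurableT_comp.
have mni : measurable_fun setT (fun x => `|ImC (g x)|) by exact: measurableT_comp.
rewrite -EintD //; apply: Eint_le => //.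
- exact: measurable_modC.
- exact: measurable_funD.
- by move=> x; exact: modC_ge0.
- by move=> x; exact: modC_le.
Qed.

End coordinate_algebra.

(** * Existence of the operators *)

Section existence.
Variables (R : realType) (N : nat).
Local Notation P := (torus_prob R N).
Local Notation tr := (trig R N).
Implicit Types (f g u v : torus R N -> R[i]).

Lemma L1_dense_seq f : inL1 P f -> exists p : nat -> tr,
  forall k, (L1norm P (fun x => f x - teval (p k) x)%R <= (4^-1 ^+ k)%:E)%E.
Proof.
move=> [mf f1].
have : forall k, exists p : tr, (L1norm P (fun x => f x - teval p x)%R <= (4^-1 ^+ k)%:E)%E.
  move=> k; have k0 : 0 < 4^-1 ^+ k :> R by rewrite exprn_gt0 // invr_gt0.
  have [r [hr _]] := tcomb_approx (isT : (0 < 1 <= 2)%N) mf f1 k0.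
  by exists (tcomb r).
by move=> /choice [p hp]; exists p.
Qed.

Lemma quarter_le (m k : nat) : (k <= m)%N -> 4^-1 ^+ m <= 4^-1 ^+ k :> R.
Proof.
by move=> km; rewrite ler_wiXn2l // ?invr_ge0 // invf_le1 // ler1n.
Qed.

Lemma dense_seq_diff f (p : nat -> tr) : measurable_fun setT f ->
  (forall k, (L1norm P (fun x => f x - teval (p k) x)%R <= (4^-1 ^+ k)%:E)%E) ->
  forall m k, (k <= m)%N ->
  (L1norm P (fun x => teval (p m) x - teval (p k) x)%R <= (4 * 4^-1 ^+ k)%:E)%E.
Proof.
move=> mf fp m k km.
have md n : measurable_fun setT (fun x => f x - teval (p n) x).
  by apply: cmeasB => //; exact: measurable_teval.
have -> : (fun x => teval (p m) x - teval (p k) x) =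
    (fun x => (f x - teval (p k) x) - (f x - teval (p m) x)).
  by apply/funext => x; ring.
apply: (le_trans (LpintB P 1 (md k) (md m))).
apply: (@le_trans _ _ (2%:E * ((4^-1 ^+ k)%:E + (4^-1 ^+ k)%:E))%E).
  rewrite expr1; apply: lee_wpmul2l => //; apply: leeD; first exact: fp.
  by apply: (le_trans (fp m)); rewrite lee_fin quarter_le.
by rewrite -EFinD -EFinM lee_fin le_eqVlt; apply/orP; left; apply/eqP; ring.
Qed.

(** Chebyshev-type tail 2 ^ -k for differences of weak norm C 4 ^ -k. *)
Lemma rapid_tail (C : R) (k : nat) : 0 <= C ->
  C / (2^-1 ^+ k) * (4 * 4^-1 ^+ k) = 4 * C * 2^-1 ^+ k.
Proof.
move=> C0; have -> : 4^-1 ^+ k = 2^-1 ^+ k * 2^-1 ^+ k :> R.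
  by rewrite -exprMn -invfM -natrM.
by field; rewrite expf_neq0 // invr_eq0 pnatr_eq0.
Qed.

Lemma condexp_seq n (p q : tr) :
  (L1norm P (fun x => teval (tmult (Em R n) p) x - teval (tmult (Em R n) q) x)%R <=
   4%:E * L1norm P (fun x => teval p x - teval q x)%R)%E.
Proof.
apply: (@condexp_contraction _ _ n).
  by apply: inL1B; exact: inL1_teval.
by apply: is_condexpB; try exact: inL1_teval; exact: is_condexp_teval.
Qed.

Lemma quarter_small (x C : R) : (forall k, x <= C * 4^-1 ^+ k) -> x <= 0.
Proof.
move=> h; have cv : (C * 4^-1 ^+ k) @[k --> \oo] --> C * (0 : R).
  apply: cvgM; first exact: cvg_cst.
  by apply: cvg_expr; rewrite ger0_norm ?invr_ge0 // invf_lt1 // ltr1n.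
rewrite mulr0 in cv; apply: (ler_cvg_to (cvg_cst x) cv); exact: nearW.
Qed.

(** Conditional expectations of polynomials tending to f at the rate 4 ^ -k converge
    in L1 and almost everywhere; the defining integrals pass to the limit. *)
Lemma condexp_exists n f : inL1 P f ->
  exists g, is_condexp P (coord_salgebra n) f g.
Proof.
move=> f1; have [mf _] := f1; have [p hp] := L1_dense_seq f1.
have dp := dense_seq_diff mf hp.
pose g k := teval (tmult (Em R n) (p k)).
have mg k : measurable_fun setT (g k) by exact: measurable_teval.
have dg m k : (k <= m)%N ->
    (L1norm P (fun x => g m x - g k x)%R <= (16 * 4^-1 ^+ k)%:E)%E.
  move=> km; apply: (le_trans (condexp_seq n (p m) (p k))).
  apply: (@le_trans _ _ (4%:E * (4 * 4^-1 ^+ k)%:E)%E).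
    by apply: lee_wpmul2l => //; exact: dp.
  by rewrite -EFinM mulrA -natrM.
have gc k : (P [set x | (2^-1 ^+ k <= modC (g k.+1 x - g k x))%R] <= (16 * 2^-1 ^+ k)%:E)%E.
  have k0 : 0 < 2^-1 ^+ k :> R by rewrite exprn_gt0 // invr_gt0.
  have mk : measurable_fun setT (fun x => g k.+1 x - g k x) by exact: cmeasB.
  have := le_trans (Lpint_chebyshev P (isT : (0 < 1)%N) mk (ltW k0)) (dg _ _ (leqnSn k)).
  rewrite expr1 -lee_pdivlMl // => /le_trans; apply.
  rewrite -EFinM lee_fin le_eqVlt; apply/orP; left; apply/eqP.
  have := rapid_tail k (ler0n R 4); rewrite -mulrA => h.
  rewrite -[16]/((4 * 4)%N%:R) natrM -h; ring.
have cl k : (L1norm P (fun x => climit g x - g k x)%R <= (16 * 4^-1 ^+ k)%:E)%E.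
  by apply: (climit_L1 mg gc); exists k => // m /= km; exact: dg.
have mc := measurable_climit mg.
have ic k : inL1 P (fun x => climit g x - g k x).
  by split; [exact: cmeasB|apply: le_lt_trans (cl k) (ltry _)].
have c1 : inL1 P (climit g).
  have -> : climit g = (fun x => (climit g x - g 0%N x) + g 0%N x).
    by apply/funext => x; rewrite subrK.
  by apply: inL1D => //; exact: inL1_teval.
exists (climit g); apply/is_condexpP; split; first exact: c1.
  have tg k x : g k (truncate n x) = g k x.
    by have /is_condexpP[_ h _] := is_condexp_teval n (p k); exact: h.
  by move=> x; exact: climit_eq.
move=> D lD; have [mD _] := lD.
apply/eqP; rewrite -subr_eq0; apply/eqP; apply: modC_eq0.
(* 34 = 2 * 16 + 2, from the L1 distances of g k to its limit and of p k to f *)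
apply/eqP; rewrite eq_le modC_ge0 andbT; apply: (@quarter_small _ 34) => k.
have gE : Cintegral P D (g k) = Cintegral P D (teval (p k)).
  by have /is_condexpP[_ _ ->] := is_condexp_teval n (p k).
have i2 : inL1 P (fun x => f x - teval (p k) x) by apply: inL1B => //; exact: inL1_teval.
have -> : Cintegral P D (climit g) - Cintegral P D f =
    Cintegral P D (fun x => climit g x - g k x)%R -
    Cintegral P D (fun x => f x - teval (p k) x)%R.
  rewrite !CintegralB //; try exact: inL1_teval.
  by rewrite gE; ring.
apply: (le_trans (modCB _ _)); rewrite -lee_fin EFinD.
apply: (@le_trans _ _ (2%:E * (16 * 4^-1 ^+ k)%:E + 2%:E * (4^-1 ^+ k)%:E)%E).
  apply: leeD.
    by apply: (le_trans (modC_Cintegral mD (ic k))); apply: lee_wpmul2l.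
  by apply: (le_trans (modC_Cintegral mD i2)); apply: lee_wpmul2l.
rewrite -!EFinM -EFinD lee_fin le_eqVlt; apply/orP; left; apply/eqP; ring.
Qed.

Lemma condexpP n f : inL1 P f ->
  is_condexp P (coord_salgebra n) f (condexp P (coord_salgebra n) f).
Proof. by move=> f1; apply: (xgetPex (cst 0) (condexp_exists n f1)). Qed.

(** The conjugates of polynomials tending to f at the rate 4 ^ -k form a Cauchy
    sequence for the weak L1 norm, hence converge almost everywhere, and Fatou's
    lemma turns this into convergence for the weak norm. *)
Lemma conjugate_exists j f : inL1 P f -> exists g, conjugate_L1 j f g.
Proof.
move=> f1; have [mf _] := f1; have [p hp] := L1_dense_seq f1.
have dp := dense_seq_diff mf hp.
pose g k := teval (tmult (Hm R j) (p k)).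
have mg k : measurable_fun setT (g k) by exact: measurable_teval.
have weak m k (y : R) : (k <= m)%N -> 0 < y ->
    (P [set x | (y <= modC (g m x - g k x))%R] <= (128 / y * (4 * 4^-1 ^+ k))%:E)%E.
  move=> km y0.
  have pair := conjugate_L2B (conjugate_L2_teval j (p m)) (conjugate_L2_teval j (p k)).
  apply: (le_trans (conjugate_L2_weak pair y0)).
  rewrite [X in (_ <= X)%E]EFinM; apply: lee_wpmul2l; last exact: dp.
  by rewrite lee_fin divr_ge0 // ltW.
have gc k : (P [set x | (2^-1 ^+ k <= modC (g k.+1 x - g k x))%R] <=
    (4 * 128 * 2^-1 ^+ k)%:E)%E.
  have k0 : 0 < 2^-1 ^+ k :> R by rewrite exprn_gt0 // invr_gt0.
  by apply: (le_trans (weak _ _ _ (leqnSn k) k0)); rewrite rapid_tail.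
have mc := measurable_climit mg.
have wk k : (weakL1norm P (fun x => modC (g k x - climit g x))%R <= (512 * 4^-1 ^+ k)%:E)%E.
  apply: ge_ereal_sup => _ [y /= y0 <-].
  have -> : (512 * 4^-1 ^+ k)%:E = (y%:E * (128 / y * (4 * 4^-1 ^+ k))%:E)%E.
    rewrite -EFinM; congr (_%:E); have -> : 512 = 128 * 4 :> R by rewrite -natrM.
    by field; exact: lt0r_neq0.
  apply: lee_wpmul2l; first by rewrite lee_fin ltW.
  have -> : [set x | (y < `|modC (g k x - climit g x)|)%R] =
      [set x | (y < modC (climit g x - g k x))%R].
    by apply/seteqP; split => x /=; rewrite ger0_norm ?modC_ge0 // modCBC.
  apply: (climit_weak mg gc); exists k => // m /= km.
  apply: le_trans (weak m k y km y0); apply: le_measure; rewrite ?inE.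
  - by apply: measurable_gt_set; apply: measurable_modC; exact: cmeasB.
  - by apply: measurable_ge_set; apply: measurable_modC; exact: cmeasB.
  - by move=> x /ltW.
have cvg0 (C : R) : (C * 4^-1 ^+ k)%:E @[k --> \oo] --> 0%E.
  apply/fine_cvgP; split; first exact: nearW.
  rewrite -[X in _ --> X](mulr0 C); apply: cvgM; first exact: cvg_cst.
  by apply: cvg_expr; rewrite ger0_norm ?invr_ge0 // invf_lt1 // ltr1n.
exists (climit g); split => //; exists (fun k => teval (p k)), g; split.
- by move=> k; exact: conjugate_L2_teval.
- apply: (squeeze_cvge _ (cvg_cst 0%E) (cvg0 1)).
  apply: nearW => k; rewrite mul1r; apply/andP; split; first exact: (Lpint_ge0 P 1).
  apply: le_trans (hp k).
  by rewrite le_eqVlt; apply/orP; left; apply/eqP; apply: eq_integral => x _ /=; rewrite modCBC.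
- apply: (squeeze_cvge _ (cvg_cst 0%E) (cvg0 512)).
  apply: nearW => k; rewrite wk andbT.
  apply: (@le_trans _ _ (1%:E * P [set x | (1 < `|modC (g k x - climit g x)|)%R])%E).
    by rewrite mule_ge0.
  apply: ereal_sup_ubound; exists (1 : R) => //=; exact: ltr01.
Qed.

Lemma conjugateP j f : inL1 P f -> conjugate_L1 j f (conjugate j f).
Proof. by move=> f1; apply: (xgetPex (cst 0) (conjugate_exists j f1)). Qed.

(** Both g and the conjugate of p are compared with the conjugate v k of some u k
    close to f: the distance to g, at level y / 4, contributes 4, and the weak
    inequality for u k - p, at level y / 2, contributes 128 * 2 * 4. *)
Lemma conjugate_L1_weak j f g (p : tr) (y e : R) : inL1 P f -> conjugate_L1 j f g ->
  0 < y -> 0 < e -> (L1norm P (fun x => f x - teval p x)%R <= e%:E)%E ->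
  (P [set x | (y <= modC (g x - teval (tmult (Hm R j) p) x))%R] <= (1028 / y * e)%:E)%E.
Proof.
move=> f1 [mg [u [v [uv cu cv]]]] y0 e0 fp; have [mf _] := f1.
have [k [uk vk]] : exists k, (L1norm P (u k \- f)%R <= e%:E)%E /\
    (weakL1norm P (fun x => modC (v k x - g x))%R <= e%:E)%E.
  have small (a : nat -> \bar R) : a @ \oo --> 0%E -> \forall k \near \oo, (a k <= e%:E)%E.
    move=> /fine_cvgP[fin /cvgr0Pnorm_lt /(_ e e0) ca].
    apply: filterS2 fin ca => k fk ak; rewrite -(fineK fk) lee_fin.
    by apply: ltW; exact: le_lt_trans (ler_norm _) ak.
  near \oo => k; exists k; split; near: k; [exact: small cu|exact: small cv].
have [uk2 vk2 _] := uv k; have [muk _] := inL2_inL1 uk2; have [mvk _] := vk2.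
have mp := measurable_teval (tmult (Hm R j) p).
have y4 : 0 < y / 4 by rewrite divr_gt0.
have y2 : 0 < y / 2 by rewrite divr_gt0.
pose A := [set x | y / 4 < modC (v k x - g x)].
pose B := [set x | y / 2 <= modC (v k x - teval (tmult (Hm R j) p) x)].
have mA : measurable A by apply: measurable_gt_set; apply: measurable_modC; exact: cmeasB.
have mB : measurable B by apply: measurable_ge_set; apply: measurable_modC; exact: cmeasB.
have PA : (P A <= (4 / y * e)%:E)%E.
  have h : ((y / 4)%:E * P A <= e%:E)%E.
    apply: le_trans vk; apply: ereal_sup_ubound; exists (y / 4) => //=.
    congr (_ * P _)%E; apply/seteqP; split => x /=; rewrite ger0_norm ?modC_ge0 //.
  have -> : 4 / y * e = (y / 4)^-1 * e by field; exact: lt0r_neq0.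
  by rewrite EFinM lee_pdivlMl.
have PB : (P B <= (128 / (y / 2) * (4 * e))%:E)%E.
  have pair := conjugate_L2B (uv k) (conjugate_L2_teval j p).
  apply: (le_trans (conjugate_L2_weak pair y2)).
  rewrite [X in (_ <= X)%E]EFinM; apply: lee_wpmul2l.
    by rewrite lee_fin divr_ge0 // ltW.
  have muf : measurable_fun setT (fun x => u k x - f x) by exact: cmeasB.
  have mfp : measurable_fun setT (fun x => f x - teval p x).
    by apply: cmeasB => //; exact: measurable_teval.
  have -> : (fun x => u k x - teval p x) = (fun x => (u k x - f x) + (f x - teval p x)).
    by apply/funext => x; rewrite addrA subrK.
  apply: (le_trans (LpintD P 1 muf mfp)).
  apply: (@le_trans _ _ (2%:E * (e%:E + e%:E))%E).
    by rewrite expr1; apply: lee_wpmul2l => //; exact: leeD.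
  by rewrite -EFinD -EFinM lee_fin le_eqVlt; apply/orP; left; apply/eqP; ring.
apply: (@le_trans _ _ (P (A `|` B))).
  apply: le_measure; rewrite ?inE.
  - by apply: measurable_ge_set; apply: measurable_modC; exact: cmeasB.
  - exact: measurableU.
  move=> x /= hx; apply: contrapT => /not_orP[/negP nA /negP nB].
  move: hx; apply/negP; rewrite -ltNge.
  rewrite -leNgt in nA; rewrite -ltNge in nB.
  have -> : g x - teval (tmult (Hm R j) p) x =
    - (v k x - g x) + (v k x - teval (tmult (Hm R j) p) x) by ring.
  apply: (le_lt_trans (modCD _ _)); rewrite modCN.
  apply: (lt_le_trans (ler_ltD nA nB)).
  have -> : y / 4 + y / 2 = y - y / 4 by field.
  by rewrite gerBl ltW.
apply: (le_trans (measureU2 P mA mB)); apply: (le_trans (leeD PA PB)).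
rewrite -EFinD lee_fin.
rewrite le_eqVlt; apply/orP; left; apply/eqP; field; exact: lt0r_neq0.
Unshelve. all: by end_near.
Qed.

End existence.

(** * The maximal operator *)

Section maximal.
Variables (R : realType) (N : nat).
Local Notation P := (torus_prob R N).
Local Notation tr := (trig R N).
Implicit Types (f : torus R N -> R[i]).

(** The multiplier of the martingale difference in coordinate j. *)
Definition Dm (j : 'I_N) (z : 'I_N -> int) : R[i] := Em R j.+1 z - Em R j z.

Lemma teval_Dm j (p : tr) x : teval (tmult (Dm j) p) x =
  teval (tmult (Em R j.+1) p) x - teval (tmult (Em R j) p) x.
Proof. by rewrite !teval_mult -sumrB; apply: eq_bigr => t _; rewrite -mulrBl. Qed.

Lemma teval_Tm n (p : tr) x : teval (tmult (Tm R n) p) x =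
  \sum_(j < N | (j < n)%N) teval (tmult (Hm R j) (tmult (Dm j) p)) x.
Proof.
rewrite teval_mult; under eq_bigr do rewrite /Tm mulr_suml.
rewrite exchange_big; apply: eq_bigr => j _ /=.
by rewrite teval_mult big_map; apply: eq_bigr => t _ /=; rewrite /Dm; ring.
Qed.

Lemma inL1_mdiff f (j : 'I_N) : inL1 P f -> inL1 P (mdiff j.+1 f).
Proof.
by move=> f1; apply: inL1B; [have [] := condexpP j.+1 f1|have [] := condexpP j f1].
Qed.

Lemma mdiff_close f (j : 'I_N) (p : tr) (e : R) : inL1 P f ->
  (L1norm P (fun x => f x - teval p x)%R <= e%:E)%E ->
  (L1norm P (fun x => mdiff j.+1 f x - teval (tmult (Dm j) p) x)%R <= (16 * e)%:E)%E.
Proof.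
move=> f1 fp; have p1 := inL1_teval p; have fp1 := inL1B f1 p1.
have E n := is_condexpB f1 p1 (condexpP n f1) (is_condexp_teval n p).
have c n : (L1norm P (fun x => condexp P (coord_salgebra n) f x -
    teval (tmult (Em R n) p) x)%R <= (4 * e)%:E)%E.
  apply: (le_trans (condexp_contraction fp1 (E n))).
  by rewrite EFinM; apply: lee_wpmul2l.
have mE n : measurable_fun setT (fun x => condexp P (coord_salgebra n) f x -
    teval (tmult (Em R n) p) x).
  by have [_ [mh _] _] := E n.
have -> : (fun x => mdiff j.+1 f x - teval (tmult (Dm j) p) x) =
    (fun x => (condexp P (coord_salgebra j.+1) f x - teval (tmult (Em R j.+1) p) x) -
              (condexp P (coord_salgebra j) f x - teval (tmult (Em R j) p) x)).
  by apply/funext => x; rewrite teval_Dm /=; ring.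
apply: (le_trans (LpintB P 1 (mE _) (mE _))).
apply: (@le_trans _ _ (2%:E * ((4 * e)%:E + (4 * e)%:E))%E).
  by rewrite expr1; apply: lee_wpmul2l => //; apply: leeD; exact: c.
by rewrite -EFinD -EFinM lee_fin le_eqVlt; apply/orP; left; apply/eqP; ring.
Qed.

Lemma max_tsq_weak (r : tr) (y : R) : 0 < y ->
  (P [set x | exists n, (y <= modC (teval (tmult (Tm R n) (tsq r)) x))%R] <=
   (2 / y)%:E * L1norm P (teval (tsq r)))%E.
Proof.
move=> y0; rewrite -tmean_tsq -EFinM.
have -> : 2 / y * ReC (tmean (tprod r (tconj r))) =
  2 * ReC (tmean (tprod r (tconj r))) / y by ring.
apply: le_trans (max_weak_type y0 (ReC_tprodJ_ge0 r)).
rewrite (_ : [set x | _] = [set x | exists n,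
  (y <= `|ReC (teval (tmult (Tm R n) (tprod r (tconj r))) x)|)%R]) //.
have E n x : modC (teval (tmult (Tm R n) (tsq r)) x) =
    `|ReC (teval (tmult (Tm R n) (tprod r (tconj r))) x)|.
  by rewrite teval_mult_sym ?modC_real // => z; exact: TmN.
by apply/seteqP; split => x [n h]; exists n; rewrite E in h *.
Qed.

Lemma measurable_max_tsq (r : tr) (y : R) :
  measurable [set x | exists n, (y <= modC (teval (tmult (Tm R n) (tsq r)) x))%R].
Proof.
rewrite (_ : [set x | _] = \bigcup_n [set x | (y <= modC (teval (tmult (Tm R n) (tsq r)) x))%R]).
  apply: bigcup_measurable => n _; apply: measurable_ge_set; apply: measurable_modC.
  exact: measurable_teval.
by apply/seteqP; split => x [n]; [move=> h; exists n|move=> _ h; exists n].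
Qed.

Let hj f j := conjugate j (mdiff j.+1 f).

Lemma maximal_op_gt f (y : R) : 0 < y ->
  [set x | (y < `|maximal_op f x|)%R] =
  [set x | exists n : 'I_N, (y < modC (\sum_(j < N | (j <= n)%N) hj f j x))%R].
Proof.
move=> y0; have M0 x : 0 <= maximal_op f x by exact: bigmax_ge_id.
apply/seteqP; split => x /=; rewrite ger0_norm //.
  move=> yM; apply: contrapT => h; move: yM; apply/negP; rewrite -leNgt.
  apply: bigmax_le; first exact: ltW.
  by move=> n _; rewrite leNgt; apply/negP => yn; apply: h; exists n.
move=> [n yn]; apply: (lt_le_trans yn).
exact: (le_bigmax _ (fun n : 'I_N => modC (\sum_(j < N | (j <= n)%N) hj f j x))).
Qed.

(** A union bound at the levels y / 8 for the maximal functions of the four squared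
    moduli and y / (2 N) for the N errors. The constant is 4 * 16 * 2: four pieces,
    the weak constant 2 at level y / 8, and the factor 2 of [tsq_L1norm_le]. *)
Lemma maximal_weak_level f (y : R) : (0 < N)%N -> inL1 P f -> 0 < y ->
  (P [set x | (y < `|maximal_op f x|)%R] <= (128 / y)%:E * L1norm P f)%E.
Proof.
move=> N0 f1 y0; have [mf f1'] := f1.
have n0 : (0 <= L1norm P f)%E by exact: (Lpint_ge0 P 1).
have nE : L1norm P f = (fine (L1norm P f))%:E by rewrite fineK // ge0_fin_numE.
have h1 j : conjugate_L1 j (mdiff j.+1 f) (hj f j).
  by apply: conjugateP; exact: inL1_mdiff.
have mh j : measurable_fun setT (hj f j) by have [] := h1 j.
have NR : 0 < N%:R :> R by rewrite ltr0n.
(* K collects the coefficients of the approximation error e1, including those that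
   grow with N, so that e1 = e / K makes the total error e *)
pose K := 128 / y + N%:R * (1028 / (y / (2 * N%:R)) * 16).
have pos n : 0 < n.+1%:R :> R by rewrite ltr0n.
have yN : 0 < y / (2 * N%:R) by rewrite divr_gt0 // mulr_gt0.
have y8 : 0 < y / 8 := divr_gt0 y0 (pos 7).
have K0 : 0 < K.
  apply: addr_gt0; first exact: divr_gt0 (pos _) y0.
  exact: mulr_gt0 NR (mulr_gt0 (divr_gt0 (pos _) yN) (pos _)).
apply/lee_addgt0Pr => e e0; pose e1 := e / K.
have e10 : 0 < e1 by rewrite divr_gt0.
have [r [hr hk]] := tcomb_approx (isT : (0 < 1 <= 2)%N) mf f1' e10.
pose Q := tcomb r; pose DQ j := teval (tmult (Hm R j) (tmult (Dm j) Q)).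
pose B (k : 'I_4) := [set x | exists n, y / 8 <= modC (teval (tmult (Tm R n) (tsq (r k))) x)].
pose E (j : 'I_N) := [set x | y / (2 * N%:R) <= modC (hj f j x - DQ j x)].
have mB k : measurable (B k) by exact: measurable_max_tsq.
have mE j : measurable (E j).
  apply: measurable_ge_set; apply: measurable_modC; apply: cmeasB => //.
  exact: measurable_teval.
have PB k : (P (B k) <= (16 / y * (2 * (fine (L1norm P f) + e1)))%:E)%E.
  apply: (le_trans (max_tsq_weak (r k) y8)).
  have -> : 2 / (y / 8) = 16 / y by field; exact: lt0r_neq0.
  rewrite [X in (_ <= X)%E]EFinM; apply: lee_wpmul2l.
    by rewrite lee_fin divr_ge0 // ltW.
  have -> : (2 * (fine (L1norm P f) + e1))%:E = (2%:E * (L1norm P f + e1%:E))%E.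
    by rewrite [in RHS]nE.
  exact: (@tsq_L1norm_le _ _ k).
have PE j : (P (E j) <= (1028 / (y / (2 * N%:R)) * (16 * e1))%:E)%E.
  apply: (@conjugate_L1_weak _ _ j (mdiff j.+1 f)) => //.
  - exact: inL1_mdiff.
  - by rewrite mulr_gt0.
  - exact: mdiff_close.
have [mUB PUB] := @prob_unionI _ _ _ P 4 B _ (le_trans (measure_ge0 _ _) (PB ord0)) mB PB.
have [mUE PUE] := @prob_unionI _ _ _ P N E _
  (le_trans (measure_ge0 _ _) (PE (Ordinal N0))) mE PE.
have mM : measurable [set x | exists n : 'I_N,
    (y < modC (\sum_(j < N | (j <= n)%N) hj f j x))%R].
  apply: (@prob_unionI _ _ _ P N (fun n => [set x | (y < modC (\sum_(j < N | (j <= n)%N) hj f j x))%R])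
    +oo%E _ _ _).1 => //.
  - by move=> n; apply: measurable_gt_set; apply: measurable_modC; exact: cmeas_sum.
  - by move=> n; exact: leey.
rewrite maximal_op_gt //.
apply: (@le_trans _ _ (P ([set x | exists k, B k x] `|` [set x | exists j, E j x]))).
  apply: le_measure; rewrite ?inE //; first exact: measurableU.
  move=> x [n yn]; apply: contrapT => /not_orP[nB nE'].
  move: yn; apply/negP; rewrite -leNgt.
  have -> : \sum_(j < N | (j <= n)%N) hj f j x =
      \sum_(j < N | (j <= n)%N) (hj f j x - DQ j x) + teval (tmult (Tm R n.+1) Q) x.
    by rewrite teval_Tm -big_split; apply: eq_bigr => j _ /=; rewrite subrK.
  apply: (le_trans (modCD _ _)).
  have -> : y = y / (2 * N%:R) *+ N + y / 8 *+ 4.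
    by rewrite -mulr_natr; field; exact: lt0r_neq0.
  apply: lerD.
    apply: (le_trans (modC_sum _ _ _)).
    rewrite -[X in _ <= _ *+ X](card_ord N) -sumr_const big_mkcond.
    apply: ler_sum => j _; case: ifP => _; last exact: ltW.
    by rewrite leNgt; apply/negP => h; apply: nE'; exists j; exact: ltW.
  rewrite teval_mult_comb; apply: (le_trans (modC_sum _ _ _)).
  rewrite -[X in _ <= _ *+ X](card_ord 4) -sumr_const; apply: ler_sum => k _.
  rewrite modCM modCX modCi expr1n mul1r leNgt; apply/negP => h.
  by apply: nB; exists k; exists n.+1; exact: ltW.
apply: (le_trans (measureU2 P mUB mUE)); apply: (le_trans (leeD PUB PUE)).
rewrite -!EFinM -EFinD nE -EFinM -EFinD lee_fin le_eqVlt; apply/orP; left; apply/eqP.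
have -> : e = K * e1 by rewrite /e1 mulrCA mulfV ?mulr1 // lt0r_neq0.
by rewrite /K; ring.
Qed.

Lemma maximal_weak_type f : (0 < N)%N -> inL1 P f ->
  (weakL1norm P (maximal_op f) <= 128%:E * L1norm P f)%E.
Proof.
move=> N0 f1; apply: ge_ereal_sup => _ [y /= y0 <-].
have -> : (128%:E * L1norm P f = y%:E * ((128 / y)%:E * L1norm P f))%E.
  by rewrite muleA -EFinM mulrCA mulfV ?mulr1 // lt0r_neq0.
apply: lee_wpmul2l; first by rewrite lee_fin ltW.
exact: maximal_weak_level.
Qed.

End maximal.

Theorem theorem1p1 (R : realType) :
  exists A : R, forall (N : nat) (f : torus R N -> R[i]),
    (0 < N)%N ->
    inL1 (torus_prob R N) f ->
    (weakL1norm (torus_prob R N) (maximal_op f)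
       <= A%:E * L1norm (torus_prob R N) f)%E.
Proof. by exists 128 => N f N0 f1; exact: maximal_weak_type. Qed.
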